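(* Let $(F,v)$ be a Henselian valued field and let $A$ be a finite-dimensional simple $F$-algebra with an $F$-linear involution $\sigma$. Let $K=Z(A)$ and assume that $F$ is the subfield of $K$ fixed under $\sigma$. Assume that $A$ is tame over $F$ and, if $\operatorname{char}(\overline{F})=2$, that $\sigma$ is not orthogonal. If $g$ is a $v$-gauge on $A$ that is invariant under $\sigma$, the following conditions are equivalent: (a) $\sigma$ is anisotropic; (b) $\tilde\sigma$ is anisotropic; (c) $\sigma_0$ is anisotropic.
   Context: Fix a divisible totally ordered abelian group $\Gamma$; all valuations and value functions take values in $\Gamma\cup\{\infty\}$. For a valued field $(F,v)$, $\overline{F}$ is the residue field. A $v$-value function on an $F$-vector space $V$ is a map $\alpha\colon V\to\Gamma\cup\{\infty\}$ with (i) $\alpha(x)=\infty$ iff $x=0$; (ii) $\alpha(x+y)\ge\min(\alpha(x),\alpha(y))$; (iii) $\alpha(xc)=\alpha(x)+v(c)$ for $x,y\in V$, $c\in F$. It is a $v$-norm if $V$ is finite-dimensional and has a base $(e_i)_{i=1}^n$ with $\alpha(\sum e_ic_i)=\min_i\alpha(e_ic_i)$ for all $c_i\in F$. A $v$-value function $g$ on an $F$-algebra $A$ is surmultiplicative if $g(1)=0$ and $g(xy)\ge g(x)+g(y)$. For a surmultiplicative $g$ put $A^{\ge\gamma}=\{x\mid g(x)\ge\gamma\}$, $A^{>\gamma}=\{x\mid g(x)>\gamma\}$, $A_\gamma=A^{\ge\gamma}/A^{>\gamma}$, $\mathrm{gr}_g(A)=\bigoplus_{\gamma\in\Gamma}A_\gamma$,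 a graded algebra over $\mathrm{gr}(F)=\mathrm{gr}_v(F)$. For $x\ne0$, $\tilde x=x+A^{>g(x)}$, $\tilde0=0$, and $\tilde a\tilde b=ab+A^{>g(a)+g(b)}$. A surmultiplicative $v$-value function $g$ on $A$ is a $v$-gauge if it is a $v$-norm and $\mathrm{gr}_g(A)$ has no nonzero nilpotent homogeneous two-sided ideal. An $F$-linear involution on $A$ is an $F$-linear map $\sigma$ with $\sigma(xy)=\sigma(y)\sigma(x)$ and $\sigma^2=\mathrm{id}$. $g$ is invariant under $\sigma$ if $g\circ\sigma=g$; then $\tilde\sigma$ is the involution on $\mathrm{gr}_g(A)$ with $\tilde\sigma(\tilde x)=\widetilde{\sigma(x)}$, and $\sigma_0$ is its degree-$0$ component, an involution on the residue algebra $A_0=A^{\ge0}/A^{>0}$. An involution $\sigma$ (or $\sigma_0$) is anisotropic if $\sigma(x)x=0$ only for $x=0$; $\tilde\sigma$ is anisotropic if no nonzero homogeneous $\xi$ satisfies $\tilde\sigma(\xi)\xi=0$. Types of involutions on a simple algebra $A$ with $[A:Z(A)]=n^2$: $\sigma$ is unitary if $\sigma|_{Z(A)}\ne\mathrm{id}$. If $\sigma|_{Z(A)}=\mathrm{id}$, $\sigma$ is symplectic if either $\operatorname{char}(F)\ne2$ and $\dim_{Z(A)}\{x\mid\sigma(x)=x\}=\frac12n(n-1)$, or $\operatorname{char}(F)=2$ and $1\in\{x+\sigma(x)\mid x\in A\}$; otherwise it is orthogonal. ''$A$ is tame over $F$'' means that $A$ is split by the maximal tamely ramified extension of $K$ (for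 the unique extension of $v$ to $K$) and that $K$ is tame over $F$. A finite extension of Henselian valued fields is tame if it is defectless, has separable residue field extension, and its ramification index is not divisible by the residue characteristic. *)

(* Defs.v *)
From HB Require Import structures.
From mathcomp Require Import all_boot all_order all_algebra all_field.

Set Implicit Arguments.
Unset Strict Implicit.
Unset Printing Implicit Defensive.

Import Order.TTheory GRing.Theory.
Local Open Scope ring_scope.
Local Open Scope quotient_scope.

Record divOrderedGroupType := DivOrderedGroup {
  dog_sort :> porderZmodType;
  dog_total : total (<=%R : rel dog_sort);
  dog_leD2l : forall x y z : dog_sort, x <= y -> z + x <= z + y;
  dog_divisible : forall (n : nat) (x : dog_sort),
    (0 < n)%N -> exists y, y *+ n = x
}.

(* The monoid G \cup {oo} is [option G], with [None] in the role of oo. *)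
Section ExtendedValues.
Variable G : divOrderedGroupType.
Implicit Types a b c : option G.

Definition ele a b : bool :=
  match a, b with
  | _, None => true
  | None, Some _ => false
  | Some x, Some y => x <= y
  end.
Definition elt a b : bool := ~~ ele b a.
Definition emin a b := if ele a b then a else b.
Definition eadd a b : option G :=
  match a, b with
  | Some x, Some y => Some (x + y)
  | _, _ => None
  end.

Lemma ele_refl a : ele a a.
Proof. by case: a => //= x. Qed.

Lemma ele_trans b a c : ele a b -> ele b c -> ele a c.
Proof. by case: a b c => [x|] [y|] [z|] //=; apply: le_trans. Qed.

Lemma ele_total a b : ele a b || ele b a.
Proof. by case: a b => [x|] [y|] //=; apply: dog_total. Qed.

Lemma eltW a b : elt a b -> ele a b.
Proof. by rewrite /elt; case: (ele a b) (ele_total a b) => //= ->. Qed.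

Lemma elt_le_trans b a c : elt a b -> ele b c -> elt a c.
Proof.
by move=> ab bc; apply: contra ab => ca; apply: ele_trans ca.
Qed.

Lemma ele_lt_trans b a c : ele a b -> elt b c -> elt a c.
Proof.
by move=> ab bc; apply: contra bc => ca; apply: ele_trans ab.
Qed.

Lemma ele_emin a b c : ele a (emin b c) = ele a b && ele a c.
Proof.
rewrite /emin; case: ifPn => bc.
  by case ab: (ele a b) => //=; rewrite (ele_trans ab bc).
case ac: (ele a c); rewrite ?andbF // andbT.
by rewrite (ele_trans ac) //; case/orP: (ele_total b c) bc => ->.
Qed.

Lemma elt_emin a b c : elt a (emin b c) = elt a b && elt a c.
Proof.
rewrite /emin; case: ifPn => bc.
  by case ab: (elt a b) => //=; rewrite (elt_le_trans ab bc).
case ac: (elt a c); rewrite ?andbF // andbT.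
by rewrite (elt_le_trans ac) //; case/orP: (ele_total b c) bc => ->.
Qed.

Lemma ele_add a b c d : ele a c -> ele b d -> ele (eadd a b) (eadd c d).
Proof.
case: a b c d => [x|] [y|] [z|] [t|] //= xz yt.
apply: (@le_trans _ _ (x + t)); first exact: dog_leD2l.
by rewrite ![_ + t]addrC; apply: dog_leD2l.
Qed.

Lemma elt_addl (x : G) a b c : ele (Some x) a -> elt b c ->
  elt (eadd (Some x) b) (eadd a c).
Proof.
rewrite /elt; case: a b c => [z|] [y|] [t|] //= xz; apply: contraNN => h.
have := dog_leD2l (- x) (le_trans (dog_leD2l t xz) (_ : t + z <= x + y)).
by rewrite addKr addrCA addNr addr0; apply; rewrite addrC.
Qed.

Lemma eaddC a b : eadd a b = eadd b a.
Proof. by case: a b => [x|] [y|] //=; rewrite addrC. Qed.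

Lemma eadd_self0 a : eadd a a = Some 0 -> a = Some 0.
Proof.
case: a => //= x [xx0]; congr Some; apply/eqP; rewrite eq_le.
have h y : y + y = 0 -> 0 <= y :> G.
  move=> yy; case/orP: (@dog_total G y 0) => // y0.
  by have := dog_leD2l y y0; rewrite yy addr0.
rewrite h // andbT; have /(dog_leD2l x) : 0 <= - x.
  by apply: h; rewrite -opprD xx0 oppr0.
by rewrite addr0 subrr.
Qed.

End ExtendedValues.

Section ValueFunctions.
Variable G : divOrderedGroupType.

Record valuation (F : fieldType) := Valuation {
  val_fun :> F -> option G;
  val_oo : forall x, val_fun x = None <-> x = 0;
  val_D : forall x y, ele (emin (val_fun x) (val_fun y)) (val_fun (x + y));
  val_M : forall x y, val_fun (x * y) = eadd (val_fun x) (val_fun y)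
}.

Definition value_function (F : fieldType) (v : valuation F) (V : lmodType F)
    (alpha : V -> option G) : Prop :=
  [/\ forall x, alpha x = None <-> x = 0,
      forall x y, ele (emin (alpha x) (alpha y)) (alpha (x + y)) &
      forall x c, alpha (c *: x) = eadd (alpha x) (v c)].

Definition is_norm (F : fieldType) (v : valuation F) (V : vectType F)
    (alpha : V -> option G) : Prop :=
  value_function v alpha /\
  exists (n : nat) (e : n.-tuple V), basis_of fullv e /\
    forall c : 'I_n -> F, alpha (\sum_i c i *: e`_i)
      = \big[@emin G/None]_i alpha (c i *: e`_i).

Record surmultiplicative (F : fieldType) (v : valuation F) (A : falgType F) :=
  Surmultiplicative {
    sm_fun :> A -> option G;
    sm_value_function : value_function v sm_fun;
    sm_1 : sm_fun 1 = Some 0;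
    sm_M : forall x y, ele (eadd (sm_fun x) (sm_fun y)) (sm_fun (x * y))
  }.

(* The common part of valuations on fields and of surmultiplicative value
   functions on algebras; the associated graded ring only depends on it. *)
Record ring_value (R : nzRingType) := RingValue {
  rv_fun :> R -> option G;
  rv_oo : forall x, rv_fun x = None <-> x = 0;
  rv_D : forall x y, ele (emin (rv_fun x) (rv_fun y)) (rv_fun (x + y));
  rv_N : forall x, rv_fun (- x) = rv_fun x;
  rv_1 : rv_fun 1 = Some 0;
  rv_M : forall x y, ele (eadd (rv_fun x) (rv_fun y)) (rv_fun (x * y))
}.

Section OfValuation.
Variables (F : fieldType) (v : valuation F).

Lemma val_1 : v 1 = Some 0.
Proof.
case v1: (v 1) => [x|]; last by move/val_oo/eqP: v1; rewrite oner_eq0.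
have := val_M v 1 1; rewrite mulr1 v1 /= => -[] xx.
by congr Some; apply: (addrI x); rewrite addr0 -xx.
Qed.

Lemma val_N1 : v (-1) = Some 0.
Proof. by apply: eadd_self0; rewrite -val_M mulrNN mulr1 val_1. Qed.

Lemma eadd0 (a : option G) : eadd a (Some 0) = a.
Proof. by case: a => //= x; rewrite addr0. Qed.

Lemma val_N x : v (- x) = v x.
Proof. by rewrite -mulrN1 val_M val_N1 eadd0. Qed.

Lemma val_Mle x y : ele (eadd (v x) (v y)) (v (x * y)).
Proof. by rewrite val_M ele_refl. Qed.

Definition rv_of_valuation : ring_value F :=
  RingValue (val_oo v) (val_D v) val_N val_1 val_Mle.

Lemma val_V x : v x = Some 0 -> v x^-1 = Some 0.
Proof.
move=> vx; have x0 : x != 0.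
  by apply/eqP => /(val_oo v); rewrite vx.
have := val_M v x x^-1; rewrite divff // val_1 vx.
by case: (v x^-1) => //= y [->]; rewrite add0r.
Qed.

End OfValuation.

Section OfSurmultiplicative.
Variables (F : fieldType) (v : valuation F) (A : falgType F).
Variable g : surmultiplicative v A.

Lemma sm_oo x : g x = None <-> x = 0.
Proof. by case: (sm_value_function g). Qed.

Lemma sm_D x y : ele (emin (g x) (g y)) (g (x + y)).
Proof. by case: (sm_value_function g). Qed.

Lemma sm_N x : g (- x) = g x.
Proof.
case: (sm_value_function g) => _ _ gZ.
by rewrite -scaleN1r gZ val_N1 eadd0.
Qed.

Definition rv_of_surmultiplicative : ring_value A :=
  RingValue sm_oo sm_D sm_N (sm_1 g) (sm_M g).

End OfSurmultiplicative.
End ValueFunctions.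

Coercion rv_of_valuation : valuation >-> ring_value.
Coercion rv_of_surmultiplicative : surmultiplicative >-> ring_value.

Section Graded.
Variables (G : divOrderedGroupType) (R : nzRingType) (f : ring_value G R).

Definition in_ge (c : G) : pred R := fun x => ele (Some c) (f x).
Definition in_gt (c : G) : pred R := fun x => elt (Some c) (f x).

Fact in_ge_zmod_closed c : zmod_closed (in_ge c).
Proof.
split=> [|x y]; rewrite !unfold_in /in_ge; first by rewrite (rv_oo f 0).2.
move=> hx hy; apply: ele_trans (rv_D f _ _).
by rewrite ele_emin rv_N hx.
Qed.
HB.instance Definition _ c :=
  GRing.isZmodClosed.Build R (in_ge c) (in_ge_zmod_closed c).

Record filtered (c : G) := Filtered {
  filtered_val : R;
  filtered_valP : filtered_val \in in_ge c
}.
HB.instance Definition _ c := [isSub for @filtered_val c].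
HB.instance Definition _ c := [Choice of filtered c by <:].
HB.instance Definition _ c := [SubChoice_isSubZmodule of filtered c by <:].

Definition filtered_gt (c : G) : pred (filtered c) :=
  fun x => in_gt c (val x).

Fact filtered_gt_zmod_closed c : zmod_closed (@filtered_gt c).
Proof.
split=> [|x y]; rewrite !unfold_in /filtered_gt /in_gt.
  by rewrite raddf0 (rv_oo f 0).2.
move=> hx hy; rewrite raddfB; apply: elt_le_trans (rv_D f _ _).
by rewrite elt_emin rv_N hx.
Qed.
HB.instance Definition _ c :=
  GRing.isZmodClosed.Build (filtered c) (@filtered_gt c)
    (filtered_gt_zmod_closed c).

(* The component of degree c of the graded ring; the direct sum itself is only
   handled through its homogeneous components. *)
Definition gr (c : G) :=
  Quotient.quot (GRing.ZmodClosed.clone _ (@filtered_gt c) _).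
HB.instance Definition _ c := GRing.Zmodule.on (gr c).
HB.instance Definition _ c := EqQuotient.on (gr c).

Definition gr_class (c : G) (x : R) (hx : x \in in_ge c) : gr c :=
  \pi_(gr c) (Filtered hx).

Lemma gr_eqE c (x y : filtered c) :
  (\pi_(gr c) x == \pi_(gr c) y) = in_gt c (val x - val y).
Proof. by rewrite -Quotient.idealrBE unfold_in /filtered_gt raddfB. Qed.

Lemma gr_eq0E c (x : filtered c) : (\pi_(gr c) x == 0) = in_gt c (val x).
Proof.
have -> : 0 = \pi_(gr c) 0 by rewrite raddf0.
by rewrite gr_eqE raddf0 addr0.
Qed.

Lemma gr_repr c (x : filtered c) :
  in_gt c (val (repr (\pi_(gr c) x)) - val x).
Proof. by rewrite -gr_eqE reprK. Qed.

Lemma in_geM c d x y :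
  x \in in_ge c -> y \in in_ge d -> x * y \in in_ge (c + d).
Proof.
rewrite !unfold_in /in_ge => hx hy; apply: ele_trans (rv_M f _ _).
exact: (ele_add hx hy).
Qed.

Lemma in_gtMr c d x y : in_ge c x -> in_gt d y -> in_gt (c + d) (x * y).
Proof.
move=> hx hy; apply: elt_le_trans (rv_M f _ _).
exact: (elt_addl hx hy).
Qed.

Lemma in_gtMl c d x y : in_gt c x -> in_ge d y -> in_gt (c + d) (x * y).
Proof.
move=> hx hy; apply: elt_le_trans (rv_M f _ _).
by rewrite eaddC addrC; apply: (elt_addl hy hx).
Qed.

Lemma in_gtD c x y : in_gt c x -> in_gt c y -> in_gt c (x + y).
Proof.
by move=> hx hy; apply: elt_le_trans (rv_D f _ _); rewrite elt_emin; apply/andP.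
Qed.

Definition filtered_mul c d (x : filtered c) (y : filtered d) :
  filtered (c + d) := Filtered (in_geM (filtered_valP x) (filtered_valP y)).

Definition gr_mul c d (a : gr c) (b : gr d) : gr (c + d) :=
  \pi_(gr (c + d)) (filtered_mul (repr a) (repr b)).

Lemma in_gt_mulB c d x x' y y' : in_ge c x' -> in_ge d y ->
  in_gt c (x - x') -> in_gt d (y - y') -> in_gt (c + d) (x * y - x' * y').
Proof.
move=> hx' hy hx hyy.
have -> : x * y - x' * y' = (x - x') * y + x' * (y - y').
  by rewrite mulrBl mulrBr addrA subrK.
by apply: in_gtD; [apply: in_gtMl | apply: in_gtMr].
Qed.

Lemma gr_mulE c d (x : filtered c) (y : filtered d) :
  gr_mul (\pi_(gr c) x) (\pi_(gr d) y) = \pi_(gr (c + d)) (filtered_mul x y).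
Proof.
apply/eqP; rewrite gr_eqE; apply: in_gt_mulB; do ?exact: gr_repr.
  exact: filtered_valP.
exact: filtered_valP.
Qed.

Fact in_ge1 : 1 \in in_ge 0.
Proof. by rewrite unfold_in /in_ge rv_1 ele_refl. Qed.

Definition gr_one : gr 0 := gr_class in_ge1.

(* A homogeneous element together with its degree. *)
Definition homog := {c : G & gr c}.
Definition homog_mul (a b : homog) : homog :=
  Tagged gr (gr_mul (tagged a) (tagged b)).
Definition homog_prod (s : seq homog) : homog :=
  foldr homog_mul (Tagged gr gr_one) s.

(* A homogeneous two-sided ideal, given by its homogeneous components. *)
Record homog_ideal (I : forall c, gr c -> Prop) : Prop := HomogIdeal {
  homog_ideal0 : forall c, I c 0;
  homog_idealB : forall c (a b : gr c), I c a -> I c b -> I c (a - b);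
  homog_idealMl : forall c d (a : gr c) (b : gr d),
    I d b -> I (c + d) (gr_mul a b);
  homog_idealMr : forall c d (a : gr c) (b : gr d),
    I c a -> I (c + d) (gr_mul a b)
}.

(* I ^ n is additively spanned by the products of n homogeneous elements of I,
   so I ^ n = 0 means that all these products vanish. *)
Definition nilpotent_homog_ideal (I : forall c, gr c -> Prop) : Prop :=
  exists n : nat, forall s : n.-tuple homog,
    (forall a, a \in (s : seq homog) -> I (tag a) (tagged a)) ->
    tagged (homog_prod s) = 0.

Definition gr_semisimple : Prop :=
  forall I : (forall c, gr c -> Prop),
    homog_ideal I -> nilpotent_homog_ideal I ->
    forall c (a : gr c), I c a -> a = 0.

(* The ring structure of the component of degree 0. *)
Definition residue := gr 0.
HB.instance Definition _ := GRing.Zmodule.on residue.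

Lemma in_ge0M x y : x \in in_ge 0 -> y \in in_ge 0 -> x * y \in in_ge 0.
Proof. by move=> hx hy; have := in_geM hx hy; rewrite addr0. Qed.

Definition filtered0_mul (x y : filtered 0) : filtered 0 :=
  Filtered (in_ge0M (filtered_valP x) (filtered_valP y)).

Definition res_mul (a b : residue) : residue :=
  \pi_(gr 0) (filtered0_mul (repr a) (repr b)).

Lemma res_mulE (x y : filtered 0) :
  res_mul (\pi_(gr 0) x) (\pi_(gr 0) y) = \pi_(gr 0) (filtered0_mul x y).
Proof.
apply/eqP; rewrite gr_eqE.
have := in_gt_mulB (filtered_valP x) (filtered_valP (repr (\pi_(gr 0) y)))
  (gr_repr x) (gr_repr y).
by rewrite addr0.
Qed.

Lemma pi_gr_eq c (x y : filtered c) : filtered_val x = filtered_val y ->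
  \pi_(gr c) x = \pi_(gr c) y.
Proof. by move=> e; congr (\pi_(gr c) _); apply: val_inj. Qed.

Fact res_mulA : associative res_mul.
Proof.
elim/quotW=> x; elim/quotW=> y; elim/quotW=> z.
rewrite (res_mulE y z) (res_mulE x y) !res_mulE.
by apply: pi_gr_eq; rewrite /= mulrA.
Qed.
Fact res_mul1 : left_id gr_one res_mul.
Proof.
elim/quotW=> x; rewrite res_mulE.
by apply: pi_gr_eq; rewrite /= mul1r.
Qed.
Fact res_mulr1 : right_id gr_one res_mul.
Proof.
elim/quotW=> x; rewrite res_mulE.
by apply: pi_gr_eq; rewrite /= mulr1.
Qed.
Lemma pi_grD c (x y : filtered c) :
  \pi_(gr c) x + \pi_(gr c) y = \pi_(gr c) (x + y).
Proof. by rewrite raddfD. Qed.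
Fact res_mulDl : left_distributive res_mul +%R.
Proof.
elim/quotW=> x; elim/quotW=> y; elim/quotW=> z.
rewrite pi_grD (res_mulE x z) (res_mulE y z) res_mulE pi_grD.
by apply: pi_gr_eq; rewrite /= mulrDl.
Qed.
Fact res_mulDr : right_distributive res_mul +%R.
Proof.
elim/quotW=> x; elim/quotW=> y; elim/quotW=> z.
rewrite pi_grD (res_mulE x y) (res_mulE x z) res_mulE pi_grD.
by apply: pi_gr_eq; rewrite /= mulrDr.
Qed.
Fact res_1neq0 : gr_one != 0 :> residue.
Proof.
by rewrite /gr_one /gr_class gr_eq0E /in_gt rv_1 /elt negbK ele_refl.
Qed.

HB.instance Definition _ := GRing.Zmodule_isNzRing.Build residue
  res_mulA res_mul1 res_mulr1 res_mulDl res_mulDr res_1neq0.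

End Graded.

Section GradedMap.
Variables (G : divOrderedGroupType) (R S : nzRingType).
Variables (f : ring_value G R) (f' : ring_value G S) (s : R -> S).
Hypothesis fs : forall x, f' (s x) = f x.

Fact in_ge_map c x : x \in in_ge f c -> s x \in in_ge f' c.
Proof. by rewrite !unfold_in /in_ge fs. Qed.

Definition filtered_map c (x : filtered f c) : filtered f' c :=
  Filtered (in_ge_map (filtered_valP x)).

(* The map x + R^{>c} |-> s x + S^{>c} induced by a value-preserving s. *)
Definition gr_map c (a : gr f c) : gr f' c := \pi_(gr f' c) (filtered_map (repr a)).

Lemma gr_mapE (s_add : {morph s : x y / x - y}) c (x : filtered f c) :
  gr_map (\pi_(gr f c) x) = \pi_(gr f' c) (filtered_map x).
Proof.
apply/eqP; rewrite gr_eqE /= -s_add /in_gt fs; exact: gr_repr.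
Qed.

Definition residue_map (a : residue f) : residue f' := gr_map a.

End GradedMap.

Section ResidueField.
Variables (G : divOrderedGroupType) (F : fieldType) (v : valuation G F).

Definition residue_field := residue v.
HB.instance Definition _ := GRing.NzRing.on residue_field.

Fact residue_field_mulC : commutative (@GRing.mul residue_field).
Proof.
elim/quotW=> x; elim/quotW=> y.
rewrite -[LHS]/(res_mul _ _) -[RHS]/(res_mul _ _) !res_mulE.
by apply: pi_gr_eq; rewrite /= mulrC.
Qed.
HB.instance Definition _ :=
  GRing.PzRing_hasCommutativeMul.Build residue_field residue_field_mulC.

Definition residue_inv (a : residue_field) : residue_field :=
  if a == 0 then 0 else
  \pi_(gr v 0) (insubd (0 : filtered v 0) (filtered_val (repr a))^-1).

Fact residue_mulVf a : a != 0 -> residue_inv a * a = 1.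
Proof.
move=> a0; rewrite /residue_inv (negPf a0).
have vr : v (filtered_val (repr a)) = Some 0.
  move: a0; rewrite -[X in X == 0]reprK gr_eq0E /in_gt /elt negbK.
  have := filtered_valP (repr a); rewrite unfold_in /in_ge /=.
  by case: (v _) => [x|] //= h1 h2; congr Some; apply/eqP; rewrite eq_le h1 h2.
rewrite -[X in _ * X]reprK -[LHS]/(res_mul _ _) res_mulE.
apply: pi_gr_eq => /=.
rewrite -[filtered_val (insubd _ _)]/(val _) insubdK; last first.
  by change (ele (Some 0) (v (filtered_val (repr a))^-1)); rewrite (val_V vr) ele_refl.
by rewrite mulVf //; apply/eqP => /(val_oo v); rewrite vr.
Qed.
Fact residue_inv0 : residue_inv 0 = 0.
Proof. by rewrite /residue_inv eqxx. Qed.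
HB.instance Definition _ :=
  GRing.ComNzRing_isField.Build residue_field residue_mulVf residue_inv0.

End ResidueField.

Section Extensions.
Variable G : divOrderedGroupType.

Definition extends (F L : fieldType) (i : {rmorphism F -> L})
    (v : valuation G F) (w : valuation G L) : Prop :=
  forall x, w (i x) = v x.

(* As G is divisible, every extension of v to an algebraic extension of F can
   be given values in G. *)
Definition henselian (F : fieldType) (v : valuation G F) : Prop :=
  forall (L : fieldType) (i : {rmorphism F -> L}),
    (forall x : L, algebraicOver i x) ->
    exists w : valuation G L, extends i v w /\
      forall w' : valuation G L, extends i v w' -> w' =1 w.

(* [e] is a basis of [M] for the scalar action [act] of [S]. *)
Definition basis_for (S : Type) (M : nmodType) (act : S -> M -> M)
    (n : nat) (e : 'I_n -> M) : Prop :=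
  forall x : M, exists! c : {ffun 'I_n -> S}, x = \sum_i act (c i) (e i).

Definition ramification_index (F L : fieldType) (v : valuation G F)
    (w : valuation G L) (e : nat) : Prop :=
  exists r : 'I_e -> G,
    (forall i, exists x, w x = Some (r i)) /\
    (forall c, (exists x, w x = Some c) ->
       exists! i, exists y, v y = Some (c - r i)).

Section ResidueExtension.
Variables (F L : fieldType) (i : {rmorphism F -> L}).
Variables (v : valuation G F) (w : valuation G L) (vw : extends i v w).

Definition residue_ext : residue_field v -> residue_field w :=
  @residue_map G F L v w i vw.

Definition residue_degree (d : nat) : Prop :=
  exists b : 'I_d -> residue_field w,
    basis_for (fun c x => residue_ext c * x) b.

Definition residue_separable : Prop :=
  forall x : residue_field w, exists p : {poly residue_field v},
    separable_poly p /\ root (map_poly residue_ext p) x.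

End ResidueExtension.

Definition tame_extension (F : fieldType) (L : fieldExtType F)
    (v : valuation G F) (w : valuation G L) : Prop :=
  exists (vw : extends (in_alg L) v w) (e d : nat),
    [/\ ramification_index v w e,
        residue_degree vw d,
        \dim {:L} = (e * d)%N,
        residue_separable vw &
        forall p : nat, p \in [pchar residue_field v] -> ~~ (p %| e)%N].

(* T is the union of all finite tame extensions of K inside an algebraic
   closure C of K. *)
Definition maximal_tame_extension (K : fieldType) (w : valuation G K)
    (T : fieldType) (j : {rmorphism K -> T}) : Prop :=
  exists (C : closedFieldType) (i : {rmorphism T -> C}),
    (forall z : C, algebraicOver (i \o j) z) /\
    (forall z : C, (exists t, i t = z) <->
       exists (L : fieldExtType K) (wL : valuation G L) (h : {rmorphism L -> C}),
         [/\ tame_extension w wL,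
             forall c : K, h (c%:A) = i (j c) &
             exists l, h l = z]).

End Extensions.

Section Algebras.
Variables (F : fieldType) (A : falgType F).

Definition simple_ring : Prop :=
  forall I : A -> Prop,
    I 0 -> (forall x y, I x -> I y -> I (x - y)) ->
    (forall a x, I x -> I (a * x)) -> (forall a x, I x -> I (x * a)) ->
    (forall x, I x -> x = 0) \/ (forall x, I x).

Definition is_center (K : fieldExtType F) (iK : {lrmorphism K -> A}) : Prop :=
  forall z : A, z \in 'Z({:A})%VS <-> exists c, iK c = z.

(* [phi] identifies the matrix algebra over T with the scalar extension of A
   from K to T: a K-base of A is mapped to a T-base. *)
Definition split_by (K : fieldExtType F) (iK : {lrmorphism K -> A})
    (T : fieldType) (j : {rmorphism K -> T}) : Prop :=
  exists (n : nat) (phi : {rmorphism A -> 'M[T]_n.+1}),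
    (forall c, phi (iK c) = (j c)%:M) /\
    exists (m : nat) (e : 'I_m -> A),
      basis_for (fun (c : K) x => iK c * x) e /\
      basis_for (fun (t : T) M => t *: M) (phi \o e).

(* For henselian v there is exactly one such w. *)
Definition tame_algebra (G : divOrderedGroupType) (v : valuation G F)
    (K : fieldExtType F) (iK : {lrmorphism K -> A}) : Prop :=
  exists w : valuation G K,
    [/\ extends (in_alg K) v w,
        exists (T : fieldType) (j : {rmorphism K -> T}),
          maximal_tame_extension w j /\ split_by iK j &
        tame_extension v w].

Definition is_involution (s : 'End(A)) : Prop :=
  (forall x y, s (x * y) = s y * s x) /\ (forall x, s (s x) = x).

Definition trivial_on_center (s : 'End(A)) : Prop :=
  forall z, z \in 'Z({:A})%VS -> s z = z.

Definition symplectic_involution (s : 'End(A)) : Prop :=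
  trivial_on_center s /\
  ((2%N \notin [pchar F] /\
    exists n : nat, (n ^ 2 = \dim_('Z({:A})) {:A})%N /\
      (\dim_('Z({:A})) (fixedSpace s) = (n * n.-1)./2)%N) \/
   (2%N \in [pchar F] /\ exists x, 1 = x + s x)).

Definition orthogonal_involution (s : 'End(A)) : Prop :=
  trivial_on_center s /\ ~ symplectic_involution s.

Definition is_gauge (G : divOrderedGroupType) (v : valuation G F)
    (g : surmultiplicative v A) : Prop :=
  is_norm v g /\ gr_semisimple g.

End Algebras.

Definition anisotropic (R : nzRingType) (s : R -> R) : Prop :=
  forall x, s x * x = 0 -> x = 0.

Section GradedInvolution.
Variables (G : divOrderedGroupType) (F : fieldType) (v : valuation G F).
Variables (A : falgType F) (s : 'End(A)) (g : surmultiplicative v A).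
Hypothesis sg : forall x, g (s x) = g x.

Definition gr_involution (c : G) : gr g c -> gr g c := @gr_map G A A g g s sg c.

Definition residue_involution : residue g -> residue g := gr_involution (c := 0).

Definition gr_anisotropic : Prop :=
  forall c (a : gr g c), gr_mul (gr_involution a) a = 0 -> a = 0.

End GradedInvolution.

(* Main.v *)
Require Import Defs.
From HB Require Import structures.
From mathcomp Require Import all_boot all_order all_algebra all_field.
From mathcomp Require Import perm zify ring.
From Stdlib Require Import Classical.

(** Write s for sigma, and call x small in degree c when its class in the
    component of degree c of the graded algebra vanishes. The three conditions
    all say that s(x)x cannot be zero, or small, unless x is.

    Anisotropy of the graded involution gives the two others at once: the
    leading term of an isotropic x is isotropic, and 0 is one of the degrees.

    From degree 0 to all degrees. Since the graded algebra is semiprime, every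
    nonzero homogeneous right ideal contains an element of degree 0 which fixes
    a nonzero element of the ideal ([right_ideal_fixes]). Hence an isotropic
    leading term x has a multiple xy of degree 0 that is nonzero, and it is
    isotropic too.

    From sigma to the graded involution, by contraposition ([isotropic_lift]).
    Let s(x)x be small and let c = xy fix the nonzero leading term of m = xz.
    One looks for y0 of nonnegative value with y0 + s(y0) = 1 and y0 m small.
    Given such a y0, the Cayley-Hamilton theorem provides a monic p with
    integral coefficients that kills y0. As v is henselian, p = p1 p0 where the
    roots of p1 are small and those of p0 are units. Then f = p0(y0) is not
    zero, because f m is p0(0) m up to a small term, and s(f)f = 0, because
    s(f) = p0(1 - y0) and the polynomials p1(X) and p1(1 - X) are coprime
    ([isotropic_of_nonunit]). With u of nonnegative value and u + s(u) = 1, a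
    first candidate is (1 - s(c)) u (1 - c) + s(c); the sum of it and its image
    is 1 + s(c)c. It remains to write the small symmetric element s(c)c as
    z0 + s(z0) with z0 small.

    This last step depends on the type of sigma: every trace x + s(x) has to be
    the trace of an element of no smaller value ([trace_properties]).

    - If some central u has nonnegative value and u + s(u) = 1, then u t has
      trace t for each symmetric t. In residue characteristic other than 2, the
      element 1/2 is such a u. For unitary involutions in residue
      characteristic 2, such a u is found in K unless the two conjugates of
      every element of K have the same leading term; tameness then gives K = F
      ([unitary_central_trace], through [rigid_tame]).

    - If the residue characteristic is 2 and sigma is symplectic, then K = F.
      The scalars are extended to a finite normal extension N of F that splits
      A and lies in the maximal tame extension. The value function and sigma
      extend to matrices over N, and the graded algebra acquires no nil ideal,
      by Galois descent for leading terms ([nil_ideal_small]). For a split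
      algebra there is a base psi_ij, adapted to the values, such that
      s(psi_ij) = eps psi_ji with a sign eps ([switch_basis]); symplectic type
      means eps = -1 ([switch_sign]). So the trace of x is a sum of terms
      a_ij psi_ij with a_ji = - a_ij, which is the trace of the partial sum
      over i < j. A base of A adapted to the kernel of the trace brings this
      element back to A ([split_trace_strict]). *)

Set Implicit Arguments.
Unset Strict Implicit.
Unset Printing Implicit Defensive.

Import Order.TTheory GRing.Theory.
Local Open Scope ring_scope.
Local Open Scope quotient_scope.

(** * Filtrations by a totally ordered group *)
Section OrderedGroup.
Variable G : divOrderedGroupType.
Implicit Types a b c d x y z : G.

Lemma leGD2l z x y : (z + x <= z + y) = (x <= y).
Proof.
apply/idP/idP => [h|]; last exact: dog_leD2l.
by have := dog_leD2l (- z) h; rewrite !addKr.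
Qed.

Lemma leGD2r z x y : (x + z <= y + z) = (x <= y).
Proof. by rewrite ![_ + z]addrC leGD2l. Qed.

Lemma leGNgt x y : (x <= y) = ~~ (y < x).
Proof.
rewrite lt_neqAle; have /orP[h|h] := dog_total x y.
  by rewrite h; case: eqP => //= ne; apply/esym/negP => h'; apply: ne; apply/eqP; rewrite eq_le h h'.
by rewrite h andbT negbK [RHS]eq_sym eq_le h andbT.
Qed.

Lemma ltGNge x y : (x < y) = ~~ (y <= x).
Proof. by rewrite leGNgt negbK. Qed.

Lemma ltGD2l z x y : (z + x < z + y) = (x < y).
Proof. by rewrite !ltGNge leGD2l. Qed.

Lemma ltGD2r z x y : (x + z < y + z) = (x < y).
Proof. by rewrite !ltGNge leGD2r. Qed.

Lemma leGD a b c d : a <= b -> c <= d -> a + c <= b + d.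
Proof. by move=> ab cd; apply: (@le_trans _ _ (a + d)); rewrite ?leGD2l ?leGD2r. Qed.

Lemma leG_pMn a b n : a <= b -> a *+ n <= b *+ n.
Proof. by move=> ab; elim: n => [|n IH]; rewrite ?mulr0n // !mulrS leGD. Qed.

Lemma ltG_pMn a b n : (0 < n)%N -> a < b -> a *+ n < b *+ n.
Proof.
case: n => // n _ ab; rewrite !mulrS.
apply: (@lt_le_trans _ _ (b + a *+ n)); first by rewrite ltGD2r.
by rewrite leGD2l leG_pMn // ltW.
Qed.

End OrderedGroup.

Section RingValue.
Variables (G : divOrderedGroupType) (R : nzRingType) (f : ring_value G R).
Implicit Types (c d : G) (x y : R).

Lemma in_ge0 c : in_ge f c 0.
Proof. by rewrite /in_ge (rv_oo f 0).2. Qed.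

Lemma in_gt0 c : in_gt f c 0.
Proof. by rewrite /in_gt (rv_oo f 0).2. Qed.

Lemma in_ge_1 : in_ge f 0 1.
Proof. by rewrite /in_ge rv_1 /= lexx. Qed.

Lemma in_gtNge c x : in_gt f c x = ~~ ele (f x) (Some c).
Proof. by []. Qed.

Lemma in_gtW c x : in_gt f c x -> in_ge f c x.
Proof. exact: eltW. Qed.

Lemma in_geN c x : in_ge f c (- x) = in_ge f c x.
Proof. by rewrite /in_ge rv_N. Qed.

Lemma in_gtN c x : in_gt f c (- x) = in_gt f c x.
Proof. by rewrite /in_gt rv_N. Qed.

Lemma in_geD c x y : in_ge f c x -> in_ge f c y -> in_ge f c (x + y).
Proof. by move=> hx hy; apply: ele_trans (rv_D f _ _); rewrite ele_emin; apply/andP. Qed.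

Lemma in_geB c x y : in_ge f c x -> in_ge f c y -> in_ge f c (x - y).
Proof. by move=> hx hy; apply: in_geD; rewrite ?in_geN. Qed.

Lemma in_gtB c x y : in_gt f c x -> in_gt f c y -> in_gt f c (x - y).
Proof. by move=> hx hy; apply: in_gtD; rewrite ?in_gtN. Qed.

Lemma in_ge_sum c (I : Type) (r : seq I) (P : pred I) (F : I -> R) :
  (forall i, P i -> in_ge f c (F i)) -> in_ge f c (\sum_(i <- r | P i) F i).
Proof. by move=> h; elim/big_ind: _ => //; [exact: in_ge0|move=> *; exact: in_geD]. Qed.

Lemma in_gt_sum c (I : Type) (r : seq I) (P : pred I) (F : I -> R) :
  (forall i, P i -> in_gt f c (F i)) -> in_gt f c (\sum_(i <- r | P i) F i).
Proof. by move=> h; elim/big_ind: _ => //; [exact: in_gt0|move=> *; exact: in_gtD]. Qed.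

Lemma in_gt_le c d x : d <= c -> in_gt f c x -> in_gt f d x.
Proof. by move=> dc; apply: ele_lt_trans. Qed.

Lemma in_ge_lt c d x : d < c -> in_ge f c x -> in_gt f d x.
Proof. by move=> dc; apply: elt_le_trans; rewrite /elt /= -ltGNge. Qed.

Lemma rv_eqP c x : reflect (f x = Some c) (in_ge f c x && ~~ in_gt f c x).
Proof.
rewrite /in_ge in_gtNge negbK; apply: (iffP andP) => [[]|->]; last by rewrite /= !lexx.
by case: (f x) => //= a h1 h2; congr Some; apply/eqP; rewrite eq_le h1 h2.
Qed.

Lemma rv_exists x : x != 0 -> exists c, f x = Some c.
Proof.
case e: (f x) => [c|]; first by exists c.
by move/(rv_oo f): e => ->; rewrite eqxx.
Qed.

Lemma in_geE c d x : f x = Some d -> in_ge f c x = (c <= d).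
Proof. by move=> e; rewrite /in_ge e. Qed.

Lemma in_gtE c d x : f x = Some d -> in_gt f c x = (c < d).
Proof. by move=> e; rewrite in_gtNge e /= ltGNge. Qed.

Lemma in_gt_subE c x y : in_gt f c (x - y) -> in_gt f c x = in_gt f c y.
Proof.
move=> h; apply/idP/idP => hx.
  by rewrite -(subKr x y); apply: in_gtB.
by rewrite -(subrK y x); apply: in_gtD.
Qed.

Lemma in_ge_subE c x y : in_gt f c (x - y) -> in_ge f c x = in_ge f c y.
Proof.
move/in_gtW => h; apply/idP/idP => hx.
  by rewrite -(subKr x y); apply: in_geB.
by rewrite -(subrK y x); apply: in_geD.
Qed.

Lemma in_geX c x n : in_ge f c x -> in_ge f (c *+ n) (x ^+ n).
Proof.
move=> h; elim: n => [|n IH]; first by rewrite mulr0n expr0 in_ge_1.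
by rewrite mulrS exprS; apply: in_geM.
Qed.

Lemma in_gt_eq0 x : (forall c, in_gt f c x) -> x = 0.
Proof.
move=> h; case: (eqVneq x 0) => // /rv_exists[c e].
by have := h c; rewrite (in_gtE _ e) ltxx.
Qed.

Lemma in_gt_ele x y : (forall c, in_gt f c x -> in_gt f c y) -> ele (f x) (f y).
Proof.
move=> xy; case E: (f x) => [c|]; last first.
  by move/(rv_oo f): E => x0; rewrite (rv_oo f y).2 //; apply: in_gt_eq0 => c; apply: xy; rewrite x0 in_gt0.
apply: wlog_neg => nyc; have y0 : y != 0 by apply: contraNneq nyc => ->; rewrite (rv_oo f 0).2.
have [b yb] := rv_exists y0; rewrite yb /= in nyc *.
by have := xy b; rewrite (in_gtE _ E) (in_gtE _ yb) ltxx ltGNge => /(_ nyc).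
Qed.

End RingValue.

Section Scalars.
Variables (G : divOrderedGroupType) (F : fieldType) (v : valuation G F).
Variables (R : lalgType F) (f : ring_value G R).
Hypothesis fZ : forall a x, f (a *: x) = eadd (f x) (v a).

Lemma in_geZ c d a x : in_ge v c a -> in_ge f d x -> in_ge f (c + d) (a *: x).
Proof.
by move=> ha hx; rewrite /in_ge fZ eaddC; apply: (ele_add ha hx).
Qed.

Lemma in_gtZr c d a x : in_ge v c a -> in_gt f d x -> in_gt f (c + d) (a *: x).
Proof.
by move=> ha hx; rewrite /in_gt fZ eaddC; apply: (elt_addl ha hx).
Qed.

Lemma in_geZE c d a x : v a = Some c -> in_ge f (c + d) (a *: x) = in_ge f d x.
Proof.
by rewrite /in_ge fZ => ->; case: (f x) => //= b; rewrite addrC leGD2r.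
Qed.

Lemma in_gtZE c d a x : v a = Some c -> in_gt f (c + d) (a *: x) = in_gt f d x.
Proof.
by rewrite !in_gtNge fZ => ->; case: (f x) => //= b; rewrite addrC leGD2l.
Qed.

Lemma in_ge_scale c d a x : f x = Some d -> in_ge f (c + d) (a *: x) = in_ge v c a.
Proof.
by rewrite /in_ge fZ => -> /=; case: (v a) => //= b; rewrite addrC leGD2l.
Qed.

Lemma in_gt_scale c d a x : f x = Some d -> in_gt f (c + d) (a *: x) = in_gt v c a.
Proof.
by rewrite !in_gtNge fZ => -> /=; case: (v a) => //= b; rewrite addrC leGD2r.
Qed.

End Scalars.

(** * Right ideals of a semiprime graded algebra *)
Section Semiprime.
Variables (G : divOrderedGroupType) (R : nzRingType) (f : ring_value G R).

(** Homogeneous elements of the graded ring are handled through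
    representatives: x with [in_ge f c x] and [~~ in_gt f c x] stands for a
    nonzero class of degree c. *)
Definition gr_semiprime : Prop := forall c x,
  in_ge f c x -> ~~ in_gt f c x ->
  exists d y, in_ge f d y /\ ~~ in_gt f (c + d + c) (x * y * x).

(** Suppose x R x = 0 at the graded level. Let L be the left annihilator of
    R x, which is a two-sided ideal. Then the elements of L that L annihilates
    from the left form a homogeneous ideal of square zero, and x is one of
    them. Unlike the ideal spanned by x, this one involves no finite sums. *)
Lemma gr_semisimple_semiprime : gr_semisimple f -> gr_semiprime.
Proof.
move=> ss c x xc xnc; apply: NNPP => no; apply/negP: xnc; rewrite negbK.
have {}no d y : in_ge f d y -> in_gt f (c + d + c) (x * y * x).
  by move=> yd; apply: wlog_neg => h; case: no; exists d, y.
pose lann e z := in_ge f e z /\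
  forall d y, in_ge f d y -> in_gt f (e + d + c) (z * y * x).
pose rann e z := forall e' w, lann e' w -> in_gt f (e' + e) (w * z).
pose I e (a : gr f e) := exists z : filtered f e,
  [/\ a = \pi z, lann e (val z) & rann e (val z)].
have lannMl e d z y : in_ge f d y -> lann e z -> lann (d + e) (y * z).
  move=> yd [ze zl]; split=> [|d' y' yd']; first exact: in_geM.
  by rewrite -!mulrA -!addrA; apply: in_gtMr => //; rewrite mulrA addrA; exact: zl.
have lannMr e d z y : in_ge f d y -> lann e z -> lann (e + d) (z * y).
  move=> yd [ze zl]; split=> [|d' y' yd']; first exact: in_geM.
  rewrite -[z * y * _]mulrA -[e + d + _]addrA; exact/zl/in_geM.
have Iid : homog_ideal I.
  split=> [e|e _ _ [z [-> zl zr]] [z' [-> zl' zr']]|e d a _ [z [-> zl zr]]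
          |e d _ b [z [-> zl zr]]].
  - exists 0; split=> [||e' w [we' _]]; rewrite ?raddf0 ?mulr0 ?in_gt0 //.
    by split=> [|d y _]; rewrite ?in_ge0 // !mul0r in_gt0.
  - exists (z - z'); rewrite !raddfB; split=> //.
      split=> [|d y yd]; first by apply: in_geB; [case: zl | case: zl'].
      by rewrite !mulrBl; apply: in_gtB; [case: zl => _; exact | case: zl' => _; exact].
    by move=> e' w wl; rewrite mulrBr; apply: in_gtB; [apply: zr | apply: zr'].
  - elim/quotW: a => y; exists (filtered_mul y z); rewrite gr_mulE; split=> //=.
      by apply: lannMl => //; exact: filtered_valP.
    move=> e' w wl; rewrite mulrA addrA; apply: zr; apply: lannMr => //.
    exact: filtered_valP.
  - elim/quotW: b => y; exists (filtered_mul z y); rewrite gr_mulE; split=> //=.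
      by apply: lannMr => //; exact: filtered_valP.
    move=> e' w wl; rewrite mulrA addrA; apply: in_gtMl; first exact: zr.
    exact: filtered_valP.
have Inil : nilpotent_homog_ideal I.
  exists 2 => s; case: s => -[|a [|b []]] //= sz Is.
  have /Is[z [az zl zr]] : a \in [:: a; b] by rewrite inE eqxx.
  have /Is[z' [bz' zl' zr']] : b \in [:: a; b] by rewrite !inE eqxx orbT.
  rewrite /homog_mul /= az bz' /gr_one /gr_class (gr_mulE z') gr_mulE.
  apply/eqP; rewrite gr_eq0E /= mulr1 addr0; exact: zr'.
have xI : I c (\pi_(gr f c) (Filtered xc)).
  exists (Filtered xc); split=> //= e' w [_ wl].
  by have := wl _ _ (in_ge_1 f); rewrite mulr1 addr0.
by have /eqP := ss I Iid Inil _ _ xI; rewrite gr_eq0E.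
Qed.

End Semiprime.

Section MinimalIndex.
Variable G : divOrderedGroupType.

Lemma exists_emin n (h : 'I_n.+1 -> option G) : exists i, forall j, ele (h i) (h j).
Proof.
elim: n h => [|n IH] h; first by exists ord0 => j; rewrite (ord1 j) ele_refl.
have [i hi] := IH (h \o lift ord0).
have /orP[le|le] := ele_total (h ord0) (h (lift ord0 i)).
  exists ord0 => j; case: (unliftP ord0 j) => [j' ->|->]; last exact: ele_refl.
  exact: ele_trans le (hi j').
exists (lift ord0 i) => j; case: (unliftP ord0 j) => [j' ->|->] //; exact: hi.
Qed.

Lemma exists_last_emin n (h : 'I_n.+1 -> option G) :
  exists i, (forall j, ele (h i) (h j)) /\ (forall j : 'I_n.+1, (i < j)%N -> elt (h i) (h j)).
Proof.
have [i0 hi0] := exists_emin h.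
pose P (i : 'I_n.+1) := [forall j, ele (h i) (h j)].
have Pi0 : P i0 by apply/forallP.
case: (@arg_maxnP _ i0 P (fun i => i) Pi0) => i /forallP Pi imax.
exists i; split=> // j ij; apply/negP => hji.
have : P j by apply/forallP => k; apply: ele_trans hji (Pi k).
by move/imax => /=; rewrite leqNgt ij.
Qed.

End MinimalIndex.

Section RightIdeals.
Variables (G : divOrderedGroupType) (F : fieldType) (v : valuation G F).
Variables (A : falgType F) (g : surmultiplicative v A).

Lemma smZ a x : g (a *: x) = eadd (g x) (v a).
Proof. by case: (sm_value_function g) => _ _ ->. Qed.

Lemma rvZ a x : rv_fun g (a *: x) = eadd (rv_fun g x) (v a).
Proof. exact: smZ. Qed.

(** A linear relation between the x_k, read at the last index k where its terms
    have least value, expresses the leading term of x_k through those of the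
    x_j with j < k. Families without such expressions are therefore linearly
    independent. *)
Lemma gr_independent_dim N (x : 'I_N -> A) (d : 'I_N -> G) :
  (forall k, in_ge g (d k) (x k)) ->
  (forall (k : 'I_N) (a : 'I_N -> F),
    (forall j : 'I_N, (j < k)%N -> in_ge g (d k) (a j *: x j)) ->
    ~~ in_gt g (d k) (x k - \sum_(j < N | (j < k)%N) a j *: x j)) ->
  (N <= \dim {:A})%N.
Proof.
case: N x d => // N x d xd ind; rewrite leqNgt; apply/negP => ltN.
pose X := [tuple of mkseq (fun i => x (inord i)) N.+1].
have XE (i : 'I_N.+1) : X`_i = x i by rewrite nth_mkseq ?inord_val.
have : ~~ free X.
  apply/negP => /eqP fX; have := dimvS (subvf <<X>>%VS).
  by rewrite fX size_tuple leqNgt ltN.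
move=> /freeP nf.
have [c sc [i0 ci0]] : exists2 c : 'I_N.+1 -> F, \sum_i c i *: x i = 0 & exists i, c i != 0.
  apply: NNPP => no; apply: nf => c; rewrite (eq_bigr _ (fun i _ => congr1 _ (XE i))) => sc i.
  by apply/eqP; apply: contraPT sc => ci sc; apply: no; exists c => //; exists i.
have [k [kmin klast]] := exists_last_emin (fun i => g (c i *: x i)).
have gx i : g (x i) = Some (d i).
  apply/(rv_eqP g); rewrite xd /=.
  have := ind i (fun=> 0); rewrite big1 ?subr0; last by move=> j _; rewrite scale0r.
  by apply=> j _; rewrite scale0r in_ge0.
have ck0 : c k != 0.
  apply/eqP => ck; have := kmin i0; rewrite ck scale0r (sm_oo g 0).2 //=.
  by rewrite smZ gx; case: (v (c i0)) (val_oo v (c i0)) => [?|[/(_ erefl) h]] //; rewrite h eqxx in ci0.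
have [e vck] : exists e, v (c k) = Some e by apply: (rv_exists v).
have gck : g (c k *: x k) = Some (e + d k) by rewrite smZ gx vck /= addrC.
pose a j := - (c j / c k).
have ajE j : c k *: (a j *: x j) = - (c j *: x j).
  by rewrite scalerA /a mulrN mulrCA divff // mulr1 scaleNr.
have ain (j : 'I_N.+1) : (j < k)%N -> in_ge g (d k) (a j *: x j).
  move=> jk; rewrite -(in_geZE rvZ _ _ vck) ajE in_geN /in_ge -gck; exact: kmin.
apply/negP: (ind k a ain); rewrite negbK -(in_gtZE rvZ _ _ vck).
rewrite scalerBr scaler_sumr (eq_bigr _ (fun j _ => ajE j)) sumrN opprK.
have -> : c k *: x k + \sum_(j < N.+1 | (j < k)%N) c j *: x j
        = - \sum_(j < N.+1 | (k < j)%N) c j *: x j.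
  apply/eqP; rewrite -addr_eq0 -addrA; apply/eqP.
  rewrite -[RHS]sc [RHS](bigD1 k) //=; congr (_ + _).
  rewrite [RHS](bigID (fun j : 'I_N.+1 => (j < k)%N)) /=.
  by congr (_ + _); apply: eq_bigl => j; rewrite -val_eqE /=; case: (ltngtP j k).
by rewrite in_gtN; apply: in_gt_sum => j kj; rewrite /in_gt -gck; exact: klast.
Qed.

Section Products.
Variables (x : A) (c : G).
Hypothesis xc : in_ge g c x.

(** A pair consists of an element and a degree, a lower bound for its value, so
    that [rdeg l] is the expected degree of [rprod l]. *)
Fixpoint rprod (l : seq (A * G)) : A :=
  if l is y :: l' then x * y.1 * rprod l' else 1.
Fixpoint rdeg (l : seq (A * G)) : G :=
  if l is y :: l' then c + y.2 + rdeg l' else 0.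
Definition homog_seq (l : seq (A * G)) := all (fun y => in_ge g y.2 y.1) l.

Lemma rprod_cat l1 l2 : rprod (l1 ++ l2) = rprod l1 * rprod l2.
Proof. by elim: l1 => [|y l1 IH] /=; rewrite ?mul1r // IH mulrA. Qed.

Lemma rdeg_cat l1 l2 : rdeg (l1 ++ l2) = rdeg l1 + rdeg l2.
Proof. by elim: l1 => [|y l1 IH] /=; rewrite ?add0r // IH addrA. Qed.

Lemma in_ge_rprod l : homog_seq l -> in_ge g (rdeg l) (rprod l).
Proof.
elim: l => [|y l IH] /= => [_|/andP[yl /IH hl]]; first exact: in_ge_1.
by apply: in_geM => //; apply: in_geM.
Qed.

Lemma rprodMr l w d : l != [::] -> homog_seq l -> in_ge g d w ->
  exists l', [/\ homog_seq l', size l' = size l,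
    rprod l' = rprod l * w & rdeg l' = rdeg l + d].
Proof.
case/lastP: l => // l y _; rewrite /homog_seq all_rcons => /andP[yl hl] wd.
exists (rcons l (y.1 * w, y.2 + d)); rewrite /homog_seq all_rcons hl /= andbT.
by split; rewrite ?size_rcons -?cats1 ?rprod_cat ?rdeg_cat /= ?mulr1 ?addr0 ?mulrA ?addrA //; exact: in_geM.
Qed.

(** Semiprimeness yields from a product l with nonzero leading term another
    one, l w l, of twice its length. *)
Lemma rprod_long : gr_semiprime g -> ~~ in_gt g c x -> forall n,
  exists l, [/\ homog_seq l, (n < size l)%N & ~~ in_gt g (rdeg l) (rprod l)].
Proof.
move=> sp xnc; elim=> [|n [l [hl nl lne]]].
  by exists [:: (1, 0)]; rewrite /= !mulr1 !addr0 /homog_seq /= in_ge_1.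
have l0 : l != [::] by case: l nl {hl lne}.
have [d [w [wd lwl]]] := sp _ _ (in_ge_rprod hl) lne.
have [l' [hl' sl' pl' dl']] := rprodMr l0 hl wd.
exists (l' ++ l); rewrite rprod_cat rdeg_cat pl' dl' lwl; split=> //.
  by rewrite /homog_seq all_cat; apply/andP.
by rewrite size_cat sl' -[n.+2]addn1 leq_add // (leq_ltn_trans (leq0n n)).
Qed.

Hypothesis nofix : forall y z d, in_ge g (- c) y -> in_ge g d z ->
  in_gt g (c + d) (x * y * (x * z) - x * z) -> in_gt g (c + d) (x * z).

(** The tails p_k of the product are subject to [gr_independent_dim]: each p_j
    with j < k is a multiple x Y p_k of the tail p_k, so an expression of the
    leading term of p_k through those of the p_j yields an element x Y of
    degree 0 that fixes it. *)
Lemma rprod_short l : homog_seq l -> ~~ in_gt g (rdeg l) (rprod l) ->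
  (size l <= \dim {:A})%N.
Proof.
move=> hl nl; pose p k := rprod (drop k l); pose e k := rdeg (drop k l).
have hd k : homog_seq (drop k l).
  by apply/allP => y /mem_drop; apply: (allP hl).
have ht k : homog_seq (take k l).
  by apply/allP => y /mem_take; apply: (allP hl).
have pe k : rv_fun g (p k) = Some (e k).
  apply/(rv_eqP g); rewrite in_ge_rprod //=; apply: contra nl => small.
  rewrite -(cat_take_drop k l) rprod_cat rdeg_cat; apply: in_gtMr => //.
  exact: in_ge_rprod.
apply: (@gr_independent_dim _ (fun i : 'I_(size l) => p i) (fun i => e i)).
  by move=> k; apply: in_ge_rprod.
move=> k a ha; apply/negP => small.
have [z [d [pkE [ekE zd]]]] : exists z d, p k = x * z /\ e k = c + d /\ in_ge g d z.
  rewrite /p /e (drop_nth (0, 0)) //=; set y := nth _ _ _; set l' := drop _ _.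
  exists (y.1 * rprod l'), (y.2 + rdeg l'); rewrite mulrA addrA; split=> //; split=> //.
  by apply: in_geM; [exact: (allP hl _ (mem_nth _ (ltn_ord k))) | exact: (in_ge_rprod (hd k.+1))].
have Y (j : 'I_(size l)) : exists Y, (j < k)%N -> in_ge g (- c) Y /\ a j *: p j = x * Y * p k.
  have [jk|_] := boolP (j < k)%N; last by exists 0.
  set t := take (k - j) (drop j l).
  have jkl : (j + (k - j) = k)%N by rewrite subnKC // ltnW.
  have dE : drop j l = t ++ drop k l.
    by rewrite -{1}(cat_take_drop (k - j) (drop j l)) drop_drop addnC jkl.
  have htt : homog_seq t by apply/allP => y /mem_take /mem_drop; apply: (allP hl).
  have pjE : p j = rprod t * p k by rewrite /p dE rprod_cat.
  have ejE : e j = rdeg t + e k by rewrite /e dE rdeg_cat.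
  have t0 : t != [::] by rewrite -size_eq0 size_takel ?size_drop ?leq_sub2r // ?subn_eq0 -?ltnNge // ltnW.
  clearbody t; case: t t0 dE htt pjE ejE => // y t' _ dE /= /andP[yh th] pjE ejE.
  exists (a j *: (y.1 * rprod t')) => _.
  have vaj : in_ge v (- (c + y.2 + rdeg t')) (a j).
    have := ha j jk; rewrite -(in_ge_scale rvZ _ _ (pe j)) -/(p j) ejE.
    by rewrite addrA addNr add0r.
  split; last by rewrite pjE -scalerAr -scalerAl !mulrA.
  have -> : - c = - (c + y.2 + rdeg t') + (y.2 + rdeg t').
    by rewrite -addrA opprD addrNK.
  by apply: (in_geZ rvZ) => //; apply: in_geM => //; exact: in_ge_rprod.
have [Yf Yp] := fin_all_exists Y.
have sE : \sum_(j < size l | (j < k)%N) a j *: p j = x * (\sum_(j < size l | (j < k)%N) Yf j) * p k.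
  rewrite mulr_sumr mulr_suml; apply: eq_bigr => j jk.
  by have [_ ->] := Yp j jk.
have : in_gt g (c + d) (x * z).
  apply: (nofix (y := \sum_(j < size l | (j < k)%N) Yf j)) => //.
    by apply: in_ge_sum => j jk; have [] := Yp j jk.
  by rewrite -pkE -ekE -sE -in_gtN opprB.
by rewrite -pkE -ekE (in_gtE _ (pe k)) ltxx.
Qed.

End Products.

(** This replaces the idempotents of the right ideals of a semisimple ring: x y
    has degree 0 and its leading term fixes that of x z, which is not zero.
    Otherwise products of elements of the right ideal of x would have bounded
    length ([rprod_short]), against [rprod_long]. *)
Lemma right_ideal_fixes x c : gr_semiprime g ->
  in_ge g c x -> ~~ in_gt g c x ->
  exists y z d, [/\ in_ge g (- c) y, in_ge g d z, ~~ in_gt g (c + d) (x * z) &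
    in_gt g (c + d) (x * y * (x * z) - x * z)].
Proof.
move=> sp xc xnc; apply: NNPP => no.
have nofix y z d : in_ge g (- c) y -> in_ge g d z ->
    in_gt g (c + d) (x * y * (x * z) - x * z) -> in_gt g (c + d) (x * z).
  by move=> hy hz h; apply: wlog_neg => hn; case: no; exists y, z, d.
have [l [hl dl nl]] := rprod_long xc sp xnc (\dim {:A}).
by have := rprod_short xc nofix hl nl; rewrite leqNgt dl.
Qed.

End RightIdeals.

(** * Bases that split a value function *)
Section Splitting.
Variables (G : divOrderedGroupType) (F : fieldType) (v : valuation G F).
Variables (R : lalgType F) (f : ring_value G R).
Hypothesis fZ : forall a x, f (a *: x) = eadd (f x) (v a).

(** For a base this says that the value of a sum is the least value of its
    terms. *)
Definition splits n (e : 'I_n -> R) := forall (c : 'I_n -> F) d,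
  in_gt f d (\sum_i c i *: e i) -> forall i, in_gt f d (c i *: e i).

Definition spans n (e : 'I_n -> R) := forall x, exists c : 'I_n -> F, x = \sum_i c i *: e i.

Lemma splits_ge n (e : 'I_n -> R) : splits e -> forall (c : 'I_n -> F) d,
  in_ge f d (\sum_i c i *: e i) -> forall i, in_ge f d (c i *: e i).
Proof.
move=> se c d h i; apply: wlog_neg => ni.
have [b bE] : exists b, f (c i *: e i) = Some b.
  by apply: rv_exists; apply: contraNneq ni => ->; apply: in_ge0.
have bd : b < d by rewrite ltGNge -(in_geE _ bE).
by have := se c b (in_ge_lt bd h) i; rewrite (in_gtE _ bE) ltxx.
Qed.

Lemma splits_eq0 n (e : 'I_n -> R) : splits e -> (forall i, e i != 0) ->
  forall c : 'I_n -> F, \sum_i c i *: e i = 0 -> forall i, c i = 0.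
Proof.
move=> se e0 c sc i; have : c i *: e i = 0.
  by apply: (@in_gt_eq0 _ _ f) => d; apply: se; rewrite sc in_gt0.
by move=> h; apply/eqP; apply: contraT => ci; have := e0 i; rewrite -(scalerK ci (e i)) h scaler0 eqxx.
Qed.

Definition exchange n (e : 'I_n -> R) k x j := if j == k then x else e j.

Lemma exchange_sum n (e : 'I_n -> R) k (b c : 'I_n -> F) :
  \sum_j b j *: exchange e k (\sum_j c j *: e j) j =
  \sum_j (b k * c j + (if j == k then 0 else b j)) *: e j.
Proof.
rewrite (bigD1 k) //= {1}/exchange eqxx scaler_sumr.
rewrite [RHS](eq_bigr _ (fun j _ => scalerDl _ _ _)) [RHS]big_split /=; congr (_ + _).
  by apply: eq_bigr => j _; rewrite scalerA.
rewrite [RHS](bigD1 k) //= eqxx scale0r add0r; apply: eq_bigr => j /negPf jk.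
by rewrite /exchange jk.
Qed.

(** Since the k-th term of the new vector has least value, a bound for b_k c_k e_k
    bounds all the terms b_k c_j e_j. *)
Lemma exchange_splits n (e : 'I_n -> R) k (c : 'I_n -> F) : splits e ->
  (forall j, ele (f (c k *: e k)) (f (c j *: e j))) ->
  splits (exchange e k (\sum_j c j *: e j)).
Proof.
move=> se cmin b d; rewrite exchange_sum => /se h.
have hk j : in_gt f d ((b k * c j) *: e j).
  have := h k; rewrite eqxx addr0 -!scalerA => hh; apply: (elt_le_trans hh).
  by rewrite ![f (b k *: _)]fZ; apply: ele_add => //; apply: ele_refl.
move=> j; rewrite /exchange; case: eqP => [->|/eqP jk].
  by rewrite scaler_sumr; apply: in_gt_sum => i _; rewrite scalerA.
have := h j; rewrite (negPf jk) scalerDl => hj.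
by rewrite -[b j *: _](addKr ((b k * c j) *: e j)); apply: in_gtD; rewrite ?in_gtN.
Qed.

Lemma exchange_spans n (e : 'I_n -> R) k (c : 'I_n -> F) : spans e -> c k != 0 ->
  spans (exchange e k (\sum_j c j *: e j)).
Proof.
move=> se ck x; have [b ->] := se x.
exists (fun j => if j == k then b k / c k else b j - b k / c k * c j).
rewrite exchange_sum eqxx; apply: eq_bigr => j _; congr (_ *: _).
by case: eqP => [->|_]; rewrite ?addr0 ?divfK // addrC subrK.
Qed.

(** Any subspace is spanned by part of a splitting base. As long as the members
    that lie in U do not span it, some nonzero y in U is a combination of the
    other members, and y may take the place of one where the terms of y attain
    their least value. *)
Lemma adapted_basis n (e : 'I_n -> R) (U : R -> Prop) :
  (forall x y, U x -> U y -> U (x - y)) -> (forall a x, U x -> U (a *: x)) ->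
  splits e -> spans e -> (forall i, e i != 0) -> U 0 ->
  exists (e' : 'I_n -> R) (D : {set 'I_n}),
    [/\ splits e', spans e', forall i, e' i != 0, forall i, i \in D -> U (e' i) &
      forall x, U x -> exists c : 'I_n -> F, x = \sum_(i in D) c i *: e' i].
Proof.
move=> UB UZ se0 pe0 ne0 U0.
have UD x y : U x -> U y -> U (x + y).
  by move=> Ux Uy; rewrite -[y]opprK -[- y]sub0r; apply: (UB) => //; apply: UB.
have Usum (P : pred 'I_n) (h : 'I_n -> R) : (forall i, P i -> U (h i)) -> U (\sum_(i | P i) h i).
  by move=> hU; elim/big_ind: _.
suff H : forall k (e : 'I_n -> R) (D : {set 'I_n}), (n - #|D| <= k)%N ->
    splits e -> spans e -> (forall i, e i != 0) -> (forall i, i \in D -> U (e i)) ->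
  exists (e' : 'I_n -> R) (D : {set 'I_n}),
    [/\ splits e', spans e', forall i, e' i != 0, forall i, i \in D -> U (e' i) &
      forall x, U x -> exists c : 'I_n -> F, x = \sum_(i in D) c i *: e' i].
  by apply: (H n e set0) => //; rewrite ?leq_subr // => i; rewrite inE.
elim=> [|k IH] {se0 pe0 ne0 e} e D szD se pe ne DU.
  exists e, D; split=> // x Ux; have [c ->] := pe x; exists c.
  apply: eq_bigl => i; apply/esym.
  suff -> : D = setT by rewrite inE.
  apply/eqP; rewrite eqEcard subsetT cardsT card_ord.
  by rewrite -subn_eq0 -leqn0.
case: (classic (forall x, U x -> exists c : 'I_n -> F, x = \sum_(i in D) c i *: e i)).
  by exists e, D.
move=> /not_all_ex_not[x nx]; have [Ux {}nx] := imply_to_and _ _ nx.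
have [b xE] := pe x; pose c i := if i \in D then 0 else b i.
pose y := \sum_i c i *: e i.
have yE : y = x - \sum_(i in D) b i *: e i.
  rewrite xE [X in X - _](bigID (mem D)) /= addrC addrK /y [LHS](bigID (mem D)) /=.
  rewrite big1 ?add0r => [|i iD]; last by rewrite /c iD scale0r.
  by apply: eq_bigr => i /negPf iD; rewrite /c iD.
have Uy : U y by rewrite yE; apply: UB => //; apply: Usum => i iD; apply/UZ/DU.
have y0 : y != 0.
  by apply/eqP => y0; apply: nx; exists b; apply/eqP; rewrite -subr_eq0 -yE y0.
have n_gt0 : (0 < n)%N.
  case: (posnP n) y0 => // n0; rewrite /y big1 ?eqxx // => i.
  by have := ltn_ord i; rewrite [X in (_ < X)%N]n0.
have [i0 imin] : exists i, forall j, ele (f (c i *: e i)) (f (c j *: e j)).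
  by have := @exists_emin G n.-1; rewrite prednK //; apply.
have ci0 : c i0 != 0.
  apply: contraNneq y0 => ci0; apply/eqP; rewrite /y big1 // => j _.
  have := imin j; rewrite ci0 scale0r (rv_oo f 0).2 //=.
  by case E: (f _) => // _; apply/(rv_oo f).
have i0D : i0 \notin D by apply: contraNN ci0; rewrite /c => ->.
apply: (IH (exchange e i0 y) (i0 |: D)).
- by rewrite cardsU1 i0D add1n subnS -subn1 leq_subLR add1n.
- exact: exchange_splits.
- exact: exchange_spans.
- by move=> i; rewrite /exchange; case: (i =P i0).
- by move=> i; rewrite !inE /exchange; case: eqP => //= _; apply: DU.
Qed.

End Splitting.

Section NormSplits.
Variables (G : divOrderedGroupType) (F : fieldType) (v : valuation G F).
Variables (A : falgType F) (g : surmultiplicative v A).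

Lemma elt_big_emin (a : option G) n (h : 'I_n -> option G) :
  elt a (\big[@emin G/None]_i h i) -> forall i, elt a (h i).
Proof.
elim: n h => [|n IH] h; first by move=> _ [].
rewrite big_ord_recl elt_emin => /andP[h0 /IH hl] i.
by case: (unliftP ord0 i) => [j ->|-> //].
Qed.

Lemma norm_splitting_basis : is_norm v g -> exists n (e : 'I_n -> A),
  [/\ splits g e, spans e & forall i, e i != 0].
Proof.
case=> _ [n [e [be ge]]]; exists n, (fun i => e`_i); split.
- by move=> c d; rewrite /in_gt /= ge => /elt_big_emin.
- by move=> x; exists (coord e ^~ x); apply: coord_basis (memvf x).
- move=> i; apply: contraTneq (basis_free be) => ei.
  apply/negP => /freeP/(_ (fun j => (j == i)%:R)).
  rewrite (bigD1 i) //= eqxx ei scaler0 big1 ?addr0; last first.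
    by move=> j /negPf ->; rewrite scale0r.
  by move/(_ erefl i)/eqP; rewrite eqxx oner_eq0.
Qed.

End NormSplits.

(** * Integral equations *)
Section WeightedPolynomials.
Variables (G : divOrderedGroupType) (L : fieldType) (w : valuation G L).
Variable b : G.

(** The terms of p have value at least c when X is given the value b. *)
Definition poly_ge (c : G) (p : {poly L}) := forall k, in_ge w (c - b *+ k) p`_k.

Lemma poly_geD c p q : poly_ge c p -> poly_ge c q -> poly_ge c (p + q).
Proof. by move=> hp hq k; rewrite coefD; apply: in_geD. Qed.

Lemma poly_geN c p : poly_ge c p -> poly_ge c (- p).
Proof. by move=> hp k; rewrite coefN in_geN. Qed.

Lemma poly_geM c d p q : poly_ge c p -> poly_ge d q -> poly_ge (c + d) (p * q).
Proof.
move=> hp hq k; rewrite coefM; apply: in_ge_sum => i _.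
have -> : c + d - b *+ k = (c - b *+ i) + (d - b *+ (k - i)).
  by rewrite addrACA -opprD -mulrnDr subnKC // -ltnS.
by apply: in_geM; [apply: hp | apply: hq].
Qed.

Lemma poly_geC c a : in_ge w c a -> poly_ge c a%:P.
Proof.
move=> ha k; rewrite coefC; case: eqP => [->|_]; last exact: in_ge0.
by rewrite mulr0n subr0.
Qed.

Lemma poly_geX : poly_ge b 'X.
Proof.
move=> k; rewrite coefX; case: eqP => [->|_]; last exact: in_ge0.
by rewrite mulr1n subrr in_ge_1.
Qed.

Lemma poly_ge_sum c (I : Type) (r : seq I) (P : pred I) (F : I -> {poly L}) :
  (forall i, P i -> poly_ge c (F i)) -> poly_ge c (\sum_(i <- r | P i) F i).
Proof.
move=> h; elim/big_ind: _ => //; last by move=> *; apply: poly_geD.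
by move=> k; rewrite coef0 in_ge0.
Qed.

Lemma poly_ge_prod (I : Type) (r : seq I) (c : I -> G) (F : I -> {poly L}) :
  (forall i, poly_ge (c i) (F i)) -> poly_ge (\sum_(i <- r) c i) (\prod_(i <- r) F i).
Proof.
move=> h; elim: r => [|i r IH]; last by rewrite !big_cons; apply: poly_geM.
by rewrite !big_nil; apply: poly_geC; apply: in_ge_1.
Qed.

(** M raises a weight function by b. Along a permutation the differences of
    weights cancel, so that every product in the determinant has weight b n. *)
Lemma char_poly_ge n (M : 'M[L]_n) (wt : 'I_n -> G) :
  (forall i j, in_ge w (b + wt j - wt i) (M i j)) ->
  poly_ge (b *+ n) (char_poly M).
Proof.
move=> hM; rewrite /char_poly /determinant; apply: poly_ge_sum => s _.
rewrite -[b *+ n]add0r; apply: poly_geM.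
  case: (odd_perm s); rewrite ?expr0 ?expr1; first apply: poly_geN.
    by apply: poly_geC; apply: in_ge_1.
  by apply: poly_geC; apply: in_ge_1.
have -> : b *+ n = \sum_(i < n) (b + wt (s i) - wt i).
  rewrite !big_split /= sumr_const card_ord sumrN.
  by rewrite [X in _ = _ + X - _](reindex_inj (@perm_inj _ s^-1)) /= (eq_bigr wt) ?addrK // => i _; rewrite permKV.
apply: poly_ge_prod => i; rewrite !mxE; apply: poly_geD; last first.
  by apply: poly_geN; apply: poly_geC.
case: eqP => [<-|_]; first by rewrite addrK mulr1n; apply: poly_geX.
by move=> k; rewrite mulr0n coef0 in_ge0.
Qed.

End WeightedPolynomials.

Section HornerAlg.
Variables (F : fieldType) (R : algType F).

Lemma horner_algE (y : R) (p : {poly F}) : horner_alg y p = \sum_(k < size p) p`_k *: y ^+ k.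
Proof.
rewrite -{1}[p]coefK poly_def linear_sum; apply: eq_bigr => k _.
by rewrite linearZ rmorphXn /= horner_algX mulr_algl.
Qed.

Lemma horner_mxE n (M : 'M[F]_n.+1) (p : {poly F}) :
  horner_mx M p = \sum_(k < size p) p`_k *: M ^+ k.
Proof.
rewrite -{1}[p]coefK poly_def linear_sum; apply: eq_bigr => k _.
by rewrite linearZ rmorphXn /= horner_mx_X.
Qed.

(** The Cayley-Hamilton theorem for the left multiplication by y on the span of
    a family. *)
Lemma char_poly_annihilates n (y : R) (e : 'I_n -> R) (M : 'M[F]_n) :
  (forall j, y * e j = \sum_i M i j *: e i) ->
  forall j, horner_alg y (char_poly M) * e j = 0.
Proof.
case: n e M => [|n] e M yM j; first by case: j.
have yk k i : y ^+ k * e i = \sum_l (M ^+ k) l i *: e l.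
  elim: k i => [|k IH] i.
    rewrite expr0 mul1r (bigD1 i) //= expr0 mxE eqxx scale1r big1 ?addr0 // => l /negPf li.
    by rewrite mxE li scale0r.
  rewrite exprSr -mulrA yM mulr_sumr.
  under eq_bigr => l _ do rewrite -scalerAr IH scaler_sumr.
  rewrite exchange_big /=; apply: eq_bigr => l _.
  under eq_bigr => h _ do rewrite scalerA.
  rewrite -scaler_suml exprSr -mulmxE mxE; congr (_ *: _).
  by apply: eq_bigr => h _; rewrite mulrC.
rewrite horner_algE mulr_suml.
under eq_bigr => k _ do rewrite -scalerAl yk scaler_sumr.
rewrite exchange_big /= big1 // => l _.
under eq_bigr => k _ do rewrite scalerA.
rewrite -scaler_suml.
have -> : \sum_(k < size (char_poly M)) (char_poly M)`_k * (M ^+ k) l j = horner_mx M (char_poly M) l j.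
  by rewrite horner_mxE summxE; apply: eq_bigr => k _; rewrite mxE.
by rewrite Cayley_Hamilton mxE scale0r.
Qed.

End HornerAlg.

Section IntegralEquation.
Variables (G : divOrderedGroupType) (F : fieldType) (v : valuation G F).
Variables (R : algType F) (f : ring_value G R).
Hypothesis fZ : forall a x, f (a *: x) = eadd (f x) (v a).

(** The characteristic polynomial of the multiplication by y, the values of the
    family serving as weights. *)
Lemma weighted_char_poly n (y : R) (e : 'I_n -> R) (c : G) :
  splits f e -> (forall i, e i != 0) ->
  (forall j, exists a : 'I_n -> F, y * e j = \sum_i a i *: e i) ->
  (forall d j, in_ge f d (e j) -> in_ge f (c + d) (y * e j)) ->
  exists p : {poly F}, [/\ p \is monic, size p = n.+1, poly_ge v c (c *+ n) p &
    forall j, horner_alg y p * e j = 0].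
Proof.
move=> se e0 ye yc; have [a aE] := fin_all_exists ye.
pose M := \matrix_(i, j) a j i.
have yM j : y * e j = \sum_i M i j *: e i.
  by rewrite aE; apply: eq_bigr => i _; rewrite mxE.
have [wt wtE] := fin_all_exists (fun i => rv_exists f (e0 i)).
exists (char_poly M); split; rewrite ?char_poly_monic ?size_char_poly //.
  apply: (char_poly_ge (wt := wt)) => i j.
  rewrite -(in_ge_scale fZ _ _ (wtE i)) subrK.
  apply: (splits_ge (e := e) se (c := M^~ j)); rewrite -yM; apply: yc.
  by rewrite (in_geE _ (wtE j)).
exact: char_poly_annihilates.
Qed.

End IntegralEquation.

(** * Extensions generated inside a given field *)
Lemma algebraic_irreducible (K T : fieldType) (i : {rmorphism K -> T}) z : algebraicOver i z ->
  exists q : {poly K}, [/\ q != 0, irreducible_poly q & root (map_poly i q) z].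
Proof.
case=> p p0 pz; have [n] := ubnP (size p); elim: n p p0 pz => // n IH p p0 pz szp.
case: (classic (exists r : {poly K}, [/\ r != 0, root (map_poly i r) z & (size r < size p)%N])).
  by case=> r [r0 rz szr]; apply: (IH r) => //; apply: leq_trans szr _.
move=> no; exists p; split=> //; apply/(subfx_irreducibleP pz p0) => q qz q0.
by rewrite leqNgt; apply/negP => szq; apply: no; exists q.
Qed.

Section FiniteExtensions.
Variables (K T : fieldType) (i : {rmorphism K -> T}).

Lemma finite_ext_in (s : seq T) : (forall z, z \in s -> algebraicOver i z) ->
  exists (L : fieldExtType K) (h : {rmorphism L -> T}) (s1 : seq L),
    (forall c : K, h c%:A = i c) /\ map h s1 = s.
Proof.
elim: s => [|z s IH] s_alg.
  pose h : {rmorphism K^o -> T} := i.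
  exists K^o, h, [::]; split=> // c; congr (i _); exact: mulr1.
have [|L [h [s1 [hi hs]]]] := IH; first by move=> y ys; apply: s_alg; rewrite inE ys orbT.
have z_alg : algebraicOver h z.
  have [p p0 pz] := s_alg z (mem_head _ _).
  exists (map_poly (in_alg L) p); first by rewrite map_poly_eq0.
  by rewrite -map_poly_comp (eq_map_poly hi).
have [q [q0 q_irr qz]] := algebraic_irreducible z_alg.
pose Lz : fieldExtType L := SubFieldExtType qz q_irr.
pose hz : {rmorphism baseFieldType Lz -> T} := @subfx_inj _ _ h z q.
exists (baseFieldType Lz), hz, (subfx_root h z q :: map (in_alg Lz) s1); split.
  move=> c; rewrite baseField_scaleE -hi; exact: (subfx_inj_base qz q0 c%:A).
rewrite /= -hs -map_comp; congr (_ :: _); first exact: subfx_inj_root.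
apply: eq_map => x; exact: (subfx_inj_base qz q0 x).
Qed.

(** The splitting field is built inside T, for the sake of valuations and tame
    extensions that only the field T carries. *)
Lemma splitting_field_in (p : {poly K}) (rs : seq T) : p != 0 ->
  map_poly i p %= \prod_(z <- rs) ('X - z%:P) ->
  exists (N : splittingFieldType K) (h : {rmorphism N -> T}) (rs' : seq N),
    (forall c : K, h c%:A = i c) /\ map h rs' = rs.
Proof.
move=> p0 prs; have rs_alg z : z \in rs -> algebraicOver i z.
  move=> zrs; exists p => //; rewrite (eqp_root prs) root_prod_XsubC //.
have [L [h [s1 [hi hs]]]] := finite_ext_in rs_alg.
pose E := <<1 & s1>>%AS; pose N := subvs_of E.
pose hN : {rmorphism N -> T} := h \o vsval.
pose s2 : seq N := map (vsproj E) s1.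
have s2E : map vsval s2 = s1.
  rewrite -map_comp -[RHS]map_id; apply/eq_in_map => x xs /=.
  by rewrite vsprojK //; apply: seqv_sub_adjoin.
have hNs : map hN s2 = rs by rewrite map_comp s2E.
have hNi c : hN c%:A = i c by rewrite -hi /hN /= algid1.
have axN : splitting_field_axiom N.
  exists (map_poly (in_alg N) p).
    by apply/polyOverP => k; rewrite coef_map memvZ ?mem1v.
  exists s2.
    rewrite -(eqp_map hN) -map_poly_comp (eq_map_poly hNi) rmorph_prod.
    by rewrite -hNs big_map in prs; apply: eqp_trans prs _; rewrite (eq_bigr _ (fun y _ => map_polyXsubC _ _)) eqpxx.
  have f_lin : linear (vsval : N -> L) by move=> a u v; rewrite linearP.
  have f_hom : ahom_in {:N} (linfun (vsval : N -> L)).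
    by apply/ahom_inP; split=> [u v|]; rewrite !lfunE //= algid1.
  pose f := AHom f_hom.
  have fE x : f x = vsval x by rewrite lfunE.
  apply/eqP; rewrite eqEsubv subvf /=; apply/subvP => x _.
  have : f x \in (f @: <<1 & s2>>)%VS.
    rewrite aimg_adjoin_seq aimg1.
    by rewrite (eq_map fE) s2E fE subvsP.
  case/memv_imgP => y ys; rewrite !fE => /val_inj -> //.
pose NMixin := FieldExt_isSplittingField.Build _ N axN.
pose NS : splittingFieldType K := HB.pack N NMixin.
by exists NS, hN, s2.
Qed.

End FiniteExtensions.

Lemma factor_rmorphism (A N S : nzRingType) (f : {rmorphism A -> S})
    (h : {rmorphism N -> S}) : injective h -> (forall x, exists y, h y = f x) ->
  exists f' : {rmorphism A -> N}, forall x, h (f' x) = f x.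
Proof.
move=> h_inj hf; have ex x : exists y, h y == f x by have [y <-] := hf x; exists y.
pose f' x := xchoose (ex x); have f'E x : h (f' x) = f x by apply/eqP/(xchooseP (ex x)).
have fB : zmod_morphism f' by move=> x y; apply: h_inj; rewrite rmorphB !f'E rmorphB.
have fM : monoid_morphism f'.
  by split=> [|x y]; apply: h_inj; rewrite ?rmorph1 ?rmorphM !f'E ?rmorph1 ?rmorphM.
pose m1 := GRing.isZmodMorphism.Build _ _ f' fB.
pose m2 := GRing.isMonoidMorphism.Build _ _ f' fM.
pose F' : {rmorphism A -> N} := HB.pack f' m1 m2.
by exists F' => x; exact: f'E.
Qed.

(** * Residues and values *)
Section Pullback.
Variables (G : divOrderedGroupType) (K L : fieldType) (i : {rmorphism K -> L}).
Variable w : valuation G L.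

Fact pullback_oo x : w (i x) = None <-> x = 0.
Proof.
split=> [/(val_oo w)/eqP|->]; first by rewrite fmorph_eq0 => /eqP.
by rewrite rmorph0 (val_oo w 0).2.
Qed.
Fact pullback_D x y : ele (emin (w (i x)) (w (i y))) (w (i (x + y))).
Proof. by rewrite rmorphD val_D. Qed.
Fact pullback_M x y : w (i (x * y)) = eadd (w (i x)) (w (i y)).
Proof. by rewrite rmorphM val_M. Qed.

Definition pullback : valuation G K := Valuation pullback_oo pullback_D pullback_M.

End Pullback.

Section Residue.
Variables (G : divOrderedGroupType) (K : fieldType) (w : valuation G K).

Definition red (x : K) : residue_field w :=
  if insub x : option (filtered w 0) is Some y then \pi_(gr w 0) y else 0.

Lemma redE x (hx : in_ge w 0 x) : red x = \pi_(gr w 0) (Filtered (hx : x \in in_ge w 0)).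
Proof. by rewrite /red; case: insubP => [y _ yx|/negP[]//]; congr (\pi _); apply: val_inj. Qed.

Lemma red_eq0 x : in_ge w 0 x -> (red x == 0) = in_gt w 0 x.
Proof. by move=> hx; rewrite (redE hx) gr_eq0E. Qed.

Lemma redB x y : in_ge w 0 x -> in_ge w 0 y -> red (x - y) = red x - red y.
Proof.
move=> hx hy; rewrite (redE hx) (redE hy) (redE (in_geB hx hy)) -raddfB.
by apply: pi_gr_eq.
Qed.

Lemma redD x y : in_ge w 0 x -> in_ge w 0 y -> red (x + y) = red x + red y.
Proof.
move=> hx hy; rewrite (redE hx) (redE hy) (redE (in_geD hx hy)) -raddfD.
by apply: pi_gr_eq.
Qed.

Lemma in_ge0_mul x y : in_ge w 0 x -> in_ge w 0 y -> in_ge w 0 (x * y).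
Proof. by move=> hx hy; rewrite -[0]addr0; apply: in_geM. Qed.

Lemma in_ge0X x n : in_ge w 0 x -> in_ge w 0 (x ^+ n).
Proof. by move=> hx; have := in_geX n hx; rewrite mul0rn. Qed.

Lemma in_ge_nat n : in_ge w 0 n%:R.
Proof. by elim: n => [|n IH]; rewrite ?in_ge0 // mulrS in_geD // in_ge_1. Qed.

Lemma redM x y : in_ge w 0 x -> in_ge w 0 y -> red (x * y) = red x * red y.
Proof.
move=> hx hy; rewrite (redE hx) (redE hy) (redE (in_ge0_mul hx hy)).
rewrite -[RHS]/(res_mul _ _) res_mulE; exact: pi_gr_eq.
Qed.

Lemma red1 : red 1 = 1.
Proof. by rewrite (redE (in_ge_1 w)); apply: pi_gr_eq. Qed.

Lemma red0 : red 0 = 0.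
Proof. by apply/eqP; rewrite red_eq0 ?in_ge0 // in_gt0. Qed.

Lemma redX x n : in_ge w 0 x -> red (x ^+ n) = red x ^+ n.
Proof.
by move=> hx; elim: n => [|n IH]; rewrite ?red1 // !exprS redM ?in_ge0X // IH.
Qed.

Lemma red_nat n : red n%:R = n%:R.
Proof.
elim: n => [|n IH]; first by rewrite red0.
by rewrite !mulrS redD ?in_ge_nat ?in_ge_1 // red1 IH.
Qed.

Lemma red_sum n (h : 'I_n -> K) : (forall k, in_ge w 0 (h k)) ->
  red (\sum_k h k) = \sum_k red (h k).
Proof.
elim: n h => [|n IH] h hh; first by rewrite !big_ord0 red0.
by rewrite !big_ord_recr /= redD ?IH //; apply: in_ge_sum.
Qed.

Lemma red_surj a : exists x, in_ge w 0 x /\ red x = a.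
Proof.
exists (val (repr a)); have h : in_ge w 0 (val (repr a)) by exact: filtered_valP.
split=> //; rewrite (redE h) -[RHS]reprK; exact: pi_gr_eq.
Qed.

Definition lift_res (a : residue_field w) : K := val (repr a).

Lemma lift_res_ge a : in_ge w 0 (lift_res a).
Proof. exact: filtered_valP. Qed.

Lemma lift_resK a : red (lift_res a) = a.
Proof. by rewrite (redE (lift_res_ge a)) -[RHS]reprK; apply: pi_gr_eq. Qed.

Lemma in_ge0_horner (p : {poly K}) x : (forall k, in_ge w 0 p`_k) -> in_ge w 0 x ->
  in_ge w 0 p.[x].
Proof.
move=> hp hx; rewrite horner_coef; apply: in_ge_sum => k _.
by rewrite in_ge0_mul ?in_ge0X.
Qed.

Lemma in_ge0_deriv (p : {poly K}) : (forall k, in_ge w 0 p`_k) ->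
  forall k, in_ge w 0 p^`()`_k.
Proof. by move=> hp k; rewrite coef_deriv -mulr_natr in_ge0_mul ?in_ge_nat. Qed.

Lemma red_horner (p : {poly K}) (q : {poly residue_field w}) x :
  (forall k, in_ge w 0 p`_k) -> (forall k, red p`_k = q`_k) -> in_ge w 0 x ->
  red p.[x] = q.[red x].
Proof.
move=> hp pq hx; rewrite horner_coef red_sum; last by move=> k; rewrite in_ge0_mul ?in_ge0X.
rewrite (@horner_coef_wide _ (size p)).
  by apply: eq_bigr => k _; rewrite redM ?in_ge0X // redX // pq.
by apply/leq_sizeP => k ks; rewrite -pq nth_default // red0.
Qed.

Lemma red_deriv (p : {poly K}) (q : {poly residue_field w}) :
  (forall k, in_ge w 0 p`_k) -> (forall k, red p`_k = q`_k) ->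
  forall k, red p^`()`_k = q^`()`_k.
Proof.
move=> hp pq k; rewrite !coef_deriv -[in LHS]mulr_natr redM ?in_ge_nat //.
by rewrite red_nat pq mulr_natr.
Qed.

End Residue.

Section ResidueExtension.
Variables (G : divOrderedGroupType) (K L : fieldType) (i : {rmorphism K -> L}).
Variables (v : valuation G K) (w : valuation G L) (vw : extends i v w).

Lemma ext_in_ge c x : in_ge w c (i x) = in_ge v c x.
Proof. by rewrite /in_ge /= vw. Qed.

Lemma ext_in_gt c x : in_gt w c (i x) = in_gt v c x.
Proof. by rewrite /in_gt /= vw. Qed.

Lemma residue_ext_red x : in_ge v 0 x -> residue_ext vw (red v x) = red w (i x).
Proof.
move=> hx; have hix : in_ge w 0 (i x) by rewrite ext_in_ge.
rewrite (redE hx) (redE hix) /residue_ext /residue_map gr_mapE; last exact: rmorphB.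
exact: pi_gr_eq.
Qed.

Lemma residue_ext_rmorphism : exists f : {rmorphism residue_field v -> residue_field w},
  f =1 residue_ext vw.
Proof.
have fB : zmod_morphism (residue_ext vw).
  move=> a b; have [x [hx <-]] := red_surj a; have [y [hy <-]] := red_surj b.
  by rewrite -redB // !residue_ext_red ?in_geB // rmorphB redB // ext_in_ge.
have fM : monoid_morphism (residue_ext vw).
  split=> [|a b]; first by rewrite -red1 residue_ext_red ?in_ge_1 // rmorph1 red1.
  have [x [hx <-]] := red_surj a; have [y [hy <-]] := red_surj b.
  by rewrite -redM // !residue_ext_red ?in_ge0_mul // rmorphM redM // ext_in_ge.
pose m1 := GRing.isZmodMorphism.Build _ _ (residue_ext vw) fB.
pose m2 := GRing.isMonoidMorphism.Build _ _ (residue_ext vw) fM.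
pose f : {rmorphism _ -> _} := HB.pack (residue_ext vw) m1 m2.
by exists f.
Qed.

End ResidueExtension.

Section Values.
Variables (G : divOrderedGroupType) (K : fieldType) (w : valuation G K).

Lemma val_X x c n : w x = Some c -> w (x ^+ n) = Some (c *+ n).
Proof.
move=> e; elim: n => [|n IH]; first by rewrite expr0 val_1.
by rewrite exprS val_M e IH /= mulrS.
Qed.

Lemma val_prod n (x : 'I_n -> K) (c : 'I_n -> G) : (forall k, w (x k) = Some (c k)) ->
  w (\prod_k x k) = Some (\sum_k c k).
Proof.
elim: n x c => [|n IH] x c h; first by rewrite !big_ord0 val_1.
by rewrite !big_ord_recr /= val_M h (IH _ (fun k => c (widen_ord (leqnSn n) k))).
Qed.

Lemma val_inv x c : w x = Some c -> w x^-1 = Some (- c).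
Proof.
move=> e; have x0 : x != 0 by apply/eqP => x0; move: e; rewrite x0 (val_oo w 0).2.
have := val_M w x x^-1; rewrite divff // val_1 e; case: (w x^-1) => //= d [].
by move/esym/eqP; rewrite addrC addr_eq0 => /eqP ->.
Qed.

Lemma val_div x y c d : w x = Some c -> w y = Some d -> w (x / y) = Some (c - d).
Proof. by move=> ex /val_inv ey; rewrite val_M ex ey. Qed.

Lemma in_gtME c d x y : w x = Some c -> in_gt w (c + d) (x * y) = in_gt w d y.
Proof.
by move=> e; rewrite !in_gtNge /= val_M e; case: (w y) => //= b; rewrite leGD2l.
Qed.

(** A product of n factors of value at most c has value at most n c. *)
Lemma in_gt_prod (rs : seq K) c :
  in_gt w (c *+ size rs) (\prod_(z <- rs) z) -> exists2 z, z \in rs & in_gt w c z.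
Proof.
elim: rs => [|z rs IH] /=.
  by rewrite big_nil mulr0n (in_gtE (f := w) _ (val_1 w)) ltxx.
rewrite big_cons mulrS => h; have [zc|znc] := boolP (in_gt w c z).
  by exists z; rewrite ?mem_head.
have [|y yrs yc] := IH; last by exists y; rewrite // inE yrs orbT.
have z0 : z != 0 by apply: contraNneq znc => ->; apply: in_gt0.
have [d wz] := rv_exists w z0.
have dc : d <= c by rewrite leGNgt -(in_gtE _ wz).
by rewrite -(in_gtME _ _ wz); apply: in_gt_le h; rewrite leGD2r.
Qed.

(** At a point of negative value the leading term is the only one of least
    value. *)
Lemma root_integral (p : {poly K}) x : (forall k, in_ge w 0 p`_k) ->
  w (lead_coef p) = Some 0 -> root p x -> in_ge w 0 x.
Proof.
move=> hp wlc px; apply: wlog_neg => nx.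
have x0 : x != 0 by apply: contraNneq nx => ->; apply: in_ge0.
have [d wx] := rv_exists w x0.
have d0 : d < 0 by rewrite ltGNge -(in_geE _ wx).
have p0 : p != 0 by apply: contraTneq isT => p0; move: wlc; rewrite p0 lead_coef0 (val_oo w 0).2.
set n := (size p).-1; have szp : size p = n.+1 by rewrite /n prednK ?size_poly_gt0.
have wn : w (lead_coef p * x ^+ n) = Some (d *+ n) by rewrite val_M wlc (val_X n wx) /= add0r.
have : in_gt w (d *+ n) (lead_coef p * x ^+ n).
  have -> : lead_coef p * x ^+ n = - \sum_(k < n) p`_k * x ^+ k.
    apply/eqP; rewrite -addr_eq0 addrC lead_coefE -/n.
    by move/eqP: px; rewrite horner_coef szp big_ord_recr /= => ->.
  rewrite in_gtN; apply: in_gt_sum => k _.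
  have h : in_ge w (0 + d *+ k) (p`_k * x ^+ k).
    by apply: in_geM; [apply: hp | apply: in_geX; rewrite (in_geE (f := w) _ wx) lexx].
  apply: in_ge_lt h; rewrite add0r -[X in _ *+ X < _](subnK (ltnW (ltn_ord k))) mulrnDr.
  rewrite -[X in _ < X]add0r ltGD2r -(mul0rn _ (n - k)) ltG_pMn // subn_gt0 //.
by rewrite (in_gtE (f := w) _ wn) ltxx.
Qed.

Lemma in_ge0_prod_XsubC (rs : seq K) : (forall z, z \in rs -> in_ge w 0 z) ->
  forall k, in_ge w 0 (\prod_(z <- rs) ('X - z%:P))`_k.
Proof.
move=> rs_ge; have h : poly_ge w 0 0 (\prod_(z <- rs) ('X - z%:P)).
  rewrite big_seq; elim/big_ind: _ => [|p1 p2 h1 h2|z /rs_ge z_ge].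
  - by apply: poly_geC; apply: in_ge_1.
  - by rewrite -[X in poly_ge _ _ X]addr0; apply: poly_geM.
  - by apply: poly_geD; [apply: poly_geX | apply: poly_geN; apply: poly_geC].
by move=> k; have := h k; rewrite mul0rn subr0.
Qed.

End Values.

(** * Conjugates over a henselian field *)
Lemma fieldExt_algebraic (K : fieldType) (N : fieldExtType K) (x : N) :
  algebraicOver (in_alg N) x.
Proof.
have /polyOver1P[q qE] := minPolyOver 1 x; exists q.
  by rewrite -(map_poly_eq0 (in_alg N)) -qE monic_neq0 ?monic_minPoly.
by rewrite -qE root_minPoly.
Qed.

Lemma algebraic_trans (F K L : fieldType) (j : {rmorphism F -> K}) (i : {rmorphism K -> L}) :
  (forall c, algebraicOver j c) -> forall x, algebraicOver i x -> algebraicOver (i \o j) x.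
Proof.
move=> jalg x /integral_algebraic[p pm px]; apply/integral_algebraic.
apply: integral_root_monic px _; first by rewrite map_monic.
move=> _ /(nthP 0)[k _ <-]; rewrite coef_map /=.
apply/integral_algebraic; have [q q0 qk] := jalg p`_k; exists q => //.
by rewrite (map_poly_comp i j) fmorph_root.
Qed.

Lemma henselian_unique (G : divOrderedGroupType) (K L : fieldType) (v : valuation G K)
    (i : {rmorphism K -> L}) (w1 w2 : valuation G L) : henselian v ->
  (forall x, algebraicOver i x) -> extends i v w1 -> extends i v w2 -> w1 =1 w2.
Proof.
move=> hv ialg e1 e2 x; have [w [_ uw]] := hv L i ialg.
by rewrite (uw w1 e1) (uw w2 e2).
Qed.

Lemma henselian_ext (G : divOrderedGroupType) (F : fieldType) (K : fieldExtType F)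
    (v : valuation G F) (w : valuation G K) :
  henselian v -> extends (in_alg K) v w -> henselian w.
Proof.
move=> hv vw L i ialg.
have alg := algebraic_trans (@fieldExt_algebraic F K).
have Lalg x : algebraicOver (i \o in_alg K) x by apply: alg.
have [w1 [w1e w1u]] := hv L _ Lalg.
exists w1; split=> [c|w' w'e]; last by apply: w1u => c; rewrite /= w'e; apply: vw.
apply: (henselian_unique (w1 := pullback i w1) hv (@fieldExt_algebraic F K)) => //.
Qed.

(** The inverse is part of the definition because descent has to undo the action
    of an automorphism. *)
Definition K_automorphism (K : fieldType) (N : fieldExtType K) (t : {rmorphism N -> N}) :=
  (forall c : K, t c%:A = c%:A) /\ exists t' : {rmorphism N -> N},
    [/\ forall c : K, t' c%:A = c%:A, cancel t t' & cancel t' t].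

Section Conjugates.
Variables (K C : fieldType) (i : {rmorphism K -> C}).

(** Conjugacy over K, without a choice of a minimal polynomial. *)
Definition conjugate (z z' : C) := forall q : {poly K},
  root (map_poly i q) z -> root (map_poly i q) z'.

Variables (N : splittingFieldType K) (h : {rmorphism N -> C}).
Hypothesis hi : forall c : K, h c%:A = i c.

Lemma splitting_map q : map_poly i q = map_poly h (map_poly (in_alg N) q).
Proof. by rewrite -map_poly_comp (eq_map_poly hi). Qed.

Lemma conjugate_lift x z : conjugate (h x) z ->
  exists (y : N) (t : {rmorphism N -> N}), [/\ K_automorphism t, t x = y & h y = z].
Proof.
have /polyOver1P[q qE] := minPolyOver 1 x => /(_ q).
rewrite splitting_map -qE => zx; have {}zx : root (map_poly h (minPoly 1 x)) z.
  by apply: zx; rewrite fmorph_root root_minPoly.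
have [r /eqP rE] := splitting_field_normal 1 x.
have [y yr hy] : exists2 y, y \in r & h y = z.
  move: zx; rewrite rE rmorph_prod (eq_bigr _ (fun y _ => map_polyXsubC _ _)).
  rewrite -(big_map h xpredT (fun z => 'X - z%:P)) root_prod_XsubC => /mapP[y yr ->].
  by exists y.
have xy : root (minPoly 1 x) y by rewrite rE root_prod_XsubC.
have [s _ sx] := normalField_root_minPoly (sub1v _) (normalFieldf 1) (memvf x) xy.
exists y, (s : 'AEnd(N)); split=> //; split=> [c|]; first exact: rmorph_alg.
exists ((s^-1)%g : 'AEnd(N)); split=> [c|u|u]; first exact: rmorph_alg.
  by have := galM s (s^-1)%g (memvf u); rewrite mulgV gal_id.
by have := galM (s^-1)%g s (memvf u); rewrite mulVg gal_id.
Qed.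

Lemma conjugate_aut (t : {rmorphism N -> N}) x : (forall c : K, t c%:A = c%:A) ->
  conjugate (h x) (h (t x)).
Proof.
move=> tc q; rewrite splitting_map !fmorph_root => qx.
have -> : map_poly (in_alg N) q = map_poly t (map_poly (in_alg N) q).
  by rewrite -map_poly_comp; apply: eq_map_poly => c /=; rewrite tc.
by rewrite fmorph_root.
Qed.

End Conjugates.

Lemma in_gt_expB (G : divOrderedGroupType) (R : nzRingType) (f : ring_value G R) d x y n :
  in_ge f d x -> in_ge f d y -> in_gt f d (x - y) -> in_gt f (d *+ n) (x ^+ n - y ^+ n).
Proof.
move=> xd yd xy; elim: n => [|n IH]; first by rewrite !expr0 subrr in_gt0.
have -> : x ^+ n.+1 - y ^+ n.+1 = x * (x ^+ n - y ^+ n) + (x - y) * y ^+ n.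
  by rewrite mulrBr mulrBl -!exprS addrA subrK.
by rewrite mulrS; apply: in_gtD; [apply: in_gtMr | apply: in_gtMl => //; apply: in_geX].
Qed.

(** The class of d acts by translation on the e classes of values of L modulo
    those of F, hence as a permutation p. The sum over all classes k of
    r_k + d - r_(p k), which are values of F, is e d. *)
Lemma ramification_power (G : divOrderedGroupType) (F L : fieldType) (vF : valuation G F) (wL : valuation G L)
    e d l :
  ramification_index vF wL e -> wL l = Some d -> (0 < e)%N /\ exists y, vF y = Some (d *+ e).
Proof.
case=> r [r_val r_uniq] l_val; split.
  by have [|k _] := r_uniq d; [exists l | apply: leq_ltn_trans (ltn_ord k)].
have tr k : exists k' y, vF y = Some (r k + d - r k').
  have [x xk] := r_val k; have [|k' [[y yk'] _]] := r_uniq (r k + d).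
    by exists (x * l); rewrite val_M xk l_val.
  by exists k', y.
have [s /fin_all_exists[y yE]] := fin_all_exists tr.
have s_inj : injective s.
  move=> k k' skk'; have [k1 [_ k1u]] := r_uniq (r k) (r_val k).
  rewrite -(k1u k); last by exists 1; rewrite subrr val_1.
  apply: k1u; exists (y k / y k').
  rewrite (val_div (yE k) (yE k')) skk' opprD opprK addrACA.
  by rewrite addNr addr0 opprD addrACA subrr addr0.
exists (\prod_k y k); rewrite (val_prod yE) !big_split /= sumrN.
rewrite [X in Some (_ + _ - X) = _](_ : _ = \sum_k r k); last by rewrite [RHS](reindex_inj s_inj).
by rewrite addrC addKr sumr_const card_ord.
Qed.

Section HenselianClosure.
Variables (G : divOrderedGroupType) (K : fieldType) (v : valuation G K).
Hypothesis hens : henselian v.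
Variables (C : closedFieldType) (i : {rmorphism K -> C}).
Hypothesis ialg : forall z, algebraicOver i z.
Variable w : valuation G C.
Hypothesis iw : extends i v w.

Lemma normal_closure (s : seq C) : exists (N : splittingFieldType K) (h : {rmorphism N -> C}),
  (forall c : K, h c%:A = i c) /\ forall z, z \in s -> exists x, h x = z.
Proof.
have [p [p0 ps]] : exists p : {poly K}, p != 0 /\ forall z, z \in s -> root (map_poly i p) z.
  elim: s => [|z s [p [p0 ps]]]; first by exists 1; rewrite oner_eq0.
  have [q q0 qz] := ialg z; exists (q * p); split; first by rewrite mulf_neq0.
  by move=> y; rewrite inE rmorphM rootM => /orP[/eqP ->|/ps ->]; rewrite ?qz ?orbT.
have [rs rsE] := closed_field_poly_normal (map_poly i p).
have lc0 : lead_coef (map_poly i p) != 0 by rewrite lead_coef_eq0 map_poly_eq0.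
have prs : map_poly i p %= \prod_(z <- rs) ('X - z%:P) by rewrite rsE eqp_scale.
have [N [h [rs' [hi hrs]]]] := splitting_field_in p0 prs.
exists N, h; split=> // z /ps; rewrite (eqp_root prs) root_prod_XsubC -hrs.
by case/mapP => x _ ->; exists x.
Qed.

(** Composition with t yields another extension of v to N, and there is only
    one. *)
Lemma val_aut (N : splittingFieldType K) (h : {rmorphism N -> C}) (t : {rmorphism N -> N}) x :
  (forall c : K, h c%:A = i c) -> (forall c : K, t c%:A = c%:A) -> w (h (t x)) = w (h x).
Proof.
move=> hi tc.
apply: (henselian_unique (w1 := pullback (h \o t) w) (w2 := pullback h w) hens (@fieldExt_algebraic K N)).
  by move=> c; rewrite /= tc hi iw.
by move=> c; rewrite /= hi iw.
Qed.

Lemma conjugate_val z z' : conjugate i z z' -> w z = w z'.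
Proof.
have [N [h [hi hN]]] := normal_closure [:: z].
have [x <-] := hN z (mem_head _ _).
by case/(conjugate_lift hi) => y [t [[tc _] <- <-]]; rewrite val_aut.
Qed.

Lemma minimal_poly z : exists q : {poly K}, [/\ q \is monic, root (map_poly i q) z,
  forall z', root (map_poly i q) z' -> conjugate i z z' &
  forall p : {poly K}, root (map_poly i p) z -> q %| p].
Proof.
have [N [h [hi hN]]] := normal_closure [:: z].
have [x <-] := hN z (mem_head _ _).
have /polyOver1P[q qE] := minPolyOver 1 x.
have qdvd p : root (map_poly i p) (h x) -> q %| p.
  rewrite (splitting_map hi) fmorph_root => px; rewrite -(dvdp_map (in_alg N)) -qE.
  by apply: minPoly_dvdp => //; apply/polyOver1P; exists p.
exists q; split=> //; first by rewrite -(map_monic (in_alg N)) -qE monic_minPoly.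
  by rewrite (splitting_map hi) -qE fmorph_root root_minPoly.
move=> z' qz' p /qdvd; rewrite -(dvdp_map i) => d; move: qz'.
by rewrite !root_factor_theorem => /dvdp_trans; apply.
Qed.

(** For z of value d this says that the Galois group fixes the leading term
    of z. *)
Definition rigid (d : G) (z : C) := forall z', conjugate i z z' -> in_gt w d (z' - z).

(** An automorphism sends y to a root of P that is close to a conjugate of z,
    hence to z, hence is y again. So y is purely inseparable over K; being a
    simple root of P, it is also separable. *)
Lemma rigid_root_rational d z (P : {poly K}) y : rigid d z ->
  root (map_poly i P) y -> (map_poly i P)^`().[y] != 0 -> in_gt w d (y - z) ->
  (forall y', root (map_poly i P) y' -> in_gt w d (y' - z) -> y' = y) ->
  exists a, i a = y.
Proof.
move=> zr Py P'y yz yu.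
have [N [h [hi hN]]] := normal_closure [:: z; y].
have [|x xz] := hN z; first by rewrite mem_head.
have [|u uy] := hN y; first by rewrite !inE eqxx orbT.
have fixed u' : conjugate i (h u) (h u') -> u' = u.
  case/(conjugate_lift hi) => _ [t [[tc _] <- /fmorph_inj <-]].
  apply: (fmorph_inj h); rewrite uy; apply: yu.
    by apply: (conjugate_aut hi tc); rewrite uy.
  have : in_gt w d (h (t u) - h (t x)).
    by rewrite -!rmorphB /in_gt /= (val_aut _ hi tc) rmorphB uy xz.
  move=> h1; rewrite -[h (t u)](subrK (h (t x))) -addrA; apply: in_gtD => //.
  by apply: zr; rewrite -xz; apply: conjugate_aut.
have [r /eqP rE] := splitting_field_normal 1 u.
have ru z' : z' \in r -> z' = u.
  move=> zr'; apply: fixed => p; rewrite (splitting_map hi) !fmorph_root => pu.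
  have mp : minPoly 1 u %| map_poly (in_alg N) p.
    by apply: minPoly_dvdp => //; apply/polyOver1P; exists p.
  have : root (minPoly 1 u) z' by rewrite rE root_prod_XsubC.
  by rewrite !root_factor_theorem => /dvdp_trans; apply.
have mP : minPoly 1 u %| map_poly (in_alg N) P.
  apply: minPoly_dvdp; first by apply/polyOver1P; exists P.
  by rewrite -(fmorph_root h) -(splitting_map hi) uy.
have : u \in 1%VS.
  apply/minPoly_XsubC; case: r rE ru => [|u1 [|u2 r]] rE ru.
  - by have := root_minPoly 1 u; rewrite rE big_nil (negPf (root1 _)).
  - by rewrite rE big_seq1 (ru u1) ?mem_head.
  - case/negP: P'y; rewrite (splitting_map hi) -uy deriv_map horner_map fmorph_eq0.
    move: mP; rewrite rE !big_cons (ru u1) ?mem_head // (ru u2) ?inE ?eqxx ?orbT //.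
    case/dvdpP => Q ->; rewrite !derivM !hornerE /= subrr.
    by rewrite !(mul0r, mulr0, addr0, add0r).
case/vlineP => a ua; exists a; by rewrite -uy ua hi.
Qed.

Lemma rigid_exp d z e b : w z = Some d -> w (i b) = Some (d *+ e) ->
  rigid d z -> rigid 0 (z ^+ e / i b).
Proof.
move=> wz wb zr y; have [N [h [hi hN]]] := normal_closure [:: z].
have [x xz] := hN z (mem_head _ _).
have -> : z ^+ e / i b = h (x ^+ e / b%:A) by rewrite fmorph_div rmorphXn xz hi.
case/(conjugate_lift hi) => _ [t [[tc _] <- <-]].
rewrite !(fmorph_div, rmorphXn) tc hi xz /= -mulrBl.
have tx : in_gt w d (h (t x) - z) by apply: zr; rewrite -xz; apply: conjugate_aut.
have : in_gt w (d *+ e) (h (t x) ^+ e - z ^+ e).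
  apply: in_gt_expB => //; last by rewrite (in_geE (f := w) _ wz).
  by rewrite (in_ge_subE tx) (in_geE (f := w) _ wz).
rewrite -(in_gtME _ _ (val_inv wb)) addNr.
by rewrite mulrC.
Qed.

(** The residue of u is a simple root of a polynomial over the residue field
    of v. A lift P of that polynomial has exactly one root close to u, and
    [rigid_root_rational] applies to it. *)
Lemma rigid_residue (L : fieldType) (j : {rmorphism K -> L}) (wL : valuation G L)
    (vL : extends j v wL) (h : {rmorphism L -> C}) u :
  residue_separable vL -> h \o j =1 i -> (forall x, w (h x) = wL x) -> wL u = Some 0 ->
  rigid 0 (h u) -> exists a, in_gt w 0 (h u - i a).
Proof.
move=> sepL hi wLE u_val; set z := h u => z_rigid; have hu : h u = z by [].
have u_ge : in_ge wL 0 u by rewrite (in_geE (f := wL) _ u_val) lexx.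
have z_ge : in_ge w 0 z by rewrite -hu /in_ge /= wLE.
have [p [p_sep p_root]] := sepL (red wL u).
have [f fE] := residue_ext_rmorphism vL.
rewrite -(eq_map_poly fE) in p_root.
have p0 : p != 0 by apply: separable_poly_neq0.
pose P := \poly_(k < size p) lift_res p`_k.
have P_ge k : in_ge v 0 P`_k.
  by rewrite coef_poly; case: ifP => _; rewrite ?lift_res_ge ?in_ge0.
have P_red k : red v P`_k = p`_k.
  rewrite coef_poly; case: ltnP => [_|le]; first exact: lift_resK.
  by rewrite red0 nth_default.
have lc_red : red v (lift_res (lead_coef p)) != 0 by rewrite lift_resK lead_coef_eq0.
have lc_val : v (lift_res (lead_coef p)) = Some 0.
  by apply/(rv_eqP v); rewrite lift_res_ge -red_eq0 ?lift_res_ge.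
have lc0 : lift_res (lead_coef p) != 0 by apply/eqP => /(val_oo v); rewrite lc_val.
have szP : size P = size p by rewrite size_poly_eq.
have lcP : lead_coef P = lift_res (lead_coef p).
  by rewrite lead_coefE szP coef_poly ltn_predL lt0n size_poly_eq0 p0.
pose PL := map_poly j P.
have PL_ge k : in_ge wL 0 PL`_k by rewrite coef_map (ext_in_ge vL).
have PL_red k : red wL PL`_k = (map_poly f p)`_k.
  by rewrite !coef_map /= fE -P_red (residue_ext_red vL).
have PLu : in_gt wL 0 PL.[u].
  by rewrite -red_eq0 ?in_ge0_horner // (red_horner PL_ge PL_red) // (rootP p_root).
have PL'u : ~~ in_gt wL 0 PL^`().[u].
  rewrite -red_eq0 ?in_ge0_horner //; last exact: in_ge0_deriv.
  rewrite (red_horner (in_ge0_deriv PL_ge) (red_deriv PL_ge PL_red)) //.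
  rewrite deriv_map; apply: coprimep_root p_root.
  by rewrite coprimep_map; move: p_sep; rewrite separable_poly.unlock.
pose PC := map_poly i P.
have PCE : PC = map_poly h PL by rewrite /PC /PL -[RHS]map_poly_comp; apply: eq_map_poly => c; apply/esym/hi.
have PCz : in_gt w 0 PC.[z] by rewrite -hu PCE horner_map /in_gt /= wLE.
have PC'z : ~~ in_gt w 0 PC^`().[z] by rewrite -hu PCE deriv_map horner_map /in_gt /= wLE.
have PC_ge k : in_ge w 0 PC`_k by rewrite coef_map (ext_in_ge iw).
have lcPC : w (lead_coef PC) = Some 0 by rewrite lead_coef_map lcP iw.
have [rs rsE] := closed_field_poly_normal PC.
have lcPC0 : lead_coef PC != 0 by apply/eqP => /(val_oo w); rewrite lcPC.
have rs_root t : t \in rs = root PC t by rewrite rsE rootZ // root_prod_XsubC.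
have rs_ge t : t \in rs -> in_ge w 0 t.
  by rewrite rs_root; apply: root_integral.
have [t trs tz] : exists2 t, t \in rs & in_gt w 0 (z - t).
  have : in_gt w 0 (\prod_(t <- map (fun t => z - t) rs) t).
    have := PCz; rewrite rsE hornerZ horner_prod big_map -[in X in X -> _](addr0 0) (in_gtME _ _ lcPC).
    by rewrite (eq_bigr _ (fun t _ => hornerXsubC _ _)).
  move=> small; have [|_ /mapP[t trs ->] tz] := @in_gt_prod _ _ w (map (fun t => z - t) rs) 0.
    by rewrite mul0rn.
  by exists t.
have [rs' prs] : exists rs', perm_eq rs (t :: rs') by exists (rem t rs); apply: perm_to_rem.
have rs'_far t' : t' \in rs' -> ~~ in_gt w 0 (z - t').
  move=> t'rs'; apply: contra PC'z => t'z.
  have prs2 : perm_eq rs [:: t, t' & rem t' rs'].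
    by apply: perm_trans prs _; rewrite perm_cons perm_to_rem.
  rewrite rsE (perm_big _ prs2) /= !big_cons.
  set Q := \prod_(_ <- _) _; have Q_ge k : in_ge w 0 Q`_k.
    apply: in_ge0_prod_XsubC => t1 t1r; apply: rs_ge.
    by rewrite (perm_mem prs2) !inE t1r !orbT.
  rewrite derivZ hornerZ -[0]addr0; apply: in_gtMr.
    by rewrite (in_geE (f := w) _ lcPC) lexx.
  rewrite !derivM !derivXsubC !hornerE.
  have Qz := in_ge0_horner Q_ge z_ge; have Q'z := in_ge0_horner (in_ge0_deriv Q_ge) z_ge.
  have zt0 : in_gt w 0 (z - t) by [].
  have small x : in_ge w 0 x -> in_gt w 0 ((z - t) * x) /\ in_gt w 0 ((z - t') * x).
    by move=> x0; split; rewrite -[0]addr0; apply: in_gtMl.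
  apply: in_gtD; first by have [] := small _ Qz.
  by have [] := small _ (in_geD Qz (in_gtW (small _ Q'z).2)).
have PCt : PC = (lead_coef PC *: \prod_(y <- rs') ('X - y%:P)) * ('X - t%:P).
  by rewrite {1}rsE (perm_big _ prs) big_cons -scalerAl mulrC.
have [a ta] : exists a, i a = t.
  apply: (rigid_root_rational z_rigid (P := P)).
  - by rewrite -/PC -rs_root.
  - rewrite -/PC PCt derivM derivXsubC mulr1 hornerD hornerM hornerXsubC subrr mulr0 add0r hornerZ mulf_neq0 //.
    rewrite horner_prod; apply/negP; rewrite prodf_seq_eq0 => /hasP[t' t'rs'] /=.
    rewrite hornerXsubC subr_eq0 => /eqP tt'.
    by case/negP: (rs'_far t' t'rs'); rewrite -tt'.
  - by rewrite -in_gtN opprB.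
  - move=> t'; rewrite -/PC -rs_root (perm_mem prs) inE => /orP[/eqP //|t'rs'].
    by rewrite -in_gtN opprB (negPf (rs'_far t' t'rs')).
by exists a; rewrite ta.
Qed.

(** The Galois group of a tame extension moves the leading term of any element
    that has not the leading term of an element of K. Let e be the ramification
    index. First, l^e has the value of some y in K, and the residue of l^e / y
    is rational by [rigid_residue]. So l^e is close to some b in K. As e is a
    unit, the polynomial X^e - b has only one root close to l, and
    [rigid_root_rational] applies to it. *)
Lemma rigid_tame (L : fieldExtType K) (wL : valuation G L) (h : {rmorphism L -> C}) l d :
  tame_extension v wL -> (forall c : K, h c%:A = i c) -> w (h l) = Some d ->
  rigid d (h l) -> exists a, in_gt w d (h l - i a).
Proof.
case=> vL [e [_ [ram _ _ sepL e_char]]] hi wl zr.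
have wLE x : w (h x) = wL x.
  apply: (henselian_unique (w1 := pullback h w) hens (@fieldExt_algebraic K L)) => //.
  by move=> c; rewrite /= hi iw.
have l_val : wL l = Some d by rewrite -wLE.
have [e_gt0 [y y_val]] := ramification_power ram l_val.
have iy_val : w (i y) = Some (d *+ e) by rewrite iw y_val.
have iy0 : i y != 0 by apply/eqP => /(val_oo w); rewrite iy_val.
have e_unit : w e%:R = Some 0.
  have ge : in_ge v 0 e%:R by exact: in_ge_nat.
  rewrite -(rmorph_nat i) iw; apply/(rv_eqP v); rewrite ge /= -red_eq0 // red_nat.
  apply/negP => e0; have [p pch] := natf0_pchar e_gt0 e0.
  by case/negP: (e_char p pch); rewrite (dvdn_pcharf pch).
pose u := l ^+ e / y%:A.
have u_val : wL u = Some 0.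
  by rewrite /u (val_div (val_X e l_val) (_ : _ = Some (d *+ e))) ?subrr // (vL y).
pose z := h l ^+ e / i y.
have hu : h u = z by rewrite /u fmorph_div rmorphXn hi.
have z_rigid : rigid 0 (h u) by rewrite hu; apply: rigid_exp wl _ zr.
have [a1 a1E] := rigid_residue sepL hi wLE u_val z_rigid; rewrite hu in a1E.
(* y a1 is the element b of K close to l^e *)
have c_val : v (y * a1) = Some (d *+ e).
  rewrite val_M y_val; have : w (i a1) = Some 0.
    apply/(rv_eqP w); rewrite -(in_ge_subE a1E) -(in_gt_subE a1E).
    by apply/(rv_eqP w); rewrite -hu /= wLE.
  by rewrite iw => -> /=; rewrite addr0.
have c_close : in_gt w (d *+ e) (h l ^+ e - i (y * a1)).
  rewrite -(in_gtME _ _ (val_inv iy_val)) addNr rmorphM.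
  by rewrite mulrBr mulrA mulVf // mul1r mulrC.
pose P := 'X^e - (y * a1)%:P.
have PC : map_poly i P = 'X^e - (i (y * a1))%:P by rewrite rmorphB rmorphXn /= map_polyX map_polyC.
have lcP : lead_coef (map_poly i P) = 1 by rewrite PC; apply/eqP; rewrite -monicE monicXnsubC.
have szP : size (map_poly i P) = e.+1 by rewrite PC size_XnsubC.
have [rs rsE] := closed_field_poly_normal (map_poly i P).
rewrite lcP scale1r in rsE.
have [t trs tl] : exists2 t, t \in rs & in_gt w d (h l - t).
  have srs : size rs = e by apply/eqP; rewrite -eqSS -szP rsE size_prod_XsubC.
  have [|_ /mapP[t trs ->] tl] := @in_gt_prod _ _ w (map (fun t => h l - t) rs) d.
    rewrite size_map srs big_map (eq_bigr _ (fun t _ => esym (hornerXsubC t (h l)))).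
    by rewrite -horner_prod -rsE PC !hornerE.
  by exists t.
have t_val : w t = Some d.
  by apply/(rv_eqP w); rewrite -(in_ge_subE tl) -(in_gt_subE tl); apply/(rv_eqP w).
have t0 : t != 0 by apply/eqP => /(val_oo w); rewrite t_val.
have t_root t' : root (map_poly i P) t' -> t' ^+ e = i (y * a1).
  by rewrite PC rootE !hornerE subr_eq0 => /eqP.
have tP : root (map_poly i P) t by rewrite rsE root_prod_XsubC.
have [a ta] : exists a, i a = t.
  apply: (rigid_root_rational zr tP).
  - rewrite PC derivB derivC subr0 derivXn hornerMn !hornerE -mulr_natr mulf_neq0 ?expf_neq0 //.
    by apply/eqP => /(val_oo w); rewrite e_unit.
  - by rewrite -in_gtN opprB.
  - move=> t' /t_root t'e t'l; pose s := t' / t.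
    have st : t' = s * t by rewrite divfK.
    have tt' : in_gt w d (t' - t).
      by rewrite -[t'](subrK (h l)) -addrA; apply: in_gtD.
    have s1 : in_gt w 0 (s - 1).
      by rewrite -(in_gtME _ _ t_val) addr0 mulrBr mulr1 mulrC -st.
    have s_ge : in_ge w 0 s by rewrite (in_ge_subE s1) in_ge_1.
    have se : s ^+ e = 1.
      apply: (mulIf (expf_neq0 e t0)); rewrite mul1r -exprMn -st t'e; exact/esym/t_root.
    have : (s - 1) * (\sum_(k < e) s ^+ k) == 0 by rewrite -subrX1 se subrr.
    rewrite mulf_eq0 subr_eq0 => /orP[/eqP s1E|/eqP s0]; first by rewrite st s1E mul1r.
    have : red w (\sum_(k < e) s ^+ k) = red w e%:R.
      have redS : red w s = 1.
        by apply/eqP; rewrite -subr_eq0 -(red1 w) -redB ?in_ge_1 // red_eq0 // in_geB ?in_ge_1.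
      rewrite red_sum => [|k]; last exact: in_ge0X.
      rewrite (eq_bigr (fun=> 1)) => [|k _]; last by rewrite redX // redS expr1n.
      by rewrite sumr_const card_ord red_nat.
    rewrite s0 red0 => /esym/eqP; rewrite red_eq0 ?in_ge_nat //.
    by rewrite (in_gtE (f := w) _ e_unit) ltxx.
by exists a; rewrite ta.
Qed.

End HenselianClosure.

(** * Lifting isotropic elements *)
Section UnitFactor.
Variables (G : divOrderedGroupType) (K : fieldType) (v : valuation G K).
Hypothesis hens : henselian v.
Variables (C : closedFieldType) (i : {rmorphism K -> C}).
Hypothesis ialg : forall z, algebraicOver i z.
Variable w : valuation G C.
Hypothesis iw : extends i v w.

(** The roots of an irreducible polynomial are conjugate, so they have the same
    value: each irreducible factor of p goes entirely to one side. *)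
Lemma split_unit_roots (p : {poly K}) : p \is monic ->
  (forall z, root (map_poly i p) z -> in_ge w 0 z) ->
  exists p1 p0, [/\ p1 \is monic, p0 \is monic, p = p1 * p0,
    forall z, root (map_poly i p1) z -> in_gt w 0 z &
    forall z, root (map_poly i p0) z -> in_ge w 0 z && ~~ in_gt w 0 z].
Proof.
have [n] := ubnP (size p); elim: n p => // n IH p szp pm pz.
have [sz1|sz1] := eqVneq (size (map_poly i p)) 1.
  exists 1, 1; rewrite mulr1 monic1 !rmorph1; split=> //; try by move=> z; rewrite (negPf (root1 z)).
  by apply/eqP; rewrite -eqp_monic ?monic1 // -size_poly_eq1 -(size_map_poly i) sz1.
have [z zroot] := closed_rootP _ sz1.
have [q [qm qz qconj qdvd]] := minimal_poly ialg z.
have /dvdpP[r rE] := qdvd p zroot.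
have rm : r \is monic by move: pm; rewrite rE (monicMr r qm).
have q_gt1 : (1 < size q)%N.
  by rewrite -(size_map_poly i) (root_size_gt1 _ qz) // map_poly_eq0 monic_neq0.
have [||t rt|p1 [p0 [p1m p0m rE' p1z p0z]]] := IH r.
- move: szp; rewrite rE size_monicM ?monic_neq0 //.
  by case: (size q) q_gt1 => [|[|k]] // _; rewrite !addnS /= ltnS; apply: leq_ltn_trans (leq_addr _ _).
- exact: rm.
- by apply: pz; rewrite rE rmorphM rootM rt.
have zval t : root (map_poly i q) t -> w t = w z by move/qconj/(conjugate_val hens ialg iw).
have [small|nsmall] := boolP (in_gt w 0 z).
  exists (q * p1), p0; rewrite rpredM //; split=> //; first by rewrite rE rE' mulrC mulrA.
  move=> t; rewrite rmorphM rootM => /orP[/zval e|]; last exact: p1z.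
  by rewrite /in_gt /= e.
exists p1, (p0 * q); rewrite rpredM //; split=> //; first by rewrite rE rE' mulrA.
move=> t; rewrite rmorphM rootM => /orP[|qt]; first exact: p0z.
rewrite pz /=; first by rewrite in_gtNge /= (zval t qt).
by rewrite rE rmorphM rootM qt orbT.
Qed.

Lemma unit_roots_unit (p : {poly K}) : p \is monic ->
  (forall z, root (map_poly i p) z -> in_ge w 0 z && ~~ in_gt w 0 z) ->
  (forall k, in_ge v 0 p`_k) /\ v p`_0 = Some 0.
Proof.
move=> pm pz; have [rs rsE] := closed_field_poly_normal (map_poly i p).
rewrite lead_coef_map (monicP pm) rmorph1 scale1r in rsE.
have rs_ge z : z \in rs -> in_ge w 0 z && ~~ in_gt w 0 z.
  by move=> zr; apply: pz; rewrite rsE root_prod_XsubC.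
split=> [k|].
  rewrite -(ext_in_ge iw) -coef_map rsE; apply: in_ge0_prod_XsubC.
  by move=> z /rs_ge/andP[].
rewrite -iw -coef_map -horner_coef0 rsE horner_prod big_seq.
elim/big_ind: _ => [|x y ex ey|z /rs_ge zr]; first exact: val_1.
  by rewrite val_M ex ey /= addr0.
by rewrite hornerXsubC sub0r val_N; apply/(rv_eqP w).
Qed.

End UnitFactor.

Section Involution.
Variables (G : divOrderedGroupType) (F : fieldType) (v : valuation G F).
Variables (A : falgType F) (s : 'End(A)) (g : surmultiplicative v A).
Hypothesis sI : is_involution s.
Hypothesis sg : forall x, g (s x) = g x.

Lemma involM x y : s (x * y) = s y * s x. Proof. exact: sI.1. Qed.
Lemma involK x : s (s x) = x. Proof. exact: sI.2. Qed.

Lemma invol1 : s 1 = 1.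
Proof. by rewrite -[LHS]mul1r -{1}(involK 1) -involM mul1r involK. Qed.

Lemma invol_exp x n : s (x ^+ n) = s x ^+ n.
Proof. by elim: n => [|n IH]; rewrite ?invol1 // exprS involM IH exprSr. Qed.

Lemma invol_horner x (p : {poly F}) : s (horner_alg x p) = horner_alg (s x) p.
Proof.
rewrite !horner_algE linear_sum; apply: eq_bigr => k _.
by rewrite linearZ /= invol_exp.
Qed.

Lemma invol_ge c x : in_ge g c (s x) = in_ge g c x.
Proof. by rewrite /in_ge /= sg. Qed.

Lemma horner_alg_comp (x : A) (p q : {poly F}) :
  horner_alg x (p \Po q) = horner_alg (horner_alg x q) p.
Proof.
elim/poly_ind: p => [|p c IH]; first by rewrite comp_poly0 !rmorph0.
by rewrite comp_polyD comp_polyM comp_polyX comp_polyC !rmorphD !rmorphM /= IH horner_algX !horner_algC.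
Qed.

Section Henselian.
Hypothesis hens : henselian v.
Variables (C : closedFieldType) (i : {rmorphism F -> C}).
Hypothesis ialg : forall z, algebraicOver i z.
Variable w : valuation G C.
Hypothesis iw : extends i v w.
Hypothesis g_norm : is_norm v g.

(** Let p = p1 p0 be an integral equation of y, where the roots of p1 are small
    and those of p0 are units; the isotropic element is f = p0(y). It is not
    zero because f m is p0(0) m up to a small term. Both p1(y) and p1(1 - y)
    kill s(f)f = p0(1 - y) p0(y), and they generate the unit ideal because t and
    1 - t cannot both be small. *)
Lemma isotropic_of_nonunit y m c : in_ge g 0 y -> y + s y = 1 ->
  in_ge g c m -> ~~ in_gt g c m -> in_gt g c (y * m) ->
  exists2 f, f != 0 & s f * f = 0.
Proof.
move=> y0 sy mc mnc ym.
have {}sy : s y = 1 - y by rewrite -sy addrC addKr.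
have [n [e [se pe ne]]] := norm_splitting_basis g_norm.
have [p [pm _ pge pe0]] : exists p : {poly F}, [/\ p \is monic, size p = n.+1,
    poly_ge v 0 (0 *+ n) p & forall j, horner_alg y p * e j = 0].
  apply: (weighted_char_poly (rvZ g) se ne) => [j|d j ej]; first exact: pe.
  exact: in_geM.
have p_ge k : in_ge v 0 p`_k by have := pge k; rewrite !mul0rn subr0.
have py : horner_alg y p = 0.
  rewrite -[LHS]mulr1; have [a ->] := pe 1.
  by rewrite mulr_sumr big1 // => j _; rewrite -scalerAr pe0 scaler0.
have [|p1 [p0 [p1m p0m pE p1z p0z]]] := split_unit_roots hens ialg iw pm.
  move=> z; apply: root_integral => [k|]; first by rewrite coef_map (ext_in_ge iw).
  by rewrite lead_coef_map (monicP pm) rmorph1 val_1.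
have [p0_ge p00] := unit_roots_unit iw p0m p0z.
pose f := horner_alg y p0; exists f.
  apply: contraNneq mnc => f0.
  rewrite -(in_gtZE (rvZ g) c m p00) add0r.
  suff : in_gt g c (f * m - p0`_0 *: m) by rewrite f0 mul0r sub0r in_gtN.
  rewrite /f horner_algE; case E: (size p0) => [|k].
    by move: (monic_neq0 p0m); rewrite -size_poly_eq0 E.
  rewrite big_ord_recl expr0 mulrDl -scalerAl mul1r addrC addKr mulr_suml.
  apply: in_gt_sum => l _; rewrite -scalerAl -[c]add0r; apply: (in_gtZr (rvZ g)) => //.
  rewrite exprSr -mulrA -[c]add0r; apply: in_gtMr => //.
  by rewrite -(mul0rn _ l); apply: in_geX.
pose X1 : {poly F} := 1 - 'X.
have X1y : horner_alg y X1 = 1 - y by rewrite rmorphB rmorph1 /= horner_algX.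
have comp p' : horner_alg y (p' \Po X1) = s (horner_alg y p').
  by rewrite horner_alg_comp X1y invol_horner sy.
have sf : s f = horner_alg y (p0 \Po X1) by rewrite comp.
have h1 : horner_alg y (p1 * ((p0 \Po X1) * p0)) = 0.
  by rewrite mulrCA -pE rmorphM /= py mulr0.
have h2 : horner_alg y ((p1 \Po X1) * ((p0 \Po X1) * p0)) = 0.
  by rewrite mulrA -comp_polyM -pE rmorphM /= comp py raddf0 mul0r.
have cop : coprimep p1 (p1 \Po X1).
  rewrite -(coprimep_map i) coprimep_def; apply: contraT => /closed_rootP[z].
  rewrite root_gcd => /andP[z1].
  rewrite map_comp_poly rmorphB rmorph1 /= map_polyX /root horner_comp !hornerE => z2.
  have := in_gtD (p1z _ z1) (p1z _ z2).
  by rewrite addrC subrK (in_gtE (f := w) _ (val_1 w)) ltxx.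
have /Bezout_eq1_coprimepP[[a b] /= ab] := cop.
rewrite sf /f -rmorphM; set Q := _ * p0 in h1 h2 *.
have -> : Q = a * (p1 * Q) + b * ((p1 \Po X1) * Q) by rewrite -[LHS]mul1r -ab mulrDl -!mulrA.
by rewrite rmorphD !(rmorphM _ a) !(rmorphM _ b) /= h1 h2 !mulr0 addr0.
Qed.

(* the two properties through which the type of the involution matters *)
Hypothesis trace_strict : forall x, exists z, z + s z = x + s x /\ ele (g (x + s x)) (g z).
Hypothesis trace_one : exists x, x + s x = 1.

Lemma isotropic_lift c x : gr_semiprime g -> in_ge g c x -> ~~ in_gt g c x ->
  in_gt g (c + c) (s x * x) -> exists2 f, f != 0 & s f * f = 0.
Proof.
move=> sp xc xnc sxx.
have [y [z [d [yc zd nxz fix_xz]]]] := right_ideal_fixes sp xc xnc.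
pose e := x * y; pose m := x * z.
have e0 : in_ge g 0 e by rewrite -(subrr c); apply: in_geM.
have se0 : in_ge g 0 (s e) by rewrite invol_ge.
have mc : in_ge g (c + d) m by apply: in_geM.
have sxx' : in_gt g (c + c + - c) (s x * e) by rewrite /e mulrA; apply: in_gtMl.
rewrite addrK in sxx'.
have see : in_gt g 0 (s e * e).
  by rewrite {1}/e involM -mulrA -(subrr c) [c - c]addrC; apply: in_gtMr; rewrite ?invol_ge.
have sem : in_gt g (c + d) (s e * m).
  rewrite /e involM -mulrA -[c + d](addKr c); apply: in_gtMr; first by rewrite invol_ge.
  by rewrite /m mulrA addrA; apply: in_gtMl.
have [u1 u1E] := trace_one; have [u [uE u0]] := trace_strict u1.
rewrite u1E in uE u0; have {}u0 : in_ge g 0 u by rewrite sm_1 in u0.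
have su : s u = 1 - u by rewrite -uE addrC addKr.
pose t := s e * e.
have [r rE] : exists r, r + s r = t.
  exists (s e * u * e); rewrite (involM _ e) (involM (s e) u) involK su [X in _ + X]mulrA -mulrDl -mulrDr.
  by rewrite [u + _]addrC subrK mulr1.
have [z0 [z0E tz0]] := trace_strict r; rewrite rE in z0E tz0.
have z0_small : in_gt g 0 z0 by apply: elt_le_trans tz0; exact: see.
(* The first two terms add up to 1 + s(e)e with their image, and z0 removes
   s(e)e. Each term is small on m: e fixes m up to a small term, and s(e)m
   and z0 are small. *)
pose y0 := (1 - s e) * u * (1 - e) + s e - z0.
apply: (@isotropic_of_nonunit y0 m (c + d)) => //.
- apply: in_geB; last exact: in_gtW.
  apply: in_geD => //; rewrite -[0]addr0; apply: in_geM; last by apply: in_geB; rewrite ?in_ge_1.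
  by rewrite -[0]addr0; apply: in_geM => //; apply: in_geB; rewrite ?in_ge_1.
- have -> : s y0 = (1 - s e) * (1 - u) * (1 - e) + e - s z0.
    by rewrite /y0 linearB linearD /= (involM _ (1 - e)) (involM (1 - s e)) !linearB /= invol1 involK su mulrA.
  rewrite /y0 addrACA -opprD z0E addrACA -mulrDl -mulrDr [u + _]addrC subrK mulr1.
  rewrite mulrBl !mulrBr !mul1r !mulr1 /t.
  by rewrite opprB -[1 - e + _ + _]addrA [_ - s e + _]addrA subrK [_ + e]addrC addrA subrK addrK.
- rewrite /y0 mulrBl mulrDl; apply: in_gtB; last by rewrite -[c + d]add0r; apply: in_gtMl.
  apply: in_gtD => //; rewrite -[_ * m]mulrA -[c + d]add0r; apply: in_gtMr.
    by rewrite -[0]addr0; apply: in_geM => //; apply: in_geB; rewrite ?in_ge_1.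
  by rewrite mulrBl mul1r -in_gtN opprB.
Qed.

End Henselian.
End Involution.

(** * Nil ideals under extension of scalars *)
Section NilIdeals.
Variables (G : divOrderedGroupType) (R : nzRingType) (f : ring_value G R).

(** The component of degree c of a homogeneous ideal of the graded ring, all of
    whose homogeneous elements are nilpotent, is represented by its preimage
    in R, which contains the small elements. *)
Record nil_ideal (I : G -> R -> Prop) : Prop := NilIdeal {
  nil_ge : forall c x, I c x -> in_ge f c x;
  nil_gt : forall c x, in_gt f c x -> I c x;
  nil_B : forall c x y, I c x -> I c y -> I c (x - y);
  nil_Ml : forall c d x y, in_ge f c x -> I d y -> I (c + d) (x * y);
  nil_Mr : forall c d x y, I c x -> in_ge f d y -> I (c + d) (x * y);
  nil_X : forall c x, I c x -> exists n, in_gt f (c *+ n) (x ^+ n)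
}.

Lemma nil_D I c x y : nil_ideal I -> I c x -> I c y -> I c (x + y).
Proof.
move=> nI Ix Iy; rewrite -[y]opprK -[- y]sub0r; apply: nil_B => //.
by apply: nil_B => //; apply: nil_gt => //; apply: in_gt0.
Qed.

Definition sum_ideal (I J : G -> R -> Prop) c x :=
  exists y z, [/\ I c y, J c z & x = y + z].

Lemma nil_ideal_sum I J : nil_ideal I -> nil_ideal J -> nil_ideal (sum_ideal I J).
Proof.
move=> nI nJ; split.
- by move=> c _ [y [z [Iy Jz ->]]]; apply: in_geD; [apply: nil_ge nI _ _ _ | apply: nil_ge nJ _ _ _].
- move=> c x xc; exists x, 0; rewrite addr0; split=> //; first exact: nil_gt.
  by apply: nil_gt => //; apply: in_gt0.
- move=> c _ _ [y [z [Iy Jz ->]]] [y' [z' [Iy' Jz' ->]]].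
  by exists (y - y'), (z - z'); rewrite opprD addrACA; split=> //; apply: nil_B.
- move=> c d x _ xc [y [z [Iy Jz ->]]].
  by exists (x * y), (x * z); rewrite mulrDr; split=> //; apply: nil_Ml.
- move=> c d _ x [y [z [Iy Jz ->]]] xd.
  by exists (y * x), (z * x); rewrite mulrDl; split=> //; apply: nil_Mr.
- move=> c _ [y [z [Iy Jz ->]]].
  (* modulo J the powers of y + z are those of y *)
  have hJ n : J (c *+ n) ((y + z) ^+ n - y ^+ n).
    elim: n => [|n IH]; first by rewrite !expr0 subrr; apply: nil_gt => //; apply: in_gt0.
    have -> : (y + z) ^+ n.+1 - y ^+ n.+1 = (y + z) * ((y + z) ^+ n - y ^+ n) + z * y ^+ n.
      by rewrite mulrBr -!exprS [X in _ - X + _]mulrDl -exprS opprD addrA subrK.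
    rewrite mulrS; apply: nil_D => //.
      apply: nil_Ml => //; apply: in_geD; [exact: nil_ge nI _ _ _ | exact: nil_ge nJ _ _ _].
    by apply: nil_Mr => //; apply: in_geX; apply: nil_ge nI _ _ _.
  have [n yn] := nil_X nI Iy.
  have [k zk] : exists k, in_gt f (c *+ n *+ k) ((y + z) ^+ n ^+ k).
    apply: (nil_X nJ); rewrite -[(y + z) ^+ n](subrK (y ^+ n)).
    by apply: (nil_D nJ); [apply: hJ | apply: (nil_gt nJ)].
  by exists (n * k)%N; rewrite exprM mulrnA.
Qed.

End NilIdeals.

(** By [right_ideal_fixes] the leading term of some a y of degree 0 fixes a
    nonzero leading term, and then so do all its powers. *)
Lemma nil_element_small (G : divOrderedGroupType) (F : fieldType) (v : valuation G F)
    (A : falgType F) (g : surmultiplicative v A) c a : gr_semiprime g -> in_ge g c a ->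
  (forall y, in_ge g (- c) y -> exists n, in_gt g 0 ((a * y) ^+ n)) -> in_gt g c a.
Proof.
move=> sp ac anil; apply: wlog_neg => anc.
have [y [z [d [yc zd nz fz]]]] := right_ideal_fixes sp ac anc.
have [n cn] := anil y yc; set b := a * y in fz cn; set m := a * z in nz fz.
have b0 : in_ge g 0 b by rewrite -(subrr c); apply: in_geM.
have mc : in_ge g (c + d) m by apply: in_geM.
have fix_n k : in_gt g (c + d) (b ^+ k * m - m).
  elim: k => [|k IH]; first by rewrite expr0 mul1r subrr in_gt0.
  have -> : b ^+ k.+1 * m - m = b * (b ^+ k * m - m) + (b * m - m).
    by rewrite exprS -[b * _ * m]mulrA mulrBr addrA subrK.
  by apply: in_gtD => //; rewrite -[c + d]add0r; apply: in_gtMr.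
case/negP: nz; rewrite -in_gtN -[- m](addKr (b ^+ n * m)) in_gtD ?fix_n //.
by rewrite in_gtN -[c + d]add0r; apply: in_gtMl.
Qed.

Section BaseChange.
Variables (G : divOrderedGroupType) (F : fieldType) (v : valuation G F).
Variables (A : falgType F) (g : surmultiplicative v A).
Variables (L : fieldType) (i : {rmorphism F -> L}) (w : valuation G L).
Hypothesis iw : extends i v w.
Variables (n : nat) (phi : {rmorphism A -> 'M[L]_n.+1}).
Hypothesis phiZ : forall a x, phi (a *: x) = i a *: phi x.
Variables (d : nat) (e : 'I_d -> A).
Hypothesis e_splits : splits g e.
Hypothesis e_spans : spans e.
Hypothesis e_neq0 : forall k, e k != 0.
Let b := [tuple phi (e k) | k < d].
Hypothesis b_basis : basis_of fullv b.

Lemma nth_b (k : 'I_d) : b`_k = phi (e k).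
Proof. by rewrite -tnth_nth tnth_mktuple. Qed.

Definition co (k : 'I_d) : 'M[L]_n.+1 -> L := coord b k.

Lemma coE M : M = \sum_k co k M *: phi (e k).
Proof.
by rewrite {1}(coord_basis b_basis (memvf M)); apply: eq_bigr => k _; rewrite nth_b.
Qed.

Lemma co_sum (c : 'I_d -> L) k : co k (\sum_l c l *: phi (e l)) = c k.
Proof.
rewrite (eq_bigr (fun l => c l *: b`_l)) => [|l _]; last by rewrite nth_b.
by rewrite /co coord_sum_free // (basis_free b_basis).
Qed.

(** The extension of g to the matrix algebra, seen as the scalar extension of A
    to L: the base phi (e k) splits it, with the values of the e k. *)
Definition base_value M : option G := \big[@emin G/None]_k eadd (g (e k)) (w (co k M)).

Lemma ele_big a m (h : 'I_m -> option G) :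
  ele a (\big[@emin G/None]_k h k) <-> forall k, ele a (h k).
Proof.
elim: m h => [|m IH] h; first by rewrite big_ord0; split=> [_ []|_] //; case: a.
rewrite big_ord_recl ele_emin; split=> [/andP[h0 /IH hl] k|hk].
  by case: (unliftP ord0 k) => [l ->|-> //].
by rewrite hk; apply/IH.
Qed.

Lemma ele_anti (a a' : option G) : ele a a' -> ele a' a -> a = a'.
Proof. by case: a a' => [x|] [y|] //= xy yx; congr Some; apply/eqP; rewrite eq_le xy. Qed.

Lemma base_value_le M k : ele (base_value M) (eadd (g (e k)) (w (co k M))).
Proof. by move: k; apply/ele_big; apply: ele_refl. Qed.

Lemma emin_le (a a' : option G) : ele (emin a a') a /\ ele (emin a a') a'.
Proof. by have := ele_refl (emin a a'); rewrite ele_emin => /andP. Qed.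

Lemma base_valueD M N : ele (emin (base_value M) (base_value N)) (base_value (M + N)).
Proof.
apply/ele_big => k; rewrite /co linearD /=.
have [mM mN] := emin_le (base_value M) (base_value N).
apply: (ele_trans (b := eadd (g (e k)) (emin (w (co k M)) (w (co k N))))).
  rewrite {2}/emin; case: ifP => _.
    exact: ele_trans mM (base_value_le M k).
  exact: ele_trans mN (base_value_le N k).
by apply: ele_add; rewrite ?ele_refl ?val_D.
Qed.

Lemma base_valueZ c M : base_value (c *: M) = eadd (base_value M) (w c).
Proof.
have eaddA x y z : eadd (eadd x y) z = eadd x (eadd y z) :> option G.
  by case: x y z => [x|] [y|] [z|] //=; rewrite addrA.
have coZ k : eadd (g (e k)) (w (co k (c *: M))) = eadd (eadd (g (e k)) (w (co k M))) (w c).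
  by rewrite /co linearZ /= val_M [eadd (w c) _]eaddC eaddA.
apply: ele_anti; last first.
  by apply/ele_big => k; rewrite coZ; apply: ele_add; rewrite ?ele_refl ?base_value_le.
have [c0|c0] := eqVneq c 0.
  by rewrite c0 (val_oo w 0).2 //; case: (base_value M) => [?|]; case: (base_value _).
have [dc wc] := rv_exists w c0; rewrite /= in wc.
have le k : ele (base_value (c *: M)) (eadd (eadd (g (e k)) (w (co k M))) (w c)).
  by rewrite -coZ; apply: base_value_le.
have h : ele (eadd (base_value (c *: M)) (Some (- dc))) (base_value M).
  apply/ele_big => k.
  have := ele_add (le k) (ele_refl (Some (- dc))).
  by rewrite wc !eaddA /= subrr eadd0.
have := ele_add h (ele_refl (Some dc)); rewrite wc eaddA /= addNr eadd0.
by [].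
Qed.

Lemma base_value_phi a : base_value (phi a) = g a.
Proof.
have [c aE] := e_spans a.
have coa k : eadd (g (e k)) (w (co k (phi a))) = g (c k *: e k).
  rewrite aE rmorph_sum (eq_bigr (fun k => i (c k) *: phi (e k))) => [|l _]; last exact: phiZ.
  by rewrite co_sum iw smZ.
apply: ele_anti.
  have h k : ele (base_value (phi a)) (g (c k *: e k)) by rewrite -coa; apply: base_value_le.
  rewrite [X in ele _ (g X)]aE; elim/big_ind: _ => [|x y hx hy|k _] //.
    by rewrite (sm_oo g 0).2 //; case: (base_value _).
  by apply: ele_trans (sm_D g x y); rewrite ele_emin hx.
apply/ele_big => k; rewrite coa; case E: (g a) => [x|]; last first.
  move/(sm_oo g): E => a0; have := splits_eq0 e_splits e_neq0 (c := c).
  by rewrite -aE => /(_ a0 k) ->; rewrite scale0r (sm_oo g 0).2.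
by apply: (splits_ge e_splits); rewrite -aE /in_ge /= E /= lexx.
Qed.

Lemma base_value_oo M : base_value M = None <-> M = 0.
Proof.
split=> [M0|->]; last first.
  by rewrite -(rmorph0 phi) base_value_phi (sm_oo g 0).2.
rewrite (coE M) big1 // => k _; have := base_value_le M k; rewrite M0.
have [c ge] := rv_exists g (e_neq0 k); rewrite /= in ge; rewrite ge.
by case E: (w _) => // _; rewrite ((val_oo w _).1 E) scale0r.
Qed.

Lemma base_value_sum a (I : Type) (r : seq I) (P : pred I) (h : I -> 'M[L]_n.+1) :
  (forall k, P k -> ele a (base_value (h k))) -> ele a (base_value (\sum_(k <- r | P k) h k)).
Proof.
move=> H; elim/big_ind: _ => [|x y hx hy|k] //; last exact: H.
  by rewrite (base_value_oo 0).2 //; case: a {H}.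
by apply: ele_trans (base_valueD x y); rewrite ele_emin hx.
Qed.

Lemma base_valueM M N : ele (eadd (base_value M) (base_value N)) (base_value (M * N)).
Proof.
rewrite (coE (M * N)) -coE {2}(coE M) {2}(coE N) mulr_suml.
apply: base_value_sum => k _; rewrite mulr_sumr; apply: base_value_sum => l _.
rewrite -scalerAl -scalerAr scalerA -rmorphM base_valueZ base_value_phi val_M.
apply: (ele_trans (b := eadd (eadd (g (e k)) (w (co k M))) (eadd (g (e l)) (w (co l N))))).
  by apply: ele_add; apply: base_value_le.
apply: (ele_trans (b := eadd (eadd (g (e k)) (g (e l))) (eadd (w (co k M)) (w (co l N))))).
  case: (g (e k)) (g (e l)) (w (co k M)) (w (co l N)) => [x|] [y|] [z|] [t|] //=.
  by rewrite addrACA.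
by apply: ele_add; rewrite ?ele_refl ?sm_M.
Qed.

Lemma base_valueN M : base_value (- M) = base_value M.
Proof. by rewrite -scaleN1r base_valueZ val_N1 eadd0. Qed.

Lemma base_value1 : base_value 1 = Some 0.
Proof. by rewrite -(rmorph1 phi) base_value_phi sm_1. Qed.

Definition base_rv : ring_value G 'M[L]_n.+1 :=
  RingValue base_value_oo base_valueD base_valueN base_value1 base_valueM.

Lemma base_rvZ (c : L) (M : 'M[L]_n.+1) : base_rv (c *: M) = eadd (base_rv M) (w c).
Proof. exact: base_valueZ. Qed.

Lemma phi_ge c a : in_ge base_rv c (phi a) = in_ge g c a.
Proof. by rewrite /in_ge /= base_value_phi. Qed.

Lemma phi_gt c a : in_gt base_rv c (phi a) = in_gt g c a.
Proof. by rewrite /in_gt /= base_value_phi. Qed.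

Lemma phi_e_neq0 k : phi (e k) != 0.
Proof.
by apply/eqP => /(base_value_oo _).2; rewrite base_value_phi => /(sm_oo g); apply/eqP.
Qed.

Lemma base_splits : splits base_rv (fun k => phi (e k)).
Proof.
move=> c x xc k; have := base_value_le (\sum_l c l *: phi (e l)) k.
rewrite co_sum -base_value_phi -base_valueZ; apply: elt_le_trans; exact: xc.
Qed.

Section Semilinear.
Variables (t : {rmorphism L -> L}) (s : 'End(A)).
Hypothesis ti : forall a, t (i a) = i a.
Hypothesis tw : forall x, w (t x) = w x.

(** The t-semilinear extension of s to the matrix algebra. With s the identity
    it is the action of the automorphism t; with t the identity it is the scalar
    extension of the involution s. *)
Definition semi_ext M := \sum_k t (co k M) *: phi (s (e k)).

Lemma semi_extD M N : semi_ext (M + N) = semi_ext M + semi_ext N.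
Proof.
rewrite -big_split; apply: eq_bigr => k _.
by rewrite /co linearD rmorphD scalerDl.
Qed.

Lemma semi_extZ c M : semi_ext (c *: M) = t c *: semi_ext M.
Proof.
rewrite scaler_sumr; apply: eq_bigr => k _.
by rewrite /co linearZ /= rmorphM scalerA.
Qed.

Lemma semi_extB M N : semi_ext (M - N) = semi_ext M - semi_ext N.
Proof. by rewrite -[- N]scaleN1r semi_extD semi_extZ rmorphN1 scaleN1r. Qed.

Lemma semi_ext0 : semi_ext 0 = 0.
Proof. by rewrite -[X in semi_ext X](subrr (0 : 'M[L]_n.+1)) semi_extB subrr. Qed.

Lemma semi_ext_sum (I : Type) (r : seq I) (P : pred I) (h : I -> 'M[L]_n.+1) :
  semi_ext (\sum_(k <- r | P k) h k) = \sum_(k <- r | P k) semi_ext (h k).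
Proof. by elim/big_rec2: _ => [|k x y _ <-]; rewrite ?semi_ext0 ?semi_extD. Qed.

Lemma semi_ext_phi a : semi_ext (phi a) = phi (s a).
Proof.
have [c ->] := e_spans a; rewrite rmorph_sum semi_ext_sum linear_sum rmorph_sum.
apply: eq_bigr => k _; rewrite linearZ /= !phiZ semi_extZ ti; congr (_ *: _).
rewrite /semi_ext (bigD1 k) //= big1 => [|l lk].
  rewrite addr0 /co -nth_b coord_free ?(basis_free b_basis) // eqxx rmorph1 scale1r //.
by rewrite /co -nth_b coord_free ?(basis_free b_basis) // eq_sym (negPf lk) rmorph0 scale0r.
Qed.

Lemma semi_ext_value M : (forall x, ele (g x) (g (s x))) ->
  ele (base_value M) (base_value (semi_ext M)).
Proof.
move=> sg; apply: base_value_sum => k _; rewrite base_valueZ base_value_phi tw.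
apply: ele_trans (base_value_le M k) _; apply: ele_add; rewrite ?ele_refl //.
Qed.

Lemma semi_extM M N : (forall x y, s (x * y) = s x * s y) ->
  semi_ext (M * N) = semi_ext M * semi_ext N.
Proof.
move=> sM; rewrite {1}(coE M) {1}(coE N) mulr_suml semi_ext_sum [in RHS]/semi_ext [in RHS]mulr_suml.
apply: eq_bigr => k _; rewrite !mulr_sumr semi_ext_sum; apply: eq_bigr => l _.
by rewrite -!scalerAl -!scalerAr !scalerA -[in LHS](rmorphM phi) semi_extZ semi_ext_phi sM !rmorphM.
Qed.

Lemma semi_extMr M N : (forall x y, s (x * y) = s y * s x) ->
  semi_ext (M * N) = semi_ext N * semi_ext M.
Proof.
move=> sM; rewrite {1}(coE M) {1}(coE N) mulr_suml semi_ext_sum [in RHS]/semi_ext [in RHS]mulr_sumr.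
apply: eq_bigr => k _; rewrite !mulr_sumr semi_ext_sum mulr_suml; apply: eq_bigr => l _.
by rewrite -!scalerAl -!scalerAr !scalerA -[in LHS](rmorphM phi) semi_extZ semi_ext_phi sM !rmorphM mulrC.
Qed.

End Semilinear.

Lemma semi_ext_comp (t t' : {rmorphism L -> L}) (s s' : 'End(A)) M :
  (forall a, t' (i a) = i a) ->
  semi_ext t' s' (semi_ext t s M) = \sum_k t' (t (co k M)) *: phi (s' (s (e k))).
Proof.
move=> ti; rewrite semi_ext_sum; apply: eq_bigr => k _.
by rewrite semi_extZ semi_ext_phi.
Qed.

Section GaloisDescent.
Hypothesis sp : gr_semiprime g.
Variable Gal : {rmorphism L -> L} -> Prop.
Hypothesis Gal_fix : forall t, Gal t -> forall a, t (i a) = i a.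
Hypothesis Gal_val : forall t, Gal t -> forall x, w (t x) = w x.
Hypothesis Gal_inv : forall t, Gal t -> exists t' : {rmorphism L -> L}, Gal t' /\ cancel t t'.
(* leading terms fixed by Gal come from F, as they do in tame extensions *)
Hypothesis Gal_rigid : forall x c, w x = Some c ->
  (forall t, Gal t -> in_gt w c (t x - x)) -> exists a, in_gt w c (x - i a).

Local Notation twist t := (semi_ext t \1%VF).

Lemma twist_ge t c M : Gal t -> in_ge base_rv c M -> in_ge base_rv c (twist t M).
Proof.
move=> tG Mc; apply: (ele_trans Mc); apply: semi_ext_value => [|x]; first exact: Gal_val.
by rewrite id_lfunE ele_refl.
Qed.

Lemma twist_gt t c M : Gal t -> in_gt base_rv c M -> in_gt base_rv c (twist t M).
Proof.
move=> tG Mc; apply: (elt_le_trans Mc); apply: semi_ext_value => [|x]; first exact: Gal_val.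
by rewrite id_lfunE ele_refl.
Qed.

Lemma twistM t M N : Gal t -> twist t (M * N) = twist t M * twist t N.
Proof. by move=> tG; apply: (semi_extM (Gal_fix tG)) => x y; rewrite !id_lfunE. Qed.

Lemma twist1 t : Gal t -> twist t 1 = 1.
Proof. by move=> tG; rewrite -(rmorph1 phi) (semi_ext_phi _ (Gal_fix tG)) id_lfunE. Qed.

Lemma twistX t M k : Gal t -> twist t (M ^+ k) = twist t M ^+ k.
Proof. by move=> tG; elim: k => [|k IH]; rewrite ?twist1 // !exprS twistM // IH. Qed.

Lemma nil_ideal_twist t I : Gal t -> nil_ideal base_rv I ->
  nil_ideal base_rv (fun c M => in_ge base_rv c M /\ I c (twist t M)).
Proof.
move=> tG nI; split.
- by move=> c M [].
- move=> c M Mc; split; first exact: in_gtW.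
  by apply: (nil_gt nI); apply: twist_gt.
- move=> c M N [Mc IM] [Nc IN]; split; first exact: in_geB.
  by rewrite semi_extB; apply: (nil_B nI).
- move=> c c' M N Mc [Nc IN]; split; first exact: in_geM.
  by rewrite twistM //; apply: (nil_Ml nI) => //; apply: twist_ge.
- move=> c c' M N [Mc IM] Nc; split; first exact: in_geM.
  by rewrite twistM //; apply: (nil_Mr nI) => //; apply: twist_ge.
- move=> c M [Mc /(nil_X nI)[k Mk]]; exists k.
  have [t' [tG' tK]] := Gal_inv tG.
  have := twist_gt tG' Mk; rewrite twistX // (semi_ext_comp _ _ _ _ (Gal_fix tG')).
  rewrite (_ : \sum_k _ = M) // [RHS]coE; apply: eq_bigr => l _.
  by rewrite !id_lfunE tK.
Qed.

Definition supp c M := [set k | ~~ in_gt base_rv c (co k M *: phi (e k))].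

Lemma small_supp c M : supp c M = set0 -> in_gt base_rv c M.
Proof.
move=> s0; rewrite (coE M); apply: in_gt_sum => k _.
by have := in_set0 k; rewrite -s0 inE => /negbFE.
Qed.

(** The proof is by induction on the number of coordinates of M that are not
    small, one of which may be normalised to 1. For t in Gal, the difference
    between M and its image under t lies in the sum of I and its image, which is
    again a nil ideal, and has fewer such coordinates; so it is small. Hence
    all the coordinates of M are rigid, and M is phi x0 up to a small term. The
    leading term of x0 generates a nil ideal, so it vanishes. *)
Theorem nil_ideal_small I c M : nil_ideal base_rv I -> I c M -> in_gt base_rv c M.
Proof.
move=> nI IM; have [m] := ubnP #|supp c M|.
elim: m I nI c M IM => // m IH I nI c M IM szM.
have [s0|[k0 k0s]] := set_0Vmem (supp c M); first exact: small_supp.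
have Mc := nil_ge nI IM.
have c0 : co k0 M != 0.
  by apply: contraTneq k0s => k00; rewrite inE k00 scale0r in_gt0.
have [x wx] := rv_exists w c0; have [y gy] := rv_exists base_rv (phi_e_neq0 k0).
have cE : c = x + y.
  have h1 : in_ge base_rv c (co k0 M *: phi (e k0)).
    by apply: (splits_ge base_splits (c := fun k => co k M)); rewrite -coE.
  have : base_rv (co k0 M *: phi (e k0)) = Some c.
    by apply/(rv_eqP base_rv); rewrite h1; move: k0s; rewrite inE.
  have gy' : base_value (phi (e k0)) = Some y by [].
  have wx' : w (co k0 M) = Some x by [].
  by rewrite /= base_valueZ gy' wx' /= addrC => -[].
have wxV : w (co k0 M)^-1 = Some (- x) by apply: val_inv.
pose M1 := (co k0 M)^-1 *: M.
have scal : in_ge base_rv (- x) ((co k0 M)^-1)%:M.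
  by rewrite -scalemx1 -[- x]addr0 (in_geZE base_rvZ _ _ wxV) in_ge_1.
have IM1 : I y M1.
  rewrite /M1 -mul_scalar_mx (_ : y = - x + c); last by rewrite cE addKr.
  exact: (nil_Ml nI).
have M1y : in_ge base_rv y M1 by exact: (nil_ge nI IM1).
have coM1 k : co k M1 = (co k0 M)^-1 * co k M by rewrite /co linearZ.
have termE k : in_gt base_rv y (co k M1 *: phi (e k)) = in_gt base_rv c (co k M *: phi (e k)).
  rewrite coM1 -scalerA (_ : y = - x + c); last by rewrite cE addKr.
  exact: (in_gtZE base_rvZ).
(* induction applies: the coordinate k0 of the difference is zero *)
have rigid_term t : Gal t -> in_gt base_rv y (twist t M1 - M1).
  move=> tG; have [t' [tG' tK]] := Gal_inv tG.
  have coT k : co k (twist t M1 - M1) = t (co k M1) - co k M1.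
    rewrite /co linearB /=; congr (_ - _); rewrite -/(co k _) /semi_ext.
    by rewrite (eq_bigr (fun l => t (co l M1) *: phi (e l))) ?co_sum // => l _; rewrite id_lfunE.
  apply: (IH (sum_ideal (fun c M => in_ge base_rv c M /\ I c (twist t' M)) I)).
  - by apply: nil_ideal_sum => //; apply: nil_ideal_twist.
  - exists (twist t M1), (- M1); split=> //; last first.
      rewrite -[- M1]sub0r; apply: (nil_B nI) => //; apply: (nil_gt nI); exact: in_gt0.
    split; first exact: twist_ge.
    rewrite (semi_ext_comp _ _ _ _ (Gal_fix tG')) (_ : \sum_k _ = M1) // [RHS]coE.
    by apply: eq_bigr => l _; rewrite !id_lfunE tK.
  - move: szM; rewrite ltnS; apply: leq_trans; rewrite (cardsD1 k0 (supp c M)) k0s add1n ltnS.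
    apply: subset_leq_card; apply/subsetP => k; rewrite !inE coT => ks; apply/andP; split.
      by apply: contraNneq ks => ->; rewrite coM1 mulVf // rmorph1 subrr scale0r in_gt0.
    apply: contra ks; rewrite -termE => small; rewrite scalerBl; apply: in_gtB => //.
    by move: small; rewrite /in_gt /= !base_valueZ Gal_val.
have approx k : exists a, in_gt base_rv y ((co k M1 - i a) *: phi (e k)).
  have [small|big] := boolP (in_gt base_rv y (co k M1 *: phi (e k))).
    by exists 0; rewrite rmorph0 subr0.
  have M1ky : in_ge base_rv y (co k M1 *: phi (e k)).
    by apply: (splits_ge base_splits (c := fun k => co k M1)); rewrite -coE.
  have [z gz] := rv_exists base_rv (phi_e_neq0 k).
  have wk : w (co k M1) = Some (y - z).
    apply/(rv_eqP w); rewrite -(in_ge_scale base_rvZ _ _ gz).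
    by rewrite -(in_gt_scale base_rvZ _ _ gz) subrK M1ky.
  have [|a aE] := Gal_rigid wk.
    move=> t tG; rewrite -(in_gt_scale base_rvZ _ _ gz) subrK.
    have coT : co k (twist t M1 - M1) = t (co k M1) - co k M1.
      rewrite /co linearB /=; congr (_ - _); rewrite -/(co k _) /semi_ext.
      by rewrite (eq_bigr (fun l => t (co l M1) *: phi (e l))) ?co_sum // => l _; rewrite id_lfunE.
    by rewrite -coT; apply: (base_splits (c := fun k => co k (twist t M1 - M1))); rewrite -coE rigid_term.
  by exists a; rewrite -(subrK z y) (in_gt_scale base_rvZ _ _ gz).
have [a aE] := fin_all_exists approx.
pose x0 := \sum_k a k *: e k.
have M1x0 : in_gt base_rv y (M1 - phi x0).
  rewrite (coE M1) /x0 rmorph_sum -sumrB; apply: in_gt_sum => k _.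
  by rewrite phiZ -scalerBl.
have Ix0 : I y (phi x0).
  rewrite -(subKr M1 (phi x0)); apply: (nil_B nI) => //; exact: (nil_gt nI).
have small : in_gt base_rv y (phi x0).
  rewrite phi_gt; apply: (nil_element_small sp) => [|z zc].
    by rewrite -phi_ge; exact: (nil_ge nI Ix0).
  have := nil_Mr nI Ix0 (_ : in_ge base_rv (- y) (phi z)); rewrite phi_ge => /(_ zc).
  rewrite subrr => /(nil_X nI)[k]; rewrite mul0rn -rmorphM -rmorphXn phi_gt.
  by exists k.
rewrite -(in_gt_subE M1x0) /M1 (_ : y = - x + c) in small; last by rewrite cE addKr.
by rewrite (in_gtZE base_rvZ _ _ wxV) in small.
Qed.

(** What follows only depends on these properties of the extended value function
    and involution, not on their construction. *)
Theorem split_extension (s : 'End(A)) : is_involution s -> (forall x, g (s x) = g x) ->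
  exists (f : ring_value G 'M[L]_n.+1) (sB : 'M[L]_n.+1 -> 'M[L]_n.+1),
  [/\ [/\ forall (c : L) (M : 'M[L]_n.+1), f (c *: M) = eadd (f M) (w c), forall a, f (phi a) = g a,
         splits f (fun k => phi (e k)), spans (fun k => phi (e k)) & forall k, phi (e k) != 0],
     forall I c M, nil_ideal f I -> I c M -> in_gt f c M &
     [/\ forall M N, sB (M - N) = sB M - sB N, forall (c : L) M, sB (c *: M) = c *: sB M,
         forall M N, sB (M * N) = sB N * sB M, forall M, sB (sB M) = M &
         (forall M, f (sB M) = f M) /\ forall a, sB (phi a) = phi (s a)]].
Proof.
move=> [sM sK] sg; pose t : {rmorphism L -> L} := idfun.
have ti a : t (i a) = i a by [].
have tw x : w (t x) = w x by [].
have ssK M : semi_ext t s (semi_ext t s M) = M.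
  rewrite (semi_ext_comp _ _ _ _ ti) [RHS]coE; apply: eq_bigr => k _.
  by rewrite sK.
have le M : ele (base_value M) (base_value (semi_ext t s M)).
  by apply: semi_ext_value => // x; rewrite sg ele_refl.
exists base_rv, (semi_ext t s); split.
- split.
  + exact: base_rvZ.
  + exact: base_value_phi.
  + exact: base_splits.
  + by move=> M; exists (fun k => co k M); apply: coE.
  + exact: phi_e_neq0.
- exact: nil_ideal_small.
split.
- exact: semi_extB.
- by move=> c M; rewrite semi_extZ.
- by move=> M N; apply: (semi_extMr ti).
- exact: ssK.
- split=> [M|a]; last exact: semi_ext_phi.
  by apply: ele_anti; [rewrite -{2}(ssK M); apply: le | apply: le].
Qed.

End GaloisDescent.
End BaseChange.

(** * Involutions on split algebras *)
Section SplitAlgebra.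
Variables (G : divOrderedGroupType) (L : fieldType) (w : valuation G L).
Variables (n : nat).
Local Notation B := 'M[L]_n.+1.
Variable f : ring_value G B.
Hypothesis fZ : forall (c : L) (M : B), f (c *: M) = eadd (f M) (w c).
Variables (d : nat) (eB : 'I_d -> B).
Hypothesis eB_splits : splits f eB.
Hypothesis eB_spans : spans eB.
Hypothesis eB_neq0 : forall k, eB k != 0.
Hypothesis no_nil : forall I c M, nil_ideal f I -> I c M -> in_gt f c M.

Local Notation e11 := (delta_mx 0 0 : B).

(** The column space, on which the matrix algebra acts, is taken to be the left
    ideal generated by the matrix unit e11. *)
Definition first_column (X : B) := X * e11 = X.

Lemma delta_mul (i j k : 'I_n.+1) : (delta_mx i j : B) * delta_mx j k = delta_mx i k.
Proof. by rewrite -mulmxE mul_delta_mx. Qed.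

Lemma e11_idem : e11 * e11 = e11.
Proof. exact: delta_mul. Qed.

Lemma corner (N : B) : e11 * N * e11 = N 0 0 *: e11.
Proof.
apply/matrixP => k l; rewrite -!mulmxE !mxE (bigD1 0) //= big1 => [|j j0]; last first.
  by rewrite [X in _ * X]mxE (negPf j0) mulr0.
rewrite !mxE (bigD1 0) //= big1 => [|j j0]; last by rewrite mxE (negPf j0) andbF mul0r.
by rewrite !mxE !eqxx andbT addr0 addr0; case: (k == 0) => /=; rewrite ?mul1r ?mul0r ?mulr0 // mulrC.
Qed.

Lemma column_annihilator (M : B) : (forall X, first_column X -> M * X = 0) -> M = 0.
Proof.
move=> h; apply/matrixP => k l; rewrite mxE.
have /matrixP/(_ k 0) : M * delta_mx l 0 = 0.
  by apply: h; rewrite /first_column delta_mul.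
rewrite -mulmxE !mxE (bigD1 l) //= big1 => [|j jl].
  by rewrite !mxE !eqxx mulr1 addr0.
by rewrite mxE (negPf jl) mulr0.
Qed.

Lemma column_basis : exists k (h : 'I_k -> B),
  [/\ splits f h, forall j, h j != 0, forall j, first_column (h j) &
    forall X, first_column X -> exists c : 'I_k -> L, X = \sum_j c j *: h j].
Proof.
have [|a X UX||e' [D [se pe ne DU UD]]] := @adapted_basis _ _ _ _ f fZ _ eB first_column _ _ eB_splits eB_spans eB_neq0 _.
- by move=> X Y UX UY; rewrite /first_column mulrBl UX UY.
- by rewrite /first_column -scalerAl UX.
- exact: mul0r.
exists #|D|, (fun j => e' (enum_val j)); split=> // [c a small j|j|X UX].
- pose c' l := \sum_(j < #|D| | enum_val j == l) c j.
  have c'E j' : c' (enum_val j') = c j'.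
    by rewrite /c' (eq_bigl (pred1 j')) ?big_pred1_eq // => l; rewrite (inj_eq enum_val_inj).
  rewrite -c'E; apply: (se c'); rewrite (bigID (mem D)) /= [X in _ + X]big1 => [|l lD]; last first.
    by rewrite /c' big1 ?scale0r // => j' /eqP jl; move: lD; rewrite -jl enum_valP.
  rewrite addr0 big_enum_val (eq_bigr (fun j => c j *: e' (enum_val j))) // => j' _.
  by rewrite c'E.
- by apply: DU; apply: enum_valP.
- have [c ->] := UD X UX; exists (fun j => c (enum_val j)).
  by rewrite big_enum_val.
Qed.

Lemma in_gt_strict k (h : 'I_k.+1 -> option G) c : (forall j, elt (Some c) (h j)) ->
  (forall j, h j = None) \/ exists2 c', c < c' & forall j, ele (Some c') (h j).
Proof.
move=> hc; have [j0 jmin] := exists_emin h; case E: (h j0) => [c'|].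
  right; exists c' => [|j]; last by rewrite -E.
  by have := hc j0; rewrite E /elt /= -ltGNge.
by left=> j; have := jmin j; rewrite E; case: (h j).
Qed.

(** If M acts as zero on the graded column space, then it raises the values of
    a splitting base of columns by more than c. Its characteristic polynomial
    ([weighted_char_poly]) shows that the leading term of M is nilpotent, so the
    annihilator of the graded column space is a nil ideal. *)
Lemma graded_faithful c (M : B) :
  (forall a X, first_column X -> in_ge f a X -> in_gt f (c + a) (M * X)) -> in_gt f c M.
Proof.
pose I c M := in_ge f c M /\
  forall a X, first_column X -> in_ge f a X -> in_gt f (c + a) (M * X).
suff nI : nil_ideal f I.
  move=> small; have [Mc|nMc] := boolP (in_ge f c M); first exact: (no_nil nI).
  have M0 : M != 0 by apply: contraNneq nMc => ->; apply: in_ge0.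
  have [b Mb] := rv_exists f M0.
  have bc : b < c by rewrite ltGNge -(in_geE _ Mb).
  have : in_gt f b M.
    apply: (no_nil nI); split=> [|a X UX Xa]; first by rewrite (in_geE _ Mb) lexx.
    by apply: in_gt_le (small a X UX Xa); rewrite leGD2r ltW.
  by rewrite (in_gtE _ Mb) ltxx.
split.
- by move=> a N [].
- move=> a N Na; split; first exact: in_gtW.
  by move=> b X _ Xb; apply: in_gtMl.
- move=> a N N' [Na hN] [Na' hN']; split; first exact: in_geB.
  by move=> b X UX Xb; rewrite mulrBl; apply: in_gtB; [apply: hN | apply: hN'].
- move=> a b N N' Na [N'b hN']; split; first exact: in_geM.
  by move=> a' X UX Xa'; rewrite -mulrA -addrA; apply: in_gtMr => //; apply: hN'.
- move=> a b N N' [Na hN] N'b; split; first exact: in_geM.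
  move=> a' X UX Xa'; rewrite -mulrA -addrA; apply: hN; last exact: in_geM.
  by rewrite /first_column -mulrA UX.
move=> {}c {}M [Mc hM]; have [k [h [sh nh Uh gh]]] := column_basis.
case: k h sh nh Uh gh => [|k] h sh nh Uh gh.
  exists 1; rewrite (_ : M = 0) ?expr1 ?in_gt0 //; apply: column_annihilator => X UX.
  by have [a ->] := gh X UX; rewrite big_ord0 mulr0.
have [wt wtE] := fin_all_exists (fun j => rv_exists f (nh j)).
have [|all0|[c' cc' hc']] := @in_gt_strict k (fun j => eadd (f (M * h j)) (Some (- wt j))) c.
- move=> j; have := hM (wt j) (h j) (Uh j); rewrite (in_geE _ (wtE j)) lexx => /(_ isT).
  rewrite in_gtNge /elt; case: (f _) => //= b; apply: contra => le.
  by rewrite -(leGD2r (- wt j)) addrK.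
- exists 1; rewrite (_ : M = 0) ?expr1 ?in_gt0 //; apply: column_annihilator => X UX.
  have [a ->] := gh X UX; rewrite mulr_sumr big1 // => j _.
  by have := all0 j; case E: (f _) => // _; rewrite -scalerAr ((rv_oo f _).1 E) scaler0.
have [j|a j aj|p [pm szp p_ge p0]] := @weighted_char_poly _ _ _ _ f fZ k.+1 M h c' sh nh.
- by apply: gh; rewrite /first_column -mulrA Uh.
- have := hc' j; rewrite (in_geE _ (wtE j)) in aj; rewrite /in_ge.
  case: (f (M * h j)) => //= b le.
  rewrite -(leGD2r (- wt j)); apply: (@le_trans _ _ c') => //.
  by rewrite -[X in _ <= X]addr0 -addrA leGD2l -(subrr (wt j)) leGD2r.
have {}p0 : horner_alg M p = 0.
  apply: column_annihilator => X UX; have [a ->] := gh X UX.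
  by rewrite mulr_sumr big1 // => j _; rewrite -scalerAr p0 scaler0.
exists k.+1; have -> : M ^+ k.+1 = - \sum_(l < k.+1) p`_l *: M ^+ l.
  apply/eqP; rewrite -addr_eq0 addrC; move: p0; rewrite horner_algE szp big_ord_recr /=.
  by have /monicP := pm; rewrite lead_coefE szp /= => ->; rewrite scale1r => ->.
rewrite in_gtN; apply: in_gt_sum => l _.
have pl := p_ge l; have Ml := in_geX l Mc.
have := in_geZ fZ pl Ml; apply: in_ge_lt.
rewrite -[X in c *+ X](subnK (ltnW (ltn_ord l))) -[X in c' *+ X - _](subnK (ltnW (ltn_ord l))) !mulrnDr addrK ltGD2r.
by rewrite ltG_pMn // subn_gt0.
Qed.

Section ColumnSums.
Variables (k : nat) (h : 'I_k -> B).
Hypothesis h_splits : splits f h.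
Hypothesis h_col : forall j, first_column (h j).

Definition first_row (N : B) := e11 * N = N.

Lemma row_column N X : first_row N -> first_column X -> N * X = (N * X) 0 0 *: e11.
Proof. by move=> rN cX; rewrite -corner -mulrA -[N * X * e11]mulrA cX mulrA rN. Qed.

(** A first row N times a first column X is a scalar multiple of e11. Thus
    multiplication by X turns the sum into a combination of the h j, which
    split, and [graded_faithful] says that enough columns X are available to
    detect the leading terms. *)
Lemma column_sum_splits c (N : 'I_k -> B) : (forall j, first_row (N j)) ->
  in_gt f c (\sum_j h j * N j) -> forall j, in_gt f c (h j * N j).
Proof.
move=> rN small j; have [->|N0] := eqVneq (N j) 0; first by rewrite mulr0 in_gt0.
have e11_neq0 : e11 != 0.
  by apply/eqP => /matrixP/(_ 0 0)/eqP; rewrite !mxE oner_eq0.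
have [eta etaE] := rv_exists f e11_neq0; have [b Nb] := rv_exists f N0.
have Nge : in_ge f b (N j) by rewrite (in_geE _ Nb) lexx.
have [a [X [cX Xa nNX]]] : exists a X, [/\ first_column X, in_ge f a X & ~~ in_gt f (b + a) (N j * X)].
  apply: NNPP => no; have : in_gt f b (N j).
    apply: graded_faithful => a X cX Xa; apply: wlog_neg => nNX.
    by case: no; exists a, X.
  by rewrite (in_gtE _ Nb) ltxx.
have hNX l Y : first_column Y -> h l * N l * Y = (N l * Y) 0 0 *: h l.
  by move=> cY; rewrite -mulrA [X in h l * X](row_column (rN l) cY) -scalerAr h_col.
have NXval : w ((N j * X) 0 0) = Some (b + a - eta).
  apply/(rv_eqP w); rewrite -(in_ge_scale fZ _ _ etaE) -(in_gt_scale fZ _ _ etaE) subrK.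
  rewrite -row_column // nNX andbT; apply: in_geM => //; exact: Nge.
have hj : in_gt f (c - b + eta) (h j).
  rewrite -(in_gtZE fZ _ _ NXval).
  have -> : b + a - eta + (c - b + eta) = c + a.
    by rewrite addrC -addrA [eta + _]addrC subrK addrA subrK.
  apply: (h_splits (c := fun l => (N l * X) 0 0)).
  have := in_gtMl small Xa; rewrite mulr_suml.
  by rewrite (eq_bigr _ (fun l _ => hNX l X cX)).
apply: graded_faithful => a' Y cY Ya'; rewrite hNX //.
have -> : c + a' = (b + a' - eta) + (c - b + eta).
  by rewrite [RHS]addrC -addrA [eta + _]addrC subrK addrA subrK.
apply: (in_gtZr fZ) => //; rewrite -(in_ge_scale fZ _ _ etaE) subrK -row_column //.
by apply: in_geM => //; exact: Nge.
Qed.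

End ColumnSums.

Section SplitInvolution.
Variable s : B -> B.
Hypothesis sB : forall M N, s (M - N) = s M - s N.
Hypothesis sZ : forall (c : L) M, s (c *: M) = c *: s M.
Hypothesis sM : forall M N, s (M * N) = s N * s M.
Hypothesis sK : forall M, s (s M) = M.
Hypothesis s_val : forall M, f (s M) = f M.

Lemma split_invol0 : s 0 = 0.
Proof. by rewrite -[X in s X](scale0r (0 : B)) sZ scale0r. Qed.

Lemma split_involD M N : s (M + N) = s M + s N.
Proof. by rewrite -{1}[N]opprK sB -[- N]sub0r sB split_invol0 sub0r opprK. Qed.

Lemma split_invol_sum (I : Type) (r : seq I) (P : pred I) (h : I -> B) :
  s (\sum_(k <- r | P k) h k) = \sum_(k <- r | P k) s (h k).
Proof. by elim/big_rec2: _ => [|k x y _ <-]; rewrite ?split_invol0 ?split_involD. Qed.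

(** The involution preserves the line of the matrices kap = e11 kap s(e11). Up to
    a scalar, kap is the first row of the Gram matrix of a bilinear form for
    which s is the adjunction. *)
Lemma polarization : exists (kap X0 : B) (eps : L),
  [/\ first_row kap, kap * s e11 = kap, kap * X0 = e11, first_column X0 & s kap = eps *: kap]
  /\ eps ^+ 2 = 1.
Proof.
pose q := s e11.
have q_idem : q * q = q by rewrite -sM e11_idem.
have [[i j] /= qij] : exists ij, q ij.1 ij.2 != 0.
  apply: NNPP => no; have : q = 0.
    by apply/matrixP => i j; rewrite mxE; apply/eqP; apply: wlog_neg => h; case: no; exists (i, j).
  move=> q0; have : e11 = 0 by rewrite -(sK e11) -/q q0 split_invol0.
  by move/matrixP/(_ 0 0)/eqP; rewrite !mxE oner_eq0.
pose kap : B := delta_mx 0 i * q.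
have rk : first_row kap by rewrite /first_row mulrA delta_mul.
have kq : kap * q = kap by rewrite /kap -mulrA q_idem.
have k0j : kap 0 j = q i j.
  rewrite /kap -mulmxE mxE (bigD1 i) //= big1 => [|l li]; last by rewrite mxE (negPf li) andbF mul0r.
  by rewrite mxE !eqxx mul1r addr0.
clearbody kap; pose X0 : B := (kap 0 j)^-1 *: delta_mx j 0.
have cX0 : first_column X0 by rewrite /first_column -scalerAl delta_mul.
have kX0 : kap * X0 = e11.
  rewrite row_column // /X0 -scalerAr -mulmxE !mxE (bigD1 j) //= big1 => [|l lj]; last first.
    by rewrite [X in _ * X]mxE (negPf lj) mulr0.
  by rewrite mxE !eqxx mulr1 addr0 mulVf ?k0j // scale1r.
have qXk : q * X0 * kap = q.
  have [c cE] : exists c, q * X0 * kap = c *: q.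
    exists ((s (X0 * kap)) 0 0); rewrite -[in LHS]kq mulrA -[q * X0 * kap]mulrA.
    by rewrite -[X in q * X * q]sK -!sM mulrA corner sZ.
  have : kap = c *: kap.
    by rewrite -{1}rk -kX0 -{1}kq -!mulrA [q * _]mulrA cE -scalerAr kq.
  move/matrixP/(_ 0 j); rewrite mxE k0j -{1}[q i j]mul1r => /(mulIf qij) c1.
  by rewrite cE -c1 scale1r.
have one_dim m : first_row m -> m * q = m -> exists c, m = c *: kap.
  move=> rm mq; exists ((m * X0) 0 0).
  by rewrite -[LHS]mq -{1}qXk !mulrA mq [X in X * kap](row_column rm cX0) -scalerAl rk.
have [eps epsE] : exists c, s kap = c *: kap.
  apply: one_dim; first by rewrite /first_row -[e11 in LHS]sK -sM -/q kq.
  by rewrite /q -sM rk.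
exists kap, X0, eps; split; first by split.
have := sK kap; rewrite epsE sZ epsE scalerA => /matrixP/(_ 0 j).
by rewrite mxE k0j -{2}[q i j]mul1r => /(mulIf qij); rewrite expr2.
Qed.

(** If h is a splitting base of columns, then psi i j = h i * (kap * s (h j)) is
    the product of a column and a row. By [column_sum_splits] these products
    split with respect to i; since the involution switches i and j, they split
    with respect to j as well. *)
Lemma switch_basis : exists k (psi : 'I_k -> 'I_k -> B) (eps : L),
  [/\ eps ^+ 2 = 1, forall i j, s (psi i j) = eps *: psi j i,
     forall i j, psi i j != 0,
     forall M, exists c : 'I_k -> 'I_k -> L, M = \sum_i \sum_j c i j *: psi i j &
     forall (c : 'I_k -> 'I_k -> L) a, in_gt f a (\sum_i \sum_j c i j *: psi i j) ->
       forall i j, in_gt f a (c i j *: psi i j)].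
Proof.
have [kap [X0 [eps [[rk kq kX0 cX0 sk] eps2]]]] := polarization.
have [k [h [sh nh Uh gh]]] := column_basis.
pose psi i j := h i * (kap * s (h j)).
have eps0 : eps != 0 by apply: contraTneq (oner_neq0 L) => e0; rewrite -eps2 e0 expr0n eqxx.
have s_psi i j : s (psi i j) = eps *: psi j i.
  by rewrite /psi !sM sK sk -mulrA -scalerAl -scalerAr.
have row_kap j : first_row (kap * s (h j)) by rewrite /first_row mulrA rk.
exists k, psi, eps; split=> //.
- move=> i j; apply/eqP => p0.
  have N0 : kap * s (h j) = 0.
    apply: column_annihilator => Y cY; rewrite row_column //.
    have : (kap * s (h j) * Y) 0 0 *: h i = 0.
      by rewrite -[h i in LHS]Uh scalerAr -row_column // mulrA -/(psi i j) p0 mul0r.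
    by move/eqP; rewrite scaler_eq0 (negPf (nh i)) orbF => /eqP ->; rewrite scale0r.
  have : h j * kap = 0.
    have := congr1 s N0; rewrite split_invol0 sM sK sk -scalerAr => /eqP.
    by rewrite scaler_eq0 (negPf eps0) => /eqP.
  move/(congr1 (fun M => M * X0)); rewrite -mulrA kX0 Uh mul0r => hj0.
  by move: (nh j); rewrite hj0 eqxx.
- move=> M.
  have rows N : first_row N -> exists c : 'I_k -> L, N = \sum_j c j *: (kap * s (h j)).
    move=> rN; have [|c cE] := gh (s (X0 * N) * e11); first by rewrite /first_column -mulrA e11_idem.
    exists c; rewrite -[LHS]rN -kX0 -mulrA -[kap in LHS]kq -mulrA.
    rewrite -[X0 * N]sK -sM cE split_invol_sum mulr_sumr; apply: eq_bigr => j _.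
    by rewrite sZ -scalerAr.
  have [c cE] : exists c : 'I_n.+1 -> 'I_k -> L, forall a, delta_mx 0 a * M = \sum_j c a j *: (kap * s (h j)).
    have H a : exists c : 'I_k -> L, delta_mx 0 a * M = \sum_j c j *: (kap * s (h j)).
      by apply: rows; rewrite /first_row mulrA delta_mul.
    by have [c cE] := fin_all_exists H; exists c.
  have [x xE] : exists x : 'I_n.+1 -> 'I_k -> L, forall a, delta_mx a 0 = \sum_j x a j *: h j.
    have H a : exists c : 'I_k -> L, delta_mx a 0 = \sum_j c j *: h j.
      by apply: gh; rewrite /first_column delta_mul.
    by have [x xE] := fin_all_exists H; exists x.
  exists (fun i j => \sum_a x a i * c a j).
  have -> : M = \sum_a delta_mx a 0 * (delta_mx 0 a * M).
    rewrite -[LHS]mul1r (_ : 1 = 1%:M :> B) // mx1_sum_delta mulr_suml.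
    by apply: eq_bigr => a _; rewrite mulrA delta_mul.
  under eq_bigr => a _ do rewrite xE cE mulr_suml.
  rewrite exchange_big /=; apply: eq_bigr => i _.
  under eq_bigr => a _ do rewrite mulr_sumr.
  rewrite exchange_big /=; apply: eq_bigr => j _.
  rewrite scaler_suml; apply: eq_bigr => a _.
  by rewrite -scalerAl -scalerAr scalerA.
- move=> c a small i j.
  have e1 : \sum_i \sum_j c i j *: psi i j = \sum_i h i * (\sum_j c i j *: (kap * s (h j))).
    by apply: eq_bigr => l _; rewrite mulr_sumr; apply: eq_bigr => l' _; rewrite -scalerAr.
  rewrite e1 in small; have r1 l : first_row (\sum_j c l j *: (kap * s (h j))).
    rewrite /first_row mulr_sumr; apply: eq_bigr => l' _.
    by rewrite -scalerAr row_kap.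
  have := column_sum_splits sh Uh r1 small i.
  have sgt M : in_gt f a (s M) = in_gt f a M by rewrite /in_gt s_val.
  rewrite -sgt mulr_sumr split_invol_sum.
  rewrite (eq_bigr (fun j => h j * ((eps * c i j) *: (kap * s (h i))))) => [|l _]; last first.
    by rewrite -scalerAr sZ s_psi -scalerAr scalerA mulrC.
  move=> /(column_sum_splits sh Uh)-/(_ _ j); rewrite -sgt => h1.
  rewrite -sgt sZ s_psi scalerA mulrC scalerAr -sgt; apply: h1 => l.
  by rewrite /first_row -scalerAr row_kap.
Qed.

End SplitInvolution.
End SplitAlgebra.

(** * The maximal tame extension *)
Section TameClosure.
Variables (G : divOrderedGroupType) (K : fieldType) (v : valuation G K).
Variables (T : fieldType) (j : {rmorphism K -> T}).
Variables (C : closedFieldType) (i : {rmorphism T -> C}).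
Hypothesis ialg : forall z, algebraicOver (i \o j) z.
Hypothesis T_tame : forall z : C, (exists t, i t = z) <->
  exists (L : fieldExtType K) (wL : valuation G L) (h : {rmorphism L -> C}),
    [/\ tame_extension v wL, forall c : K, h (c%:A) = i (j c) & exists l, h l = z].

(** If t lies in a tame extension L of K, then so does any conjugate z, under
    another embedding of the same L into C: the composition of the given one
    with an automorphism of a normal closure. *)
Lemma tame_conjugate t z : conjugate (i \o j) (i t) z -> exists t', i t' = z.
Proof.
have [L [wL [h [tL hi [l hl]]]]] := (T_tame (i t)).1 (ex_intro _ t erefl).
rewrite -hl => lz.
have [N [hN [hNi hNs]]] := normal_closure ialg (map h (vbasis {:L})).
have hL x : exists y, hN y = h x.
  have [y yE] : exists y : 'I_(\dim {:L}) -> N, forall k, hN (y k) = h (vbasis {:L})`_k.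
    have H (k : 'I_(\dim {:L})) : exists y, hN y = h (vbasis {:L})`_k.
      apply: hNs; apply: map_f; apply: mem_nth; rewrite size_tuple; exact: ltn_ord.
    by have [y yE] := fin_all_exists H; exists y.
  exists (\sum_k (coord (vbasis {:L}) k x)%:A * y k).
  rewrite {2}(coord_vbasis (memvf x)) !rmorph_sum; apply: eq_bigr => k _.
  by rewrite rmorphM hNi yE -[in RHS]mulr_algl rmorphM hi.
have [f fE] := factor_rmorphism (fmorph_inj hN) hL.
rewrite -fE in lz; have [_ [s [[sc _] <- <-]]] := conjugate_lift hNi lz.
apply/T_tame; exists L, wL, (hN \o (s \o f)); split=> //; last by exists l.
move=> c /=; rewrite (_ : f c%:A = c%:A) ?sc ?hNi //.
by apply: (fmorph_inj hN); rewrite fE hi hNi.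
Qed.

Lemma split_in_tame (s : seq T) : exists (p : {poly K}) (ts : seq T),
  [/\ p != 0, map_poly j p = \prod_(t <- ts) ('X - t%:P) & {subset s <= ts}].
Proof.
elim: s => [|t s [p [ts [p0 pE sts]]]].
  by exists 1, [::]; rewrite oner_eq0 rmorph1 big_nil; split.
have [q [qm qt qconj _]] := minimal_poly ialg (i t).
have [rs rsE] := closed_field_poly_normal (map_poly (i \o j) q).
rewrite lead_coef_map (monicP qm) rmorph1 scale1r in rsE.
have [rs' rs'E] : exists rs', rs = map i rs'.
  have : forall z, z \in rs -> exists t', i t' = z.
    move=> z zrs; apply: (@tame_conjugate t); apply: qconj.
    by rewrite rsE root_prod_XsubC.
  elim: rs {rsE} => [|z rs IH] h; first by exists [::].
  have [|rs' ->] := IH; first by move=> y yrs; apply: h; rewrite inE yrs orbT.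
  by have [t' <-] := h z (mem_head _ _); exists (t' :: rs').
have qE : map_poly j q = \prod_(t <- rs') ('X - t%:P).
  apply: (map_inj_poly (f := i)); [exact: fmorph_inj | exact: rmorph0 |].
  rewrite -map_poly_comp rsE rs'E big_map rmorph_prod.
  by apply: eq_bigr => y _ /=; rewrite map_polyXsubC.
exists (q * p), (rs' ++ ts); split.
- by rewrite mulf_neq0 // monic_neq0.
- by rewrite rmorphM big_cat /= qE pE.
- move=> y; rewrite inE mem_cat => /orP[/eqP->|/sts ->]; last by rewrite orbT.
  have : root (map_poly j q) t by rewrite -(fmorph_root i) -map_poly_comp.
  by rewrite qE root_prod_XsubC => ->.
Qed.

(** The extension N serves as a finite field of definition for a splitting of A
    over T. *)
Lemma tame_normal_closure (s : seq T) : exists (N : splittingFieldType K) (h : {rmorphism N -> T}),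
  (forall c : K, h c%:A = j c) /\ forall t, t \in s -> exists x, h x = t.
Proof.
have [p [ts [p0 pE sts]]] := split_in_tame s.
have [|N [h [rs [hi hrs]]]] := splitting_field_in (i := j) (rs := ts) p0.
  by rewrite pE eqpxx.
exists N, h; split=> // t /sts; rewrite -hrs => /mapP[x _ ->].
by exists x.
Qed.

End TameClosure.

(** * Traces of symplectic involutions *)
Lemma spans_free_basis (L : fieldType) (V : vectType L) d (h : 'I_d -> V) :
  (forall x, exists c : 'I_d -> L, x = \sum_k c k *: h k) ->
  (forall c : 'I_d -> L, \sum_k c k *: h k = 0 -> forall k, c k = 0) ->
  basis_of fullv [tuple h k | k < d].
Proof.
set X := [tuple _ | _ < _] => hs hf.
have XE (k : 'I_d) : X`_k = h k by rewrite -tnth_nth tnth_mktuple.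
apply/andP; split; last first.
  apply/freeP => c; rewrite (eq_bigr (fun k => c k *: h k)) => [|k _]; last by rewrite XE.
  exact: hf.
rewrite eqEsubv subvf; apply/subvP => x _; have [c ->] := hs x.
by apply: memv_suml => k _; rewrite memvZ // -XE memv_span // mem_nth ?size_tuple.
Qed.

Lemma spans_free_dim (L : fieldType) (V : vectType L) d (h : 'I_d -> V) :
  (forall x, exists c : 'I_d -> L, x = \sum_k c k *: h k) ->
  (forall c : 'I_d -> L, \sum_k c k *: h k = 0 -> forall k, c k = 0) -> d = \dim {:V}.
Proof. by move=> hs hf; rewrite -(size_basis (spans_free_basis hs hf)). Qed.

Section FreeBaseChange.
Variables (F L : fieldType) (i : {rmorphism F -> L}) (A : lmodType F) (B : lmodType L).
Variable phi : A -> B.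
Hypothesis phiD : forall x y, phi (x + y) = phi x + phi y.
Hypothesis phiZ : forall a x, phi (a *: x) = i a *: phi x.
Variables (m : nat) (e0 : 'I_m -> A).
Hypothesis e0_spans : forall x, exists c : 'I_m -> F, x = \sum_r c r *: e0 r.
Hypothesis e0_free : forall c : 'I_m -> L, \sum_r c r *: phi (e0 r) = 0 -> forall r, c r = 0.

Lemma base_change_sum (I : Type) (r : seq I) (P : pred I) (h : I -> A) :
  phi (\sum_(k <- r | P k) h k) = \sum_(k <- r | P k) phi (h k).
Proof.
have phi0 : phi 0 = 0 by rewrite -[X in phi X](scale0r (0 : A)) phiZ rmorph0 scale0r.
by elim/big_rec2: _ => [|k x y _ <-].
Qed.

(** The matrix of y with respect to e0 has entries in F, and its rank is the same
    over L. *)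
Lemma free_base_change k (y : 'I_k -> A) :
  (forall c : 'I_k -> F, \sum_l c l *: y l = 0 -> forall l, c l = 0) ->
  forall c : 'I_k -> L, \sum_l c l *: phi (y l) = 0 -> forall l, c l = 0.
Proof.
move=> y_free c c0; have [Y YE] := fin_all_exists (fun l => e0_spans (y l)).
pose M := \matrix_(l, r) Y l r.
have M_free : row_free M.
  apply: inj_row_free => u uM; apply/rowP => l; rewrite mxE.
  apply: (y_free (u 0)); under eq_bigr => l' _ do rewrite YE scaler_sumr.
  rewrite exchange_big big1 //= => r _.
  under eq_bigr => l' _ do rewrite scalerA.
  rewrite -scaler_suml; have <- : (u *m M) 0 r = \sum_l' u 0 l' * Y l' r.
    by rewrite mxE; apply: eq_bigr => l' _; rewrite mxE.
  by rewrite uM mxE scale0r.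
have cM : (\row_l c l) *m map_mx i M = 0.
  apply/rowP => r; rewrite [RHS]mxE.
  rewrite mxE (eq_bigr (fun l => c l * i (Y l r))) => [|l _]; last by rewrite !mxE.
  apply: (e0_free (c := fun r => \sum_l c l * i (Y l r))).
  rewrite -[RHS]c0.
  under eq_bigr => r' _ do rewrite scaler_suml.
  rewrite exchange_big; apply: eq_bigr => l _ /=.
  rewrite YE base_change_sum scaler_sumr; apply: eq_bigr => r' _.
  by rewrite phiZ scalerA.
have := mulmx_free_eq0 (\row_l c l) (_ : row_free (map_mx i M)); rewrite row_free_map => /(_ M_free).
by rewrite cM eqxx => /esym/eqP/rowP c00 l; have := c00 l; rewrite !mxE.
Qed.

Lemma free_base_change_cond k (P : pred 'I_k) (y : 'I_k -> A) :
  (forall c : 'I_k -> F, \sum_(l | P l) c l *: y l = 0 -> forall l, P l -> c l = 0) ->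
  forall c : 'I_k -> L, \sum_(l | P l) c l *: phi (y l) = 0 -> forall l, P l -> c l = 0.
Proof.
move=> y_free c c0 l Pl.
have lE := enum_rankK_in (Pl : l \in P) (Pl : l \in P).
rewrite -lE; move: (enum_rank_in _ l).
apply: (@free_base_change _ (fun r => y (enum_val r)) _ (fun r => c (enum_val r))).
  move=> a a0 r.
  pose a' l := \sum_(r < #|P| | enum_val r == l) a r.
  have a'E r' : a' (enum_val r') = a r'.
    by rewrite /a' (eq_bigl (pred1 r')) ?big_pred1_eq // => l'; rewrite (inj_eq enum_val_inj).
  rewrite -a'E; apply: (y_free a'); last exact: (enum_valP r).
  rewrite -[RHS]a0 (eq_bigl (fun l => l \in P)) // big_enum_val.
  by apply: eq_bigr => r' _; rewrite a'E.
by rewrite -[RHS]c0 [RHS](eq_bigl (fun l => l \in P)) // [RHS]big_enum_val.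
Qed.

End FreeBaseChange.

Lemma card_ordered_pairs k : (0 < k)%N ->
  (k * k < #|[set p : 'I_k * 'I_k | p.1 <= p.2]%N|.*2)%N.
Proof.
move=> k0; set P := [set p | _].
have := cardsC P; rewrite card_prod card_ord => <-.
rewrite -addnn ltn_add2l.
pose swap (p : 'I_k * 'I_k) := (p.2, p.1).
have swap_inj : injective swap by case=> a b [c d] [-> ->].
rewrite -(card_imset _ swap_inj); apply: proper_card; apply/properP; split.
  by apply/subsetP => q /imsetP[p]; rewrite !inE -ltnNge => lt ->; apply: ltnW.
exists (Ordinal k0, Ordinal k0); first by rewrite inE.
by apply/imsetP => -[[a b]]; rewrite !inE -ltnNge /= => lt [ea eb]; move: lt; rewrite -ea -eb ltnn.
Qed.

Section SplitTrace.
Variables (G : divOrderedGroupType) (F L : fieldType) (v : valuation G F) (w : valuation G L).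
Variables (i : {rmorphism F -> L}) (A : falgType F) (g : surmultiplicative v A).
Variables (s : 'End(A)) (n : nat).
Local Notation B := 'M[L]_n.+1.
Variable phi : {rmorphism A -> B}.
Hypothesis phiZ : forall a x, phi (a *: x) = i a *: phi x.
Variables (d : nat) (e : 'I_d -> A) (D : {set 'I_d}).
Hypothesis e_splits : splits g e.
Hypothesis e_spans : spans e.
Hypothesis e_neq0 : forall k, e k != 0.
(* D selects the part of the base that spans the kernel of the trace *)
Hypothesis e_skew : forall k, k \in D -> e k + s (e k) = 0.
Hypothesis skew_e : forall x, x + s x = 0 -> exists c : 'I_d -> F, x = \sum_(k in D) c k *: e k.
Variables (f : ring_value G B) (sB : B -> B).
Hypothesis fZ : forall (c : L) (M : B), f (c *: M) = eadd (f M) (w c).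
Hypothesis f_phi : forall a, f (phi a) = g a.
Hypothesis f_splits : splits f (fun k => phi (e k)).
Hypothesis f_spans : spans (fun k => phi (e k)).
Hypothesis f_neq0 : forall k, phi (e k) != 0.
Hypothesis no_nil : forall I c M, nil_ideal f I -> I c M -> in_gt f c M.
Hypothesis sB_sub : forall M N, sB (M - N) = sB M - sB N.
Hypothesis sB_scale : forall (c : L) M, sB (c *: M) = c *: sB M.
Hypothesis sB_mul : forall M N, sB (M * N) = sB N * sB M.
Hypothesis sBK : forall M, sB (sB M) = M.
Hypothesis sB_val : forall M, f (sB M) = f M.
Hypothesis sB_phi : forall a, sB (phi a) = phi (s a).
Hypothesis sI : is_involution s.
(* in characteristic other than 2, the type is read off the dimension of the
   space of symmetric elements *)
Hypothesis type_s : 2%N \in [pchar F] \/ (2%:R != 0 :> F /\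
  exists m : nat, (m ^ 2 = \dim {:A})%N /\ (\dim (fixedSpace s) = (m * m.-1)./2)%N).

Lemma phi_e_free (c : 'I_d -> L) : \sum_k c k *: phi (e k) = 0 -> forall k, c k = 0.
Proof. exact: (splits_eq0 f_splits f_neq0). Qed.

Lemma dim_split_algebra : \dim {:A} = (n.+1 * n.+1)%N.
Proof.
have <- : d = \dim {:A}.
  apply: (spans_free_dim (h := e)) => [x|c]; first exact: e_spans.
  exact: (splits_eq0 e_splits e_neq0).
rewrite (spans_free_dim (h := fun k => phi (e k))); [|exact: f_spans|exact: phi_e_free].
by rewrite dimvf.
Qed.

(** If the sign were 1, the elements psi i j + psi j i with i <= j would be
    linearly independent symmetric elements, k (k + 1) / 2 in number. But k is
    at least the degree m of the algebra, and the symmetric elements have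
    dimension m (m - 1) / 2. In characteristic 2 the two signs agree. *)
Lemma switch_sign k (psi : 'I_k -> 'I_k -> B) (eps : L) : eps ^+ 2 = 1 ->
  (forall i j, sB (psi i j) = eps *: psi j i) -> (forall i j, psi i j != 0) ->
  (forall M, exists c : 'I_k -> 'I_k -> L, M = \sum_i \sum_j c i j *: psi i j) ->
  (forall (c : 'I_k -> 'I_k -> L) a, in_gt f a (\sum_i \sum_j c i j *: psi i j) ->
       forall i j, in_gt f a (c i j *: psi i j)) -> eps = -1.
Proof.
move=> eps2 s_psi psi0 psi_spans psi_splits.
case: type_s => [ch2|[two0 [m [mdim mfix]]]].
  have ch2L : 2%N \in [pchar L] by rewrite (fmorph_pchar i).
  have : (eps - 1) ^+ 2 == 0.
    by rewrite sqrrB1 eps2 (mulrn_pchar ch2L) subr0 -mulr2n (mulrn_pchar ch2L).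
  by rewrite expf_eq0 subr_eq0 /= (oppr_pchar2 ch2L) => /eqP.
have : (eps - 1) * (eps + 1) == 0 by rewrite -subr_sqr eps2 expr1n subrr.
rewrite mulf_eq0 subr_eq0 addr_eq0 => /orP[/eqP eps1|/eqP //].
exfalso.
have twoL : 2%:R != 0 :> L by rewrite -(rmorph_nat i) fmorph_eq0.
have k0 : (0 < k)%N.
  case: k psi psi_spans {s_psi psi0 psi_splits} => // psi /(_ 1)[c].
  by rewrite big_ord0 => /eqP; rewrite oner_eq0.
pose P := [set p : 'I_k * 'I_k | p.1 <= p.2]%N.
pose S := <<map phi (vbasis (fixedSpace s))>>%VS.
have dimS : (\dim S <= (m * m.-1)./2)%N.
  by rewrite -mfix -(size_tuple (vbasis (fixedSpace s))) -(size_map phi) dim_span.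
have phiS y : s y = y -> phi y \in S.
  move/fixedSpaceP/coord_vbasis => ->; rewrite (base_change_sum (rmorphD phi) phiZ).
  apply: memv_suml => l _; rewrite phiZ memvZ // memv_span // map_f //.
  by rewrite mem_nth ?size_tuple.
(* 2 is invertible, so M is half the trace of itself *)
have symS M : sB M = M -> M \in S.
  move=> sM; have -> : M = 2%:R^-1 *: (M + sB M).
    by rewrite sM -mulr2n -scaler_nat scalerA mulVf // scale1r.
  rewrite memvZ //; have [c ->] := f_spans M.
  rewrite (split_invol_sum sB_sub sB_scale) -big_split memv_suml // => l _ /=.
  rewrite sB_scale sB_phi -scalerDr -rmorphD memvZ // phiS //.
  by rewrite linearD /= (involK sI) addrC.
have psi_free (c : 'I_k -> 'I_k -> L) : \sum_i \sum_j c i j *: psi i j = 0 -> forall i j, c i j = 0.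
  move=> c0 a b; have : c a b *: psi a b = 0.
    by apply: (@in_gt_eq0 _ _ f) => x; apply: psi_splits; rewrite c0 in_gt0.
  by move/eqP; rewrite scaler_eq0 (negPf (psi0 a b)) orbF => /eqP.
pose X := [seq psi p.1 p.2 + psi p.2 p.1 | p <- enum P].
have XS : (<<X>> <= S)%VS.
  apply/span_subvP => _ /mapP[p _ ->]; apply: symS.
  by rewrite (split_involD sB_sub sB_scale) !s_psi eps1 !scale1r addrC.
have Xfree : free X.
  pose Y := [tuple psi (enum_val l).1 (enum_val l).2 + psi (enum_val l).2 (enum_val l).1 | l < #|P|].
  have -> : X = Y.
    apply: (@eq_from_nth _ 0) => [|l]; rewrite size_map -?cardE ?size_tuple // => lP.
    rewrite (nth_map (enum_val (Ordinal lP))) -?cardE // -(tnth_nth 0 Y (Ordinal lP)) tnth_mktuple.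
    have -> // : nth (enum_val (Ordinal lP)) (enum P) l = enum_val (Ordinal lP).
    by rewrite [RHS](enum_val_nth (enum_val (Ordinal lP))).
  apply/freeP => c c0 l.
  (* the coefficients c, with pairs as indices *)
  pose c' (p : 'I_k * 'I_k) := \sum_(l < #|P| | enum_val l == p) c l.
  have c'E l' : c' (enum_val l') = c l'.
    by rewrite /c' (eq_bigl (pred1 l')) ?big_pred1_eq // => l1; rewrite (inj_eq enum_val_inj).
  pose a (x y : 'I_k) := (if (x <= y)%N then c' (x, y) else 0) + (if (y <= x)%N then c' (y, x) else 0).
  have a0 x y : a x y = 0.
    apply: psi_free; rewrite -[RHS]c0.
    rewrite [RHS](eq_bigr (fun l => c' (enum_val l) *: (psi (enum_val l).1 (enum_val l).2
        + psi (enum_val l).2 (enum_val l).1))) => [|l' _]; last first.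
      by rewrite c'E -tnth_nth tnth_mktuple.
    rewrite -(big_enum_val (fun p : 'I_k * 'I_k => c' p *: (psi p.1 p.2 + psi p.2 p.1))).
    have pairs (h : 'I_k * 'I_k -> B) : \sum_(p in P) h p
        = \sum_(x < k) \sum_(y < k) (if (x <= y)%N then h (x, y) else 0).
      by rewrite big_mkcond pair_big; apply: eq_bigr => -[x' y'] _; rewrite inE.
    under [RHS]eq_bigr => p _ do rewrite scalerDr.
    rewrite big_split !pairs [X in _ = _ + X]exchange_big -big_split /=.
    apply: eq_bigr => x' _; rewrite -big_split; apply: eq_bigr => y' _.
    rewrite /= /a scalerDl.
    by congr (_ + _); case: ifP => // _; rewrite scale0r.
  have lP := enum_valP l; rewrite -c'E; move: lP; case: (enum_val l) => x y; rewrite inE /= => xy.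
  have := a0 x y; rewrite /a xy; case: leqP => [yx|_]; last by rewrite addr0.
  have -> : y = x by apply: val_inj; apply/eqP; rewrite eqn_leq xy yx.
  move/eqP; rewrite -mulr2n -mulr_natr mulf_eq0 (negPf twoL) orbF => /eqP //.
have sizeX : (#|P| <= (m * m.-1)./2)%N.
  have := leq_trans (dimvS XS) dimS; rewrite (eqP Xfree) size_map -cardE //.
have dimB : (n.+1 * n.+1 <= k * k)%N.
  pose Y := [seq psi p.1 p.2 | p : 'I_k * 'I_k].
  have Yfull : (fullv <= <<Y>>)%VS.
    apply/subvP => M _; have [c ->] := psi_spans M.
    apply: memv_suml => x _; apply: memv_suml => y _.
    by rewrite memvZ // memv_span //; apply/mapP; exists (x, y); rewrite ?mem_enum.
  have := leq_trans (dimvS Yfull) (dim_span _).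
  by rewrite size_map -cardE card_prod card_ord dimvf.
have := card_ordered_pairs k0; rewrite -/P.
have : (m * m.-1 <= m ^ 2)%N by rewrite -mulnn leq_mul2l leq_pred orbT.
rewrite mdim dim_split_algebra; move: sizeX dimB; clear; lia.
Qed.

(** As s switches the psi l m with a sign -1, the trace of x is a sum of terms
    a l m *: psi l m with alternating coefficients. The partial sum z over l < m
    has the same trace, and no smaller value because the psi l m split. The
    coordinates of z outside D only depend on its trace, so they are those
    of x, up to i; dropping the coordinates in D gives x'. *)
Theorem split_trace_strict x : exists z, z + s z = x + s x /\ ele (g (x + s x)) (g z).
Proof.
have [k [psi [eps [eps2 s_psi psi0 psi_spans psi_splits]]]] :=
  switch_basis fZ f_splits f_spans f_neq0 no_nil sB_sub sB_scale sB_mul sBK sB_val.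
have eps1 := switch_sign eps2 s_psi psi0 psi_spans psi_splits.
have sB_sum := split_invol_sum sB_sub sB_scale.
have [c cE] := psi_spans (phi x).
pose a l m := c l m - c m l.
have tE : phi (x + s x) = \sum_l \sum_m a l m *: psi l m.
  rewrite rmorphD -sB_phi cE sB_sum.
  rewrite [X in _ + X](eq_bigr (fun l => \sum_m (- c l m) *: psi m l)) => [|l _]; last first.
    by rewrite sB_sum; apply: eq_bigr => m _; rewrite sB_scale s_psi eps1 scaleN1r scalerN scaleNr.
  rewrite [X in _ + X]exchange_big /= -big_split; apply: eq_bigr => l _ /=.
  by rewrite -big_split; apply: eq_bigr => m _; rewrite /= -scalerDl.
pose z := \sum_(l < k) \sum_(m < k | (l < m)%N) a l m *: psi l m.
have zE : z + sB z = phi (x + s x).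
  rewrite tE /z sB_sum.
  rewrite [X in _ + X](eq_bigr (fun l : 'I_k => \sum_(m < k | (l < m)%N) a m l *: psi m l)) => [|l _]; last first.
    rewrite sB_sum; apply: eq_bigr => m _; rewrite sB_scale s_psi eps1 scaleN1r scalerN -scaleNr.
    by rewrite /a opprB.
  rewrite [X in _ + X](exchange_big_dep xpredT) //= -big_split; apply: eq_bigr => l _ /=.
  rewrite [RHS](bigID (fun m : 'I_k => (l < m)%N)) /=; congr (_ + _).
  rewrite [RHS](bigD1 l) /=; last by rewrite ltnn.
  rewrite (_ : a l l = 0) ?scale0r ?add0r; last exact: subrr.
  apply: eq_bigl => m.
  by rewrite -val_eqE /=; case: ltngtP.
have z_small b : in_gt f b (phi (x + s x)) -> in_gt f b z.
  by rewrite tE => h; do 2![apply: in_gt_sum => ? _]; apply: psi_splits.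
have [y yE] := f_spans z; have [u uE] := e_spans x.
pose x' := \sum_(l | l \notin D) u l *: e l.
have x'E : x' + s x' = x + s x.
  rewrite [in RHS]uE (bigID (mem D)) /= linearD addrACA -[LHS]add0r; congr (_ + _).
  rewrite linear_sum -big_split big1 // => l lD.
  by rewrite linearZ /= -scalerDr e_skew // scaler0.
have traces_free (c' : 'I_d -> L) : \sum_(l | l \notin D) c' l *: phi (e l + s (e l)) = 0 ->
    forall l, l \notin D -> c' l = 0.
  apply: (free_base_change_cond _ phiZ e_spans phi_e_free); first exact: rmorphD.
  move=> b b0 l lD.
  have [|b' b'E] := skew_e (x := \sum_(l | l \notin D) b l *: e l).
    by rewrite linear_sum -big_split -[RHS]b0; apply: eq_bigr => l' _; rewrite linearZ /= -scalerDr.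
  have := splits_eq0 e_splits e_neq0 (c := fun l => if l \in D then - b' l else b l).
  rewrite (bigID (mem D)) /= (eq_bigr (fun l => - (b' l *: e l))) => [|l' ->]; last by rewrite scaleNr.
  rewrite [X in _ + X](eq_bigr (fun l => b l *: e l)) => [|l' /negPf -> //].
  by rewrite sumrN b'E addNr => /(_ erefl l); rewrite (negPf lD).
have yu l : l \notin D -> y l = i (u l).
  move=> lD; apply/eqP; rewrite -subr_eq0; apply/eqP; move: l lD.
  apply: traces_free; under eq_bigr => l _ do rewrite scalerBl.
  rewrite sumrB; apply/eqP; rewrite subr_eq0; apply/eqP.
  transitivity (phi (x + s x)).
    rewrite -zE yE sB_sum -big_split [RHS](bigID (mem D)) /= [X in _ = X + _]big1 ?add0r => [|l lD].
      by apply: eq_bigr => l _; rewrite sB_scale sB_phi -scalerDr -rmorphD.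
    by rewrite sB_scale sB_phi -scalerDr -rmorphD e_skew // rmorph0 scaler0.
  rewrite -x'E linear_sum -big_split (base_change_sum (rmorphD phi) phiZ) /=.
  by apply: eq_bigr => l _; rewrite linearZ /= -scalerDr phiZ.
exists x'; split=> //.
have g_small b : in_gt g b (x + s x) -> in_gt g b x'.
  move=> h; apply: in_gt_sum => l lD.
  have : in_gt f b (y l *: phi (e l)).
    by apply: (f_splits (c := y)); rewrite -yE; apply: z_small; rewrite /in_gt f_phi.
  by rewrite yu // -phiZ /in_gt f_phi.
exact: (in_gt_ele (f := g)).
Qed.

End SplitTrace.

Section Symplectic.
Variables (G : divOrderedGroupType) (F : fieldType) (v : valuation G F).
Variables (A : falgType F) (s : 'End(A)) (K : fieldExtType F) (iK : {lrmorphism K -> A}).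
Variable g : surmultiplicative v A.
Hypothesis hens : henselian v.
Hypothesis sI : is_involution s.
Hypothesis KF : forall c : K, exists a : F, a%:A = c.
Hypothesis A_tame : tame_algebra v iK.
Hypothesis g_norm : is_norm v g.
Hypothesis g_semi : gr_semiprime g.
Hypothesis sg : forall x, g (s x) = g x.
Hypothesis type_s : 2%N \in [pchar F] \/ (2%:R != 0 :> F /\
  exists m : nat, (m ^ 2 = \dim {:A})%N /\ (\dim (fixedSpace s) = (m * m.-1)./2)%N).

(** The field extension to which [split_trace_strict] is applied is a finite
    normal extension N of K = F inside the maximal tame extension, containing
    the entries of the matrices of a base of A. Its automorphisms detect the
    leading terms of elements of F by [rigid_tame]. *)
Theorem symplectic_trace_strict x : exists z, z + s z = x + s x /\ ele (g (x + s x)) (g z).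
Proof.
have [w [vw [T [j [[C [iC [Calg T_tame]]] [n [phiT [phiT_K [m [e0 [e0_basis phi_e0_basis]]]]]]]]] _]]
  := A_tame.
have hensw := henselian_ext hens vw.
have [wC [wCext _]] := hensw C (iC \o j) Calg.
have [d [e1 [e1_splits e1_spans e1_neq0]]] := norm_splitting_basis g_norm.
have [|||e [D [e_splits e_spans e_neq0 e_skew skew_e]]] :=
  adapted_basis (rvZ g) (U := fun x => x + s x = 0) _ _ e1_splits e1_spans e1_neq0.
- by move=> y z yU zU; rewrite linearB /= addrACA yU -opprD zU subr0.
- by move=> a y yU; rewrite linearZ /= -scalerDr yU scaler0.
- by rewrite linear0 addr0.
pose S := [seq phiT (e t.1) t.2.1 t.2.2 | t : 'I_d * ('I_n.+1 * 'I_n.+1)].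
have [N [hN [hNK hNS]]] := tame_normal_closure Calg T_tame S.
have phiTZ a y : phiT (a *: y) = j a%:A *: phiT y.
  have -> : a *: y = iK a%:A * y by rewrite linearZ rmorph1 mulr_algl.
  by rewrite rmorphM phiT_K; apply: mul_scalar_mx.
have phiTN y : exists M, map_mx hN M = phiT y.
  have entries (t : 'I_n.+1 * 'I_n.+1) : exists z, hN z = phiT y t.1 t.2.
    have [c ->] := e_spans y.
    have [Y YE] := fin_all_exists (fun k : 'I_d =>
      hNS _ (map_f (fun t => phiT (e t.1) t.2.1 t.2.2) (mem_enum predT (k, t)))).
    exists (\sum_k (c k)%:A%:A * Y k); rewrite !rmorph_sum summxE; apply: eq_bigr => k _.
    by rewrite rmorphM hNK YE phiTZ mxE.
  have [Y YE] := fin_all_exists entries.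
  by exists (\matrix_(p, q) Y (p, q)); apply/matrixP => p q; rewrite !mxE YE.
have hN_inj : injective (map_mx hN : 'M_n.+1 -> 'M_n.+1) by apply: map_mx_inj.
have [phi phiE] := factor_rmorphism (h := map_mx hN) hN_inj phiTN.
pose i := in_alg N \o in_alg K.
have phiZ a y : phi (a *: y) = i a *: phi y.
  by apply: hN_inj; rewrite map_mxZ !phiE phiTZ /= hNK.
pose wN := pullback (iC \o hN) wC.
have iv : extends i v wN.
  by move=> a; rewrite /wN /= hNK; rewrite -vw; apply: wCext.
(* e0 is a base of A over K = F and of the matrices over T, hence free over N *)
have phi_e0_free (c : 'I_m -> N) : \sum_r c r *: phi (e0 r) = 0 -> forall r, c r = 0.
  move=> c0; have [b [_ bU]] := phi_e0_basis 0.
  have bE (c' : 'I_m -> T) : \sum_r c' r *: phiT (e0 r) = 0 -> b = [ffun r => c' r].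
    by move=> c'0; apply: bU; rewrite -[LHS]c'0; apply: eq_bigr => r _; rewrite ffunE.
  have b1 : b = [ffun r => hN (c r)].
    apply: bE; rewrite -[RHS](rmorph0 (map_mx hN)) -c0 rmorph_sum; apply: eq_bigr => r _.
    by rewrite /= map_mxZ phiE.
  have b0 : b = [ffun r => 0] by apply: bE; rewrite big1 // => r _; rewrite scale0r.
  move=> r; apply: (fmorph_inj hN); rewrite rmorph0.
  by have /ffunP/(_ r) := etrans (esym b1) b0; rewrite !ffunE.
have e0_spans y : exists c : 'I_m -> F, y = \sum_r c r *: e0 r.
  have [c [yE _]] := e0_basis y; have [a aE] := fin_all_exists (fun r => KF (c r)).
  exists a; rewrite yE; apply: eq_bigr => r _.
  by rewrite -aE linearZ rmorph1 mulr_algl.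
have phi_e_free : forall c : 'I_d -> N, \sum_k c k *: phi (e k) = 0 -> forall k, c k = 0.
  apply: (free_base_change (rmorphD phi) phiZ e0_spans phi_e0_free).
  exact: (splits_eq0 e_splits e_neq0).
have e0_free (c : 'I_m -> F) : \sum_r c r *: e0 r = 0 -> forall r, c r = 0.
  move=> c0 r; apply/eqP; rewrite -(fmorph_eq0 i); apply/eqP; move: r.
  apply: phi_e0_free; have := rmorph0 phi; rewrite -[in LHS]c0 rmorph_sum => phi0.
  by rewrite -[RHS]phi0; apply: eq_bigr => r _; rewrite phiZ.
have dim_d : d = (n.+1 * n.+1)%N.
  have -> : d = m.
    rewrite (spans_free_dim e0_spans e0_free).
    exact: (spans_free_dim e_spans (splits_eq0 e_splits e_neq0)).
  have spansT M : exists c : 'I_m -> T, M = \sum_r c r *: phiT (e0 r).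
    by have [c [ME _]] := phi_e0_basis M; exists c.
  rewrite (spans_free_dim spansT) ?dimvf // => c c0.
  have [b [_ bU]] := phi_e0_basis 0; move=> r.
  have b1 : b = [ffun r => c r].
    by apply: bU; rewrite -[LHS]c0; apply: eq_bigr => r' _; rewrite ffunE.
  have b0 : b = [ffun r => 0].
    by apply: bU; rewrite big1 // => r' _; rewrite ffunE scale0r.
  by have /ffunP/(_ r) := etrans (esym b1) b0; rewrite !ffunE.
have phi_e_basis : basis_of fullv [tuple phi (e k) | k < d].
  have dimN : (\dim {:'M[N]_n.+1} <= d)%N by rewrite dimvf dim_d.
  rewrite basisEfree subvf size_tuple dimN !andbT.
  apply/freeP => c c0; apply: phi_e_free; rewrite -[RHS]c0.
  by apply: eq_bigr => k _; rewrite -tnth_nth tnth_mktuple.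
have hNi (c : K) : (iC \o hN) c%:A = (iC \o j) c by rewrite /= hNK.
pose Gal (t : {rmorphism N -> N}) := K_automorphism t.
have Gal_fix t : Gal t -> forall a, t (i a) = i a by case=> tK _ a; apply: tK.
have Gal_val t : Gal t -> forall y, wN (t y) = wN y.
  by case=> tK _ y; apply: (val_aut hensw wCext (h := iC \o hN)).
have Gal_inv t : Gal t -> exists t' : {rmorphism N -> N}, Gal t' /\ cancel t t'.
  case=> tK [t' [t'K tt' t't]]; exists t'; split=> //; split=> //.
  by exists t.
have Gal_rigid y c : wN y = Some c -> (forall t : {rmorphism N -> N}, Gal t -> in_gt wN c (t y - y)) ->
    exists a : F, in_gt wN c (y - i a).
  move=> yc rigid_y.
  have [L [wL [h [tL hL [l hl]]]]] := (T_tame (iC (hN y))).1 (ex_intro _ _ erefl).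
  have wl : wC (h l) = Some c by rewrite hl.
  have [|a aE] := rigid_tame hensw Calg wCext tL hL wl.
    move=> z; rewrite hl => yz.
    have [y' [t [tG ty' <-]]] := conjugate_lift hNi yz.
    by have := rigid_y t tG; rewrite ty' /in_gt /= rmorphB /= rmorphB.
  have [a' a'E] := KF a; exists a'; move: aE.
  by rewrite hl -a'E /in_gt /= !rmorphB /= hNK.
have [f [sB [[fZ f_phi f_splits f_spans f_neq0] no_nil [sB_sub sB_scale sB_mul sBK [sB_val sB_phi]]]]] :=
  split_extension iv phiZ e_splits e_spans e_neq0 phi_e_basis g_semi Gal_fix Gal_val Gal_inv Gal_rigid sI sg.
exact: (split_trace_strict phiZ e_splits e_spans e_neq0 e_skew skew_e fZ f_phi f_splits f_spans f_neq0
  no_nil sB_sub sB_scale sB_mul sBK sB_val sB_phi sI type_s).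
Qed.

End Symplectic.

(** * Traces through the centre *)
Section CentralTrace.
Variables (G : divOrderedGroupType) (F : fieldType) (v : valuation G F).
Variables (A : falgType F) (s : 'End(A)) (g : surmultiplicative v A).
Hypothesis sI : is_involution s.

(** For a symmetric t, the trace of u t is (u + s u) t = t. *)
Lemma central_trace_strict u : (forall y, u * y = y * u) -> u + s u = 1 -> in_ge g 0 u ->
  forall x, exists z, z + s z = x + s x /\ ele (g (x + s x)) (g z).
Proof.
move=> uC u1 u0 x; exists (u * (x + s x)); split.
  rewrite (involM sI) linearD /= (involK sI) [s x + x]addrC uC -mulrDr u1 mulr1 //.
apply: (in_gt_ele (f := g)) => c h.
by rewrite -[c]add0r; apply: in_gtMr.
Qed.

(** If u had a negative value d, then u y u = u^2 y = (u - n) y would be small in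
    degree d + b + d for every y of degree b, against semiprimeness. *)
Lemma central_quadratic_ge0 u (n : F) : gr_semiprime g -> (forall y, u * y = y * u) ->
  u * u = u - n%:A -> in_ge v 0 n -> in_ge g 0 u.
Proof.
move=> g_semi uC u2 n0; have [->|uN0] := eqVneq u 0; first exact: in_ge0.
have [d gu] := rv_exists g uN0; rewrite (in_geE 0 gu) leGNgt; apply/negP => d0.
have /andP[ud uNd] : in_ge g d u && ~~ in_gt g d u by apply/(rv_eqP g).
have [b [y [yb /negP]]] := g_semi _ _ ud uNd; apply.
have -> : u * y * u = u * y - n *: y.
  by rewrite -mulrA -uC mulrA u2 mulrBl mulr_algl.
apply: in_gtB.
  apply: (@in_ge_lt _ _ _ (d + b)); last exact: in_geM.
  by rewrite -[X in _ < X]addr0 ltGD2l.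
apply: (@in_ge_lt _ _ _ (0 + b)); last exact: (in_geZ (rvZ g)).
by rewrite addrAC ltGD2r -[0]addr0; apply: (lt_trans (y := d + 0)); rewrite ?ltGD2l ?ltGD2r.
Qed.

Lemma half_trace : 2%:R != 0 :> F -> 2%:R^-1 *: 1 + s (2%:R^-1 *: 1) = 1.
Proof.
move=> two0; rewrite linearZ /= (invol1 sI) -scalerDl.
by rewrite -mulr2n -[_ *+ 2]mulr_natr mulVf // scale1r.
Qed.

Lemma val_two : 2%N \notin [pchar residue_field v] -> v 2%:R = Some 0.
Proof.
move=> ch; apply/(rv_eqP v); rewrite in_ge_nat /= -red_eq0 ?in_ge_nat //.
by rewrite red_nat; apply: contra ch => two0; rewrite inE.
Qed.

Lemma central_half : 2%N \notin [pchar residue_field v] ->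
  exists u, [/\ forall y, u * y = y * u, u + s u = 1 & in_ge g 0 u].
Proof.
move=> /val_two v2; have two0 : 2%:R != 0 :> F by apply/eqP => /(val_oo v); rewrite v2.
exists (2%:R^-1 *: 1); split; [|exact: half_trace|].
  by move=> y; rewrite mulr_algl mulr_algr.
rewrite -[0]addr0 (in_geZE (rvZ g) 0 1 (c := 0)) ?in_ge_1 //.
by rewrite (val_inv v2) oppr0.
Qed.

End CentralTrace.

Lemma centerP (F : fieldType) (A : falgType F) (z : A) :
  reflect (forall y, z * y = y * z) (z \in 'Z({:A})%VS).
Proof.
rewrite memv_cap memvf; apply: (iffP centvP) => [h y|h y _]; last exact: h.
by rewrite h ?memvf.
Qed.

(** There are no new values and no new residues, so e = f = 1, and tame
    extensions are defectless. *)
Lemma tame_immediate_trivial (G : divOrderedGroupType) (F : fieldType) (K : fieldExtType F)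
    (v : valuation G F) (w : valuation G K) : tame_extension v w ->
  (forall c d, w c = Some d -> exists a : F, in_gt w d (c - a%:A)) ->
  forall c : K, exists a : F, a%:A = c.
Proof.
case=> [vw [e [d [[r [r_val r_uniq]] [b b_basis] dimK _ _]]]] approx.
have values c x : w c = Some x -> exists a : F, v a = Some x.
  move=> wc; have [a aE] := approx c x wc; exists a.
  rewrite -[v a]vw; apply/(rv_eqP w).
  by rewrite -(in_gt_subE aE) -(in_ge_subE aE); apply/(rv_eqP w).
have e1 : (e <= 1)%N.
  rewrite leqNgt; apply/negP => e2.
  pose k0 := Ordinal (ltnW e2); pose k1 := Ordinal e2.
  have [x wx] := r_val k0; have [a va] := values _ _ wx.
  have [k [_ kU]] := r_uniq _ (ex_intro _ x wx).
  have kE k' : k = k'.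
    have [x' wx'] := r_val k'; have [a' va'] := values _ _ wx'.
    by apply: kU; exists (a / a'); apply: val_div.
  by have := congr1 val (etrans (esym (kE k0)) (kE k1)).
have res_surj (x : residue_field w) : exists a, residue_ext vw a = x.
  have [y [y0 <-]] := red_surj x.
  have [y00|yN] := boolP (in_gt w 0 y).
    exists (red v 0); rewrite residue_ext_red ?in_ge0 // rmorph0 red0.
    by apply/esym/eqP; rewrite red_eq0.
  have [|a aE] := approx y 0; first by apply/(rv_eqP w); rewrite y0.
  have a0 : in_ge w 0 a%:A by rewrite -(in_ge_subE aE).
  exists (red v a); rewrite residue_ext_red; last by rewrite -(ext_in_ge vw).
  by apply/esym/eqP; rewrite -subr_eq0 -redB // red_eq0 // in_geB.
have [rho rhoE] := residue_ext_rmorphism vw.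
have b_free (c : 'I_d -> residue_field v) :
    \sum_k residue_ext vw (c k) * b k = 0 -> forall k, c k = 0.
  move=> c0; have [c' [_ cU]] := b_basis 0.
  have h1 : c' = [ffun k => c k].
    by apply: cU; rewrite -[LHS]c0; apply: eq_bigr => k _; rewrite ffunE.
  have h0 : c' = [ffun k => 0].
    by apply: cU; rewrite big1 // => k _; rewrite ffunE -rhoE rmorph0 mul0r.
  by move=> k; have /ffunP/(_ k) := etrans (esym h1) h0; rewrite !ffunE.
have d1 : (d <= 1)%N.
  rewrite leqNgt; apply/negP => d2.
  pose k0 := Ordinal (ltnW d2); pose k1 := Ordinal d2.
  have [c0 c0E] := res_surj (b k0); have [c1 c1E] := res_surj (b k1).
  have b_neq0 (k : 'I_d) : b k != 0.
    apply/eqP => bk; suff /eqP : 1 = 0 :> residue_field v by rewrite oner_eq0.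
    have := b_free (fun l => (l == k)%:R) _ k; rewrite eqxx; apply.
    rewrite (bigD1 k) //= bk mulr0 add0r big1 // => l /negPf ->.
    by rewrite -rhoE rmorph0 mul0r.
  have := b_free (fun l => if l == k0 then c1 else if l == k1 then - c0 else 0) _ k0.
  rewrite eqxx => c10; have := b_neq0 k1; rewrite -c1E c10 -?rhoE ?rmorph0 ?eqxx //.
  rewrite (bigD1 k0) // (bigD1 k1) //= big1 ?addr0.
    by rewrite c1E -rhoE rmorphN rhoE c0E mulNr [X in X - _]mulrC subrr.
  by move=> l /andP[/negPf -> /negPf ->]; rewrite -rhoE rmorph0 mul0r.
have dim1 : (\dim {:K} <= 1)%N by rewrite dimK; move: e1 d1; case: e d {r r_val r_uniq b b_basis dimK b_free} => [|[|]] // [|[|]].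
move=> c; have : c \in 1%AS.
  by rewrite (_ : 1%AS = fullv :> {vspace K}) ?memvf //; apply/eqP; rewrite eqEdim subvf dimv1.
by case/vlineP => a ->; exists a.
Qed.

Section Unitary.
Variables (G : divOrderedGroupType) (F : fieldType) (v : valuation G F).
Variables (A : falgType F) (s : 'End(A)) (K : fieldExtType F) (iK : {lrmorphism K -> A}).
Variable g : surmultiplicative v A.
Hypothesis hens : henselian v.
Hypothesis sI : is_involution s.
Hypothesis K_center : is_center iK.
Hypothesis F_fixed : forall c : K, s (iK c) = iK c <-> exists a : F, a%:A = c.
Hypothesis A_tame : tame_algebra v iK.
Hypothesis g_semi : gr_semiprime g.

Lemma iK_central c y : iK c * y = y * iK c.
Proof. by move: y; apply/centerP/K_center; exists c. Qed.

Lemma center_involution : exists t : {rmorphism K -> K},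
  [/\ forall c, iK (t c) = s (iK c), forall a : F, t a%:A = a%:A & forall c, t (t c) = c].
Proof.
have fB : zmod_morphism (s \o iK) by move=> x y; rewrite /= raddfB linearB.
have fM : monoid_morphism (s \o iK).
  split=> [|x y]; first by rewrite /= rmorph1 (invol1 sI).
  by rewrite /= mulrC rmorphM (involM sI).
pose f : {rmorphism K -> A} := HB.pack (s \o iK)
  (GRing.isZmodMorphism.Build _ _ (s \o iK) fB) (GRing.isMonoidMorphism.Build _ _ (s \o iK) fM).
have iK_inj : injective iK by apply: fmorph_inj.
have [|t tE] := factor_rmorphism (f := f) iK_inj.
  move=> c; apply/K_center/centerP => y.
  by rewrite -[y](involK sI) /= -!(involM sI) iK_central.
exists t; split=> [c|a|c]; first exact: tE.
  by apply: iK_inj; rewrite tE /=; apply/F_fixed; exists a.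
by apply: iK_inj; rewrite tE /= tE /= (involK sI).
Qed.

(** Let t be the restriction of s to K. Suppose that t c - c has the same value
    as c for some c. As 2 c is small, so has c + t c, which lies in F; then
    u = c / (c + t c) has trace 1. Otherwise c and t c, which are all the
    conjugates of c, always have the same leading term. By [rigid_tame] the
    field K has then no leading terms but those of F, and K = F by
    [tame_immediate_trivial], against the assumption on s. *)
Lemma unitary_central_trace : 2%N \in [pchar residue_field v] -> ~ trivial_on_center s ->
  exists u, [/\ forall y, u * y = y * u, u + s u = 1 & in_ge g 0 u].
Proof.
move=> ch2 nontrivial; have [t [tE tF tK]] := center_involution.
have iK_inj : injective iK by apply: fmorph_inj.
have fixed c : t c = c -> exists a : F, a%:A = c by move=> tc; apply/F_fixed; rewrite -tE tc.
have [w [vw [T [j [[C [iC [Calg _]]] _]]] tame_w]] := A_tame.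
have vwE (b : F) : w b%:A = v b by apply: vw.
have val_t c : w (t c) = w c.
  have vt : extends (in_alg K) v (pullback t w) by move=> a; rewrite /= tF; apply: vw.
  exact: (henselian_unique hens (@fieldExt_algebraic F K) vt vw).
have two_small c d : in_ge w d c -> in_gt w d (c *+ 2).
  move=> cd; rewrite -mulr_natl -[d]add0r; apply: in_gtMl => //.
  rewrite -(rmorph_nat (in_alg K)) (ext_in_gt vw) -red_eq0 ?in_ge_nat // red_nat.
  by move: ch2; rewrite inE => /andP[].
have [[c [c0 cmoved]]|] := classic (exists c d, w c = Some d /\ ~~ in_gt w d (t c - c)).
  have cd : in_ge w c0 c && ~~ in_gt w c0 c by apply/(rv_eqP w); case: cmoved.
  case: cmoved => wc moved.
  have [|a aE] := fixed (c + t c); first by rewrite rmorphD tK addrC.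
  have va : v a = Some c0.
    have sumE : in_gt w c0 (c + t c - (t c - c)).
      by rewrite opprB addrACA subrr addr0 -mulr2n; apply: two_small; case/andP: cd.
    rewrite -vwE aE; apply/(rv_eqP w).
    have tcd : in_ge w c0 (t c) by have /(rv_eqP w)/andP[] : w (t c) = Some c0 by rewrite val_t.
    by rewrite (in_gt_subE sumE) moved andbT in_geD //; case/andP: cd.
  have a0 : a != 0 by apply/eqP => /(val_oo v); rewrite va.
  pose u := a^-1 *: c; have tu : u + t u = 1.
    rewrite /u -mulr_algl rmorphM tF -mulrDr -aE mulr_algl scalerA mulVf ?scale1r //.
  have wu : w u = Some 0.
    rewrite /u -mulr_algl val_M wc vwE (val_inv va) /= addNr //.
  have [|n nE] := fixed (u * t u); first by rewrite rmorphM tK mulrC.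
  have vn : v n = Some 0 by rewrite -vwE nE val_M val_t wu /= addr0.
  exists (iK u); split; [exact: iK_central | by rewrite -tE -rmorphD tu rmorph1|].
  apply: (central_quadratic_ge0 (n := n)) => //; [exact: iK_central | | by have /(rv_eqP v)/andP[] := vn].
  rewrite -(rmorph_alg iK) -rmorphB -rmorphM nE; congr (iK _).
  by apply/eqP; rewrite eq_sym subr_eq -mulrDr tu mulr1.
move=> rigid_all; case: nontrivial => z /K_center[c <-].
suff [a aE] : exists a : F, a%:A = c by apply/F_fixed; exists a.
move: c; apply: (tame_immediate_trivial tame_w) => c d wc.
pose i := (iC \o j) \o in_alg K.
have ialg : forall z : C, algebraicOver i z.
  by move=> y; apply: algebraic_trans (Calg y) => x; apply: fieldExt_algebraic.
have [wC [wCext _]] := hens ialg.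
have wCw : extends (iC \o j) w wC.
  move=> x.
  have vi : extends (in_alg K) v (pullback (iC \o j) wC) by move=> a; apply: wCext.
  exact: (henselian_unique hens (@fieldExt_algebraic F K) vi vw).
have [|||a aE] := rigid_tame hens ialg wCext (h := iC \o j) (l := c) (d := d) tame_w.
- by [].
- by rewrite wCw.
- move=> y cy.
  have [|a aE] := fixed (c + t c); first by rewrite rmorphD tK addrC.
  have [|n nE] := fixed (c * t c); first by rewrite rmorphM tK mulrC.
  pose q : {poly F} := 'X^2 - a *: 'X + n%:P.
  have qE : map_poly i q = ('X - ((iC \o j) c)%:P) * ('X - ((iC \o j) (t c))%:P).
    rewrite /q rmorphD rmorphB /= map_polyXn map_polyZ map_polyX map_polyC /=.
    rewrite aE nE !rmorphD !rmorphM /=.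
    by rewrite -mul_polyC; ring.
  have : root (map_poly i q) y by apply: cy; rewrite qE rootM root_XsubC eqxx.
  rewrite qE rootM !root_XsubC => /orP[] /eqP ->; first by rewrite subrr in_gt0.
  rewrite -rmorphB (ext_in_gt wCw); apply: wlog_neg => moved; case: rigid_all.
  by exists c, d.
by exists a; rewrite -(ext_in_gt wCw) rmorphB.
Qed.

End Unitary.

(** * Comparison of the three conditions *)
Section GradedAnisotropy.
Variables (G : divOrderedGroupType) (F : fieldType) (v : valuation G F).
Variables (A : falgType F) (s : 'End(A)) (g : surmultiplicative v A).
Hypothesis sg : forall x, g (s x) = g x.

Lemma gr_anisotropicP : gr_anisotropic sg <->
  forall c x, in_ge g c x -> in_gt g (c + c) (s x * x) -> in_gt g c x.
Proof.
split=> [aniso c x xc small|aniso c a].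
  have := aniso c (\pi_(gr g c) (Filtered (xc : x \in in_ge g c))).
  rewrite /gr_involution gr_mapE ?gr_mulE => [|? ?]; last exact: linearB.
  by move=> h; apply/idP; rewrite -(gr_eq0E (Filtered (xc : x \in in_ge g c))) h //; apply/eqP; rewrite gr_eq0E.
elim/quotW: a => x /eqP; rewrite /gr_involution gr_mapE ?gr_mulE => [|? ?]; last exact: linearB.
rewrite gr_eq0E => small; apply/eqP; rewrite gr_eq0E; apply: aniso => //.
exact: filtered_valP.
Qed.

Lemma residue_anisotropicP : anisotropic (residue_involution sg) <->
  forall x, in_ge g 0 x -> in_gt g 0 (s x * x) -> in_gt g 0 x.
Proof.
split=> [aniso x x0 small|aniso a].
  have := aniso (\pi_(gr g 0) (Filtered (x0 : x \in in_ge g 0))).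
  rewrite /residue_involution /gr_involution gr_mapE => [|? ?]; last exact: linearB.
  move=> h; apply/idP; rewrite -(gr_eq0E (Filtered (x0 : x \in in_ge g 0))) h //.
  by apply/eqP; rewrite -[_ * _]/(res_mul _ _) res_mulE gr_eq0E.
elim/quotW: a => x; rewrite /residue_involution /gr_involution gr_mapE => [|? ?]; last exact: linearB.
rewrite -[_ * _]/(res_mul _ _) res_mulE => /eqP; rewrite gr_eq0E => small.
apply/eqP; rewrite gr_eq0E; apply: aniso => //; exact: filtered_valP.
Qed.

(** If the leading term of x is isotropic, then so is that of x y, where y is
    given by [right_ideal_fixes]; and x y, fixing a nonzero element, is not
    small. *)
Lemma residue_anisotropic_gr : is_involution s -> gr_semiprime g ->
  anisotropic (residue_involution sg) -> gr_anisotropic sg.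
Proof.
move=> sI g_semi /residue_anisotropicP aniso; apply/gr_anisotropicP => c x xc small.
apply: wlog_neg => big; have [y [z [d [yc zd xz_big xyxz]]]] := right_ideal_fixes g_semi xc big.
have xy0 : in_ge g 0 (x * y) by rewrite -[0](subrr c); apply: in_geM.
have xy_small : in_gt g 0 (x * y).
  apply: aniso => //; rewrite (involM sI) -mulrA (mulrA (s x)).
  rewrite (_ : 0 = - c + ((c + c) + - c)); last by rewrite addrK addNr.
  by apply: in_gtMr; [rewrite (invol_ge sg) | apply: in_gtMl].
case/negP: xz_big; rewrite -(in_gt_subE xyxz) -[c + d]add0r.
by apply: in_gtMl => //; apply: in_geM.
Qed.

End GradedAnisotropy.

Section Traces.
Variables (G : divOrderedGroupType) (F : fieldType) (v : valuation G F).
Variables (A : falgType F) (s : 'End(A)) (K : fieldExtType F) (iK : {lrmorphism K -> A}).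
Variable g : surmultiplicative v A.
Hypothesis hens : henselian v.
Hypothesis sI : is_involution s.
Hypothesis K_center : is_center iK.
Hypothesis F_fixed : forall c : K, s (iK c) = iK c <-> exists a : F, a%:A = c.
Hypothesis A_tame : tame_algebra v iK.
Hypothesis s_type : 2%N \in [pchar residue_field v] -> ~ orthogonal_involution s.
Hypothesis g_gauge : is_gauge g.
Hypothesis sg : forall x, g (s x) = g x.

(** In residue characteristic other than 2, one half is available. In residue
    characteristic 2, an involution that is not orthogonal is either nontrivial
    on K, or symplectic with K = F. *)
Lemma trace_properties :
  (forall x, exists z, z + s z = x + s x /\ ele (g (x + s x)) (g z)) /\ (exists x, x + s x = 1).
Proof.
have g_semi := gr_semisimple_semiprime g_gauge.2.
have of_central : (exists u, [/\ forall y, u * y = y * u, u + s u = 1 & in_ge g 0 u]) ->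
    (forall x, exists z, z + s z = x + s x /\ ele (g (x + s x)) (g z)) /\ (exists x, x + s x = 1).
  by case=> u [uC u1 u0]; split; [exact: (central_trace_strict sI uC u1 u0) | exists u].
have [ch2|ch2] := boolP (2%N \in [pchar residue_field v]); last exact: of_central (central_half g sI ch2).
have [trivial|nontrivial] := classic (trivial_on_center s); last first.
  exact: of_central (unitary_central_trace hens sI K_center F_fixed A_tame g_semi ch2 nontrivial).
have [sympl|not_sympl] := classic (symplectic_involution s); last by case: (s_type ch2).
have KF (c : K) : exists a : F, a%:A = c.
  by apply/F_fixed; apply: trivial; apply/K_center; exists c.
have dimZ : \dim 'Z({:A})%VS = 1%N.
  suff -> : 'Z({:A})%VS = 1%VS by rewrite dimv1.
  apply/eqP; rewrite eqEsubv; apply/andP; split; apply/subvP => z.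
    case/K_center => c <-; have [a <-] := KF c.
    by rewrite linearZ rmorph1 memvZ ?memv_line.
  by case/vlineP => a ->; apply/centerP => y; rewrite mulr_algl mulr_algr.
have type_s : 2%N \in [pchar F] \/ (2%:R != 0 :> F /\
    exists m : nat, (m ^ 2 = \dim {:A})%N /\ (\dim (fixedSpace s) = (m * m.-1)./2)%N).
  case: sympl => _ [[two0 [m [m2 mfix]]]|[ch2F _]]; [right|by left].
  split; first by move: two0; rewrite inE.
  by exists m; move: m2 mfix; rewrite dimZ !divn1.
split; first exact: (symplectic_trace_strict hens sI KF A_tame g_gauge.1 g_semi sg type_s).
case: sympl => _ [[two0 _]|[_ [x x1]]]; last by exists x.
by exists (2%:R^-1 *: 1); apply: (half_trace sI); move: two0; rewrite inE.
Qed.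

Lemma anisotropic_gr : anisotropic s -> gr_anisotropic sg.
Proof.
move=> aniso; apply/gr_anisotropicP => c x xc small; apply: wlog_neg => big.
have [trace_strict trace_one] := trace_properties.
have [w [_ [T [j [[C [iC [Calg _]]] _]]] _]] := A_tame.
have ialg : forall z : C, algebraicOver ((iC \o j) \o in_alg K) z.
  by move=> y; apply: algebraic_trans (Calg y) => a; apply: fieldExt_algebraic.
have [wC [wCext _]] := hens ialg.
have g_semi := gr_semisimple_semiprime g_gauge.2.
have [f f0 /aniso] := isotropic_lift sI sg hens ialg wCext g_gauge.1 trace_strict trace_one g_semi xc big small.
by move=> f00; rewrite f00 eqxx in f0.
Qed.

End Traces.

Theorem corollary2p3 (G : divOrderedGroupType) (F : fieldType)
    (v : valuation G F) (A : falgType F) (sigma : 'End(A))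
    (K : fieldExtType F) (iK : {lrmorphism K -> A})
    (g : surmultiplicative v A)
    (v_henselian : henselian v)
    (A_simple : simple_ring A)
    (sigma_inv : is_involution sigma)
    (K_center : is_center iK)
    (F_fixed : forall c : K, sigma (iK c) = iK c <-> exists a : F, a%:A = c)
    (A_tame : tame_algebra v iK)
    (sigma_type : 2%N \in [pchar residue_field v] -> ~ orthogonal_involution sigma)
    (g_gauge : is_gauge g)
    (sigma_g : forall x, g (sigma x) = g x) :
  (anisotropic sigma <-> gr_anisotropic sigma_g) /\
  (gr_anisotropic sigma_g <-> anisotropic (residue_involution sigma_g)).
Proof.
split; split.
- exact: anisotropic_gr.
- move=> /gr_anisotropicP aniso x sxx; apply/eqP; apply: contraT => x0.
  have [c gx] := rv_exists g x0; have /(rv_eqP g)/andP[xc] := gx.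
  by rewrite (aniso c x xc) // sxx in_gt0.
- move=> /gr_anisotropicP aniso; apply/residue_anisotropicP => x x0 small.
  by apply: aniso; rewrite ?addr0.
- apply: residue_anisotropic_gr => //; exact: gr_semisimple_semiprime g_gauge.2.
Qed.
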